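(* Let $\Sigma=(A,B,C,D;\mathcal X,\mathcal U,\mathcal Y)$ be a minimal realization of the inner function $\theta\in\mathcal S(\mathcal U,\mathcal Y)$. Then $\mathrm{RI}_\Sigma^\circ$ consists of a single element, $H_\circ$ say, and $\delta_\Sigma(H_\circ)=0$.
   Context: A system $\Sigma=(A,B,C,D;\mathcal X,\mathcal U,\mathcal Y)$ is the discrete time-invariant linear system $x_{n+1}=Ax_n+Bu_n$, $y_n=Cx_n+Du_n$ $(n\ge 0)$, where $A:\mathcal X\to\mathcal X$, $B:\mathcal U\to\mathcal X$, $C:\mathcal X\to\mathcal Y$, $D:\mathcal U\to\mathcal Y$ are bounded linear operators between separable (complex) Hilbert spaces. Its transfer function is $\theta_\Sigma(\lambda)=D+\lambda C(I-\lambda A)^{-1}B$, defined for those $\lambda\in\mathbb C$ for which $I-\lambda A$ is boundedly invertible. Put $\operatorname{Im}(A|B)=\operatorname{span}\{\operatorname{Im}A^nB\mid n\ge 0\}$ (linear span, not closed), $\operatorname{Im}(A^*|C^* )=\operatorname{span}\{\operatorname{Im}(A^* )^nC^*\mid n\ge0\}$ and $\operatorname{Ker}(C|A)=\bigcap_{n\ge0}\operatorname{Ker}CA^n$. $\Sigma$ is minimal if $\operatorname{Im}(A|B)$ is dense in $\mathcal X$ and $\operatorname{Ker}(C|A)=\{0\}$. The Schur class $\mathcal S(\mathcal U,\mathcal Y)$ consists of the functions $\theta$ analytic on the open unit disc $\mathbb D$ with values bounded operators $\mathcal U\to\mathcal Y$ with $\|\theta(z)\|\le1$ for all $z\in\mathbb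 D$. $\theta$ is inner if its boundary values satisfy $\theta(\zeta)^*\theta(\zeta)=I_{\mathcal U}$ for almost every $\zeta$ in the unit circle $\mathbb T$. $\Sigma$ is a realization of $\theta$ if $\theta_\Sigma$ coincides with $\theta$ in a neighborhood of zero. For a bounded selfadjoint operator $T$ on a Hilbert space $\mathcal H$, put $\mathcal H_1=\overline{T\mathcal H}$, $\mathcal H_2=\operatorname{Ker}T=\mathcal H\ominus\mathcal H_1$, $T_1=T|_{\mathcal H_1}$ (injective on $\mathcal H_1$). The Moore--Penrose pseudo-inverse $T^{[-1]}$ is the (possibly unbounded) selfadjoint operator with domain $\operatorname{Im}T_1\oplus\mathcal H_2$ acting as $T_1^{-1}$ on $\operatorname{Im}T_1$ and as $0$ on $\mathcal H_2$. $\mathcal D(\cdot)$ denotes the domain of an operator. $\mathrm{RI}_\Sigma$ is the set of all (possibly unbounded) selfadjoint operators $H$ in $\mathcal X$ such that: (1) $\langle Hx,x\rangle>0$ for each $0\ne x\in\mathcal D(H)$; (2) $A\mathcal D(H^{1/2})\subset\mathcal D(H^{1/2})$ and $B\mathcal U\subset\mathcal D(H^{1/2})$ (so $H^{1/2}B:\mathcal U\to\mathcal X$ is bounded); (3) the operator $\delta_\Sigma(H)=I_{\mathcal U}-D^*D-(H^{1/2}B)^*H^{1/2}B$ is bounded and nonnegative, and $\big(D^*C+(H^{1/2}B)^*H^{1/2}A\big)\mathcal D(H^{1/2})\subset\delta_\Sigma(H)^{1/2}\mathcal U$; (4) for each $x\in\mathcal D(H^{1/2})$, $$\|H^{1/2}x\|^2-\|H^{1/2}Ax\|^2-\|Cx\|^2\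 \ge\ \big\|\big(\delta_\Sigma(H)^{1/2}\big)^{[-1]}\big(D^*C+(H^{1/2}B)^*H^{1/2}A\big)x\big\|^2 .$$ For $H\in\mathrm{RI}_\Sigma$ one has $\operatorname{Im}(A|B)\subset\mathcal D(H^{1/2})$ and $\operatorname{Im}(A^*|C^* )\subset\mathcal D(H^{-1/2})$. $\mathrm{RI}_\Sigma^\circ$ is the set of all $H\in\mathrm{RI}_\Sigma$ such that (a) both $H^{1/2}\operatorname{Im}(A|B)$ and $H^{-1/2}\operatorname{Im}(A^*|C^* )$ are dense in $\mathcal X$, and (b) $\operatorname{Im}(A|B)$ is a core for $H^{1/2}$, i.e. $\{(u,H^{1/2}u)\mid u\in\operatorname{Im}(A|B)\}$ is dense in the graph of $H^{1/2}$ with respect to the graph norm. *)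

(* Defs.v *)
From HB Require Import structures.
From mathcomp Require Import all_boot all_order all_algebra.
From mathcomp Require Import all_classical all_reals all_analysis.
From mathcomp Require Export complex.

Set Implicit Arguments.
Unset Strict Implicit.
Unset Printing Implicit Defensive.

Import Order.TTheory GRing.Theory Num.Theory.
Import numFieldNormedType.Exports.

Local Open Scope classical_set_scope.
Local Open Scope ring_scope.
Local Open Scope complex_scope.

(* The complex numbers are [R[i]] with [R : realType]; norms and inner products
   take values in [R[i]], whose order [x <= y] forces [y - x] to be real. *)

(* [{dot H for Num.conj}] is linear in its first argument, conjugate-linear in
   the second one, hermitian and positive definite. *)
HB.mixin Record isHilbert (R : realType) (H : Type)
    of CompleteNormedModule R[i] H := {
  ip : {dot H for Num.conj} ;
  ip_normE : forall x : H, `|x| ^+ 2 = ip x x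
}.

#[short(type="hilbertType")]
HB.structure Definition Hilbert (R : realType) :=
  {H of CompleteNormedModule R[i] H & isHilbert R H}.

Definition separable (T : topologicalType) :=
  exists2 E : set T, countable E & dense E.

Section bounded_operators.
Context {R : realType}.

Record bop (U V : hilbertType R) := Bop {
  bop_fun :> {linear U -> V} ;
  bop_cont : continuous bop_fun }.

End bounded_operators.

(* Possibly unbounded operators are represented by their graphs, so that equality
    of operators includes equality of their domains.  The domain and the range
    of [T] are [T.`1] and [T.`2]. *)

Notation pop X Y := (set (X * Y)).

Section unbounded_operators.
Context {R : realType}.
Implicit Types X Y : hilbertType R.

Definition graph X Y (f : X -> Y) : pop X Y := [set p | p.2 = f p.1].

Definition is_operator X Y (T : pop X Y) :=
  [/\ T (0, 0),
      forall (a : R[i]) x y x' y', T (x, y) -> T (x', y') ->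
        T (a *: x + x', a *: y + y')
    & forall x y y', T (x, y) -> T (x, y') -> y = y'].

(* value of [T] at a point of its domain; 0 elsewhere *)
Definition papp X Y (T : pop X Y) (x : X) : Y := xget 0 [set y | T (x, y)].

Definition pimage X Y (T : pop X Y) (L : set X) : set Y :=
  [set y | exists2 x, L x & T (x, y)].

Definition padjoint X Y (T : pop X Y) : pop Y X :=
  [set p | forall x w, T (x, w) -> ip w p.1 = ip x p.2].

(* meaningful for an everywhere defined bounded [f]: [padjoint (graph f)] is
   then the graph of an everywhere defined operator *)
Definition adjoint X Y (f : X -> Y) : Y -> X := papp (padjoint (graph f)).

Definition selfadjoint X (T : pop X X) :=
  [/\ is_operator T, dense T.`1 & padjoint T = T].

Definition nonnegative X (T : pop X X) :=
  forall x y, T (x, y) -> 0 <= ip y x.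

(* the nonnegative selfadjoint square root, which exists and is unique
   when [T] is selfadjoint and nonnegative *)
Definition psqrt X (T : pop X X) : pop X X :=
  xget set0 [set S : pop X X |
    [/\ selfadjoint S, nonnegative S & (S \; S)%relation = T]].

(* Moore-Penrose pseudo-inverse: [T x + z |-> x] for [x] in the closure of the
   range of [T] and [z] in the kernel of [T] *)
Definition mpinv X (T : pop X X) : pop X X :=
  [set p | exists y z,
    [/\ p.1 = y + z, T (p.2, y), closure T.`2 p.2 & T (z, 0)]].

Definition graph_norm X Y (p : X * Y) : R[i] :=
  sqrtC (`|p.1| ^+ 2 + `|p.2| ^+ 2).

Definition is_core X Y (L : set X) (T : pop X Y) :=
  L `<=` T.`1 /\
  forall p, T p -> forall e : R[i], 0 < e ->
    exists q, [/\ T q, L q.1 & graph_norm (p - q) < e].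

Definition lspan X (E : set X) : set X :=
  [set x | exists n (a : 'I_n -> R[i]) (v : 'I_n -> X),
    (forall i, E (v i)) /\ x = \sum_(i < n) a i *: v i].

End unbounded_operators.

Record system (R : realType) (X U Y : hilbertType R) := System {
  sysA : bop X X ;
  sysB : bop U X ;
  sysC : bop X Y ;
  sysD : bop U Y }.

Section systems.
Context {R : realType} {X U Y : hilbertType R}.
Variable S : system X U Y.

Let A := sysA S.
Let B := sysB S.
Let C := sysC S.
Let D := sysD S.

Definition tf_dom : set R[i] :=
  [set l | exists Q : bop X X,
    (forall x, Q (x - l *: A x) = x) /\ (forall x, Q x - l *: A (Q x) = x)].

Definition transfer (l : R[i]) (u : U) : Y :=
  D u + l *: C (papp ((graph (fun x => x - l *: A x))^-1)%relation (B u)).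

Definition is_realization (theta : R[i] -> bop U Y) :=
  \forall l \near (0 : R[i]^o),
    tf_dom l /\ forall u, transfer l u = theta l u.

Definition ImAB : set X :=
  lspan [set x | exists n u, x = iter n A (B u)].

Definition ImAC : set X :=
  lspan [set x | exists n y, x = iter n (adjoint A) (adjoint C y)].

Definition KerCA : set X := \bigcap_n [set x | C (iter n A x) = 0].

Definition minimal := dense ImAB /\ KerCA = [set 0].

(* [H^{1/2} B] *)
Definition hB (H : pop X X) : U -> X := fun u => papp (psqrt H) (B u).

Definition delta (H : pop X X) : U -> U :=
  fun u => u - adjoint D (D u) - adjoint (hB H) (hB H u).

(* [D^* C + (H^{1/2} B)^* H^{1/2} A] *)
Definition crossop (H : pop X X) : X -> U :=
  fun x => adjoint D (C x) + adjoint (hB H) (papp (psqrt H) (A x)).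

Definition sqrt_delta (H : pop X X) : pop U U := psqrt (graph (delta H)).

Record RI (H : pop X X) : Prop := {
  RI_selfadjoint : selfadjoint H ;
  RI_positive : forall x y, H (x, y) -> x != 0 -> 0 < ip y x ;
  RI_domA : forall x, (psqrt H).`1 x -> (psqrt H).`1 (A x) ;
  RI_domB : forall u, (psqrt H).`1 (B u) ;
  RI_delta_bounded : continuous (delta H) ;
  RI_delta_nonneg : forall u, 0 <= ip (delta H u) u ;
  RI_range : forall x, (psqrt H).`1 x -> (sqrt_delta H).`2 (crossop H x) ;
  RI_ineq : forall x, (psqrt H).`1 x ->
    `|papp (mpinv (sqrt_delta H)) (crossop H x)| ^+ 2
      <= `|papp (psqrt H) x| ^+ 2 - `|papp (psqrt H) (A x)| ^+ 2 - `|C x| ^+ 2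
}.

Definition RIcirc : set (pop X X) :=
  [set H | [/\ RI H,
    dense (pimage (psqrt H) ImAB),
    dense (pimage ((psqrt H)^-1)%relation ImAC)
  & is_core ImAB (psqrt H)]].

End systems.

(* Functions on the open unit disc are total on [R[i]]; only their values on the disc are used. *)

Section schur.
Context {R : realType} {U Y : hilbertType R}.
Implicit Type theta : R[i] -> bop U Y.

(* complex differentiability on the disc in the operator norm *)
Definition analytic_disc theta :=
  forall z : R[i], `|z| < 1 -> exists T : bop U Y,
    forall e : R[i], 0 < e -> \forall h \near (0 : R[i]^o),
      forall u, `|theta (z + h) u - theta z u - h *: T u| <= e * `|h| * `|u|.

Definition schur_class theta :=
  analytic_disc theta /\
  forall z : R[i], `|z| < 1 -> forall u, `|theta z u| <= `|u|.

(* [T] is the strong radial limit of [theta] at the point [e^(i t)] *)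
Definition boundary_value theta (t : R) (T : bop U Y) :=
  forall u, theta ((r * cos t) +i* (r * sin t)) u @[r --> (1 : R)^'-] --> T u.

Definition inner theta :=
  schur_class theta /\
  {ae (@lebesgue_measure R), forall t : R, 0 <= t <= 2 * pi ->
    exists2 T : bop U Y, boundary_value theta t T &
      forall u, adjoint T (T u) = u}.

End schur.

(* Main.v *)
(* A form q on the reachable space L = Im(A|B) is given by q x = sum_k |C A^k x|^2.
   For an input u of finite length driving the zero state to x, the output is the
   sequence of Taylor coefficients of theta(z) u(z), so, theta being inner, Parseval's
   identity and radial limits give q x = |u|^2 - |output up to that time|^2.  Hence the
   system is energy preserving for q.

   If H is in RI, H^(1/2) makes the system passive; the energy put in bounds |H^(1/2) x|^2
   from above by q x, and the energy still to come out bounds it from below by q x.  So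
   |H^(1/2) x|^2 = q x on L, and as L is a core, H is the operator of the closure of q.

   Conversely q is closable, since it is a sum of squares of bounded operators.  The
   operator H of its closure is K^-1 - 1, where <v, f> = <v, K f> + q(v, K f), and its
   square root has graph {(K^(1/2) g, (1 - K)^(1/2) g)}, so only bounded square roots
   are needed.  Energy conservation becomes delta(H) = 0 and equality in (4). *)

Require Import Defs.
From mathcomp Require Import all_boot all_order all_algebra.
From mathcomp Require Import all_classical all_reals all_analysis.
From mathcomp Require Import ring lra.

Set Implicit Arguments.
Unset Strict Implicit.
Unset Printing Implicit Defensive.

Import Order.TTheory GRing.Theory Num.Theory.
Import numFieldNormedType.Exports.

Local Open Scope classical_set_scope.
Local Open Scope ring_scope.
Local Open Scope complex_scope.

Local Notation Re := (@complex.Re _).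
Local Notation Im := (@complex.Im _).

(** * Real inner products and bounded operators *)

(** The transfer function agrees with [theta] only near 0, while innerness is a condition on the
    unit circle. The bridge is a Cauchy theory on the disc for the scalar functions z |-> <theta(z)
    u(z), y>. These are given as complex differentiable, so Goursat's argument is run in the
    coordinates log |z| and arg z, where an annulus becomes a rectangle; it makes the outputs Taylor
    coefficients valid on the whole disc. Square roots are values of a choice, and an adjoint is
    meaningful only for a bounded map. Forms therefore carry the argument: two complete forms
    agreeing on a common core are equal, so a selfadjoint root is identified through its graph form,
    whichever one is chosen. For an arbitrary member of RI, boundedness of H^(1/2) B is a uniform
    boundedness argument, and conditions (3) and (4) combine by completing a square. Estimates use
    the real part of the inner product; compatibility with multiplication by i is checked apart. *)

Lemma discriminant_le (R : realFieldType) (a b c : R) : 0 <= a ->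
  (forall t, 0 <= a * t ^+ 2 + 2 * t * b + c) -> b ^+ 2 <= a * c.
Proof.
move=> a0 h; have [a00|an0] := eqVneq a 0.
  rewrite a00 mul0r; case: (eqVneq b 0) => [->|b0]; first by rewrite expr0n.
  (* At this point the affine function takes the value -1. *)
  exfalso; have := h (- (c + 1) / (2 * b)); rewrite a00 mul0r add0r.
  have -> : 2 * (- (c + 1) / (2 * b)) * b = - (c + 1) by field.
  by lra.
have ap : 0 < a by rewrite lt_neqAle eq_sym an0.
have := h (- b / a).
have -> : a * (- b / a) ^+ 2 + 2 * (- b / a) * b + c = (a * c - b ^+ 2) / a by field.
by rewrite pmulr_lge0 ?invr_gt0 // subr_ge0.
Qed.

Lemma eqW (R : numDomainType) (a b : R) : a = b -> a <= b.
Proof. by move->. Qed.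

Section real_sequences.
Context {R : realType}.
Implicit Types (u w : nat -> R) (a b c l : R).

Lemma cvgn_uniq u a b : u @ \oo --> a -> u @ \oo --> b -> a = b.
Proof. exact: (cvg_unique (@Rhausdorff R)). Qed.

Lemma cvgn_cst_eq u l c : u @ \oo --> l -> (forall n, u n = c) -> l = c.
Proof. by move=> ul /funext uE; apply: cvgn_uniq ul _; rewrite uE; exact: cvg_cst. Qed.

Lemma nondecreasing_cvgn_to_le u l : nondecreasing_seq u -> u @ \oo --> l ->
  forall n, u n <= l.
Proof.
move=> um ul n; rewrite -(cvg_lim (@Rhausdorff R) ul).
by apply: nondecreasing_cvgn_le => //; apply/cvg_ex; exists l.
Qed.

Lemma sqr_cvgn0 u w c : w @ \oo --> (0 : R) -> (forall n, u n ^+ 2 <= c * w n) ->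
  u @ \oo --> (0 : R).
Proof.
move=> w0 uw; have /cvgr0Pnorm_lt cw : c * w n @[n --> \oo] --> (0 : R).
  by rewrite -(mulr0 c); apply: cvgM => //; exact: cvg_cst.
apply/cvgr0Pnorm_lt => e e0; have [|N _ hN] := cw (e ^+ 2); first by rewrite exprn_gt0.
exists N => // n /hN /= h; rewrite -(ltr_pXn2r (n := 2)) ?nnegrE ?(ltW e0) //.
by rewrite real_normK ?num_real //; apply: le_lt_trans (uw n) (le_lt_trans (ler_norm _) h).
Qed.

Lemma cvg_half_expr : 2^-1 ^+ n @[n --> \oo] --> (0 : R).
Proof. by apply: cvg_expr; rewrite ger0_norm ?invr_ge0 // invf_lt1 // ltr1n. Qed.

End real_sequences.

Section real_inner_product.
Context {R : realType} {X : hilbertType R}.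
Implicit Types x y z : X.

(** Order arguments such as minimization and Cauchy-Schwarz are run over [R]; [ipE] recovers the
    complex product from [rip x y] and [rip ('i *: x) y]. *)
Definition rip x y : R := Re (ip x y).
Definition nrm x : R := Re `|x|.

Lemma ReD (a b : R[i]) : Re (a + b) = Re a + Re b. Proof. by case: a b => [? ?] [? ?]. Qed.
Lemma ReN (a : R[i]) : Re (- a) = - Re a. Proof. by case: a => [? ?]. Qed.
Lemma ReZ (r : R) (a : R[i]) : Re (r%:C * a) = r * Re a.
Proof. by case: a => [? ?] /=; rewrite mul0r subr0. Qed.
Lemma ReJ (a : R[i]) : Re (Num.conj a) = Re a.
Proof. by case: a => [a b]. Qed.

Lemma normE x : `|x| = (nrm x)%:C.
Proof. by rewrite /nrm RRe_real // ger0_real. Qed.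
Lemma nrm_ge0 x : 0 <= nrm x.
Proof. by rewrite -ler0c -normE. Qed.

Lemma ipC x y : ip x y = Num.conj (ip y x).
Proof. by rewrite (hermC (ip : {hermitian X for false & Num.conj})) /= expr0 mul1r. Qed.
Lemma ripC x y : rip x y = rip y x.
Proof. by rewrite /rip ipC ReJ. Qed.
Lemma ripDl x y z : rip (x + y) z = rip x z + rip y z.
Proof. by rewrite /rip linearDl ReD. Qed.
Lemma ripDr x y z : rip x (y + z) = rip x y + rip x z.
Proof. by rewrite ripC ripDl !(ripC _ x). Qed.
Lemma ripNl x y : rip (- x) y = - rip x y.
Proof. by rewrite /rip linearNl ReN. Qed.
Lemma ripNr x y : rip x (- y) = - rip x y.
Proof. by rewrite ripC ripNl ripC. Qed.
Lemma ripBl x y z : rip (x - y) z = rip x z - rip y z.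
Proof. by rewrite ripDl ripNl. Qed.
Lemma ripBr x y z : rip x (y - z) = rip x y - rip x z.
Proof. by rewrite ripDr ripNr. Qed.
Lemma rip0l x : rip 0 x = 0.
Proof. by rewrite -(subrr x) ripBl subrr. Qed.
Lemma rip0r x : rip x 0 = 0.
Proof. by rewrite ripC rip0l. Qed.
Lemma ripZl (r : R) x y : rip (r%:C *: x) y = r * rip x y.
Proof. by rewrite /rip linearZl_LR /= -ReZ. Qed.
Lemma ripZr (r : R) x y : rip x (r%:C *: y) = r * rip x y.
Proof. by rewrite ripC ripZl ripC. Qed.
Lemma rip_il x y : rip ('i *: x) y = - Im (ip x y).
Proof. by rewrite /rip linearZl_LR /= mulrC ReiNIm. Qed.
Lemma ipE x y : ip x y = rip x y +i* (- rip ('i *: x) y).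
Proof. by rewrite rip_il opprK /rip; case: (ip x y). Qed.
Lemma rip_ii x y : rip ('i *: x) ('i *: y) = rip x y.
Proof.
rewrite rip_il ipC linearZl_LR /= ipC; rewrite /rip.
by case: (ip x y) => a b /=; rewrite !mul0r !mul1r add0r opprK.
Qed.
Lemma rip_iC x y : rip ('i *: x) y = - rip x ('i *: y).
Proof. by rewrite -[y in LHS](scale1r y) -[1]opprK -sqr_i expr2 scaleNr -scalerA ripNr rip_ii. Qed.

Lemma nrm_sq x : nrm x ^+ 2 = rip x x.
Proof.
have := ip_normE x; rewrite normE /rip => <-.
by rewrite !expr2 /= mul0r subr0.
Qed.
Lemma rip_ge0 x : 0 <= rip x x. Proof. by rewrite -nrm_sq sqr_ge0. Qed.
Lemma nrm0_eq0 x : nrm x = 0 -> x = 0.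
Proof. by move=> h; apply/eqP; rewrite -normr_eq0 normE h. Qed.
Lemma rip_eq0 x : rip x x = 0 -> x = 0.
Proof. by rewrite -nrm_sq => /eqP; rewrite sqrf_eq0 => /eqP/nrm0_eq0. Qed.
Lemma nrm0 : nrm 0 = 0. Proof. by rewrite /nrm normr0. Qed.
Lemma nrmD x y : nrm (x + y) <= nrm x + nrm y.
Proof. by rewrite -lecR rmorphD /= -!normE ler_normD. Qed.
Lemma nrmN x : nrm (- x) = nrm x.
Proof. by rewrite /nrm normrN. Qed.
Lemma nrmBC x y : nrm (x - y) = nrm (y - x).
Proof. by rewrite -nrmN opprB. Qed.
Lemma nrmB_tri y x z : nrm (x - z) <= nrm (x - y) + nrm (y - z).
Proof. by apply: le_trans (nrmD _ _); rewrite addrA subrK. Qed.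
Lemma nrmB_ge x y : nrm x - nrm y <= nrm (x - y).
Proof. by rewrite lerBlDr -{1}(subrK y x) nrmD. Qed.
Lemma nrmZ (a : R[i]) x : nrm (a *: x) = Re `|a| * nrm x.
Proof. by rewrite /nrm normrZ (normE x) mulrC ReZ mulrC. Qed.
Lemma nrmZr (r : R) x : nrm (r%:C *: x) = `|r| * nrm x.
Proof. by rewrite nrmZ normc_def /= expr0n addr0 sqrtr_sqr. Qed.

Lemma rip_CS x y : rip x y ^+ 2 <= rip x x * rip y y.
Proof.
have [y0|yn0] := eqVneq (rip y y) 0.
  by rewrite (rip_eq0 y0) !rip0r expr0n mulr0.
have yp : 0 < rip y y by rewrite lt_neqAle eq_sym yn0 rip_ge0.
have := rip_ge0 ((rip y y)%:C *: x - (rip x y)%:C *: y).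
rewrite !ripBl !ripBr !ripZl !ripZr (ripC y x) => h.
rewrite -subr_ge0 -(pmulr_rge0 _ yp); apply: le_trans h _.
by apply: eqW; ring.
Qed.
Lemma rip_le x y : `|rip x y| <= nrm x * nrm y.
Proof.
rewrite -(ler_pXn2r (n := 2)) ?nnegrE ?normr_ge0 ?mulr_ge0 ?nrm_ge0 //.
by rewrite exprMn !nrm_sq real_normK ?num_real // rip_CS.
Qed.

Lemma rip_eqP x : (forall y, rip y x = 0) -> x = 0.
Proof. by move=> h; apply: rip_eq0. Qed.
Lemma rip_inj x y : (forall z, rip z x = rip z y) -> x = y.
Proof. by move=> h; apply/subr0_eq/rip_eqP => z; rewrite ripBr h subrr. Qed.

Lemma hilbert_complete (u : nat -> X) :
  (forall e : R, 0 < e -> exists N, forall m n, (N <= m)%N -> (N <= n)%N ->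
     nrm (u m - u n) < e) ->
  exists x, nrm (u n - x) @[n --> \oo] --> (0 : R).
Proof.
move=> uC.
have uc : cvg (u @ \oo).
  apply/cauchy_cvgP/cauchy_exP => e e0.
  have er : e = (Re e)%:C by rewrite RRe_real // gtr0_real.
  have [|N hN] := uC (Re e); first by rewrite -ltcR -er.
  exists (u N); exists N => // n /= Nn.
  by rewrite -ball_normE /= normE er ltcR hN.
exists (lim (u @ \oo)); apply/cvgr0Pnorm_lt => e e0.
have /cvgrPdist_lt/(_ e%:C) := uc; rewrite ltcR => /(_ e0) [N _ hN].
exists N => // n /hN /=.
by rewrite ger0_norm ?nrm_ge0 // distrC normE ltcR.
Qed.

Lemma rip_cvg (T : Type) (F : set_system T) {FF : Filter F} (u v : T -> X) x y :
  nrm (u t - x) @[t --> F] --> (0 : R) -> nrm (v t - y) @[t --> F] --> (0 : R) ->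
  rip (u t) (v t) @[t --> F] --> rip x y.
Proof.
move=> ux vy; apply/subr_cvg0/norm_cvg0P.
have h : (nrm (u t - x) * nrm (v t - y) + nrm x * nrm (v t - y)
   + nrm (u t - x) * nrm y) @[t --> F] --> (0 * 0 + nrm x * 0 + 0 * nrm y : R).
  apply: cvgD; last by apply: cvgM => //; apply: cvg_cst.
  by apply: cvgD; apply: cvgM => //; apply: cvg_cst.
rewrite !(mul0r, mulr0, addr0) in h.
apply: squeeze_cvgr (cvg_cst 0) h; apply: nearW => t.
rewrite normr_ge0 /=.
have -> : rip (u t) (v t) - rip x y
  = rip (u t - x) (v t - y) + rip x (v t - y) + rip (u t - x) y.
  by rewrite !ripBl !ripBr; lra.
apply: le_trans (ler_normD _ _) _; apply: lerD; last exact: rip_le.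
by apply: le_trans (ler_normD _ _) _; apply: lerD; exact: rip_le.
Qed.

Lemma rip_cvgl (T : Type) (F : set_system T) {FF : Filter F} (u : T -> X) x y :
  nrm (u t - x) @[t --> F] --> (0 : R) -> rip (u t) y @[t --> F] --> rip x y.
Proof.
move=> ux; apply: rip_cvg => //; under eq_cvg do rewrite subrr nrm0.
exact: cvg_cst.
Qed.

Lemma nrm_cvg (T : Type) (F : set_system T) {FF : Filter F} (u : T -> X) x :
  nrm (u t - x) @[t --> F] --> (0 : R) -> nrm (u t) @[t --> F] --> nrm x.
Proof.
move=> ux; apply/subr_cvg0/norm_cvg0P.
apply: squeeze_cvgr (cvg_cst 0) ux; apply: nearW => t.
rewrite normr_ge0 /= ler_norml lerNl opprB nrmB_ge andbT.
by rewrite (le_trans (nrmB_ge _ _)) // nrmBC.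
Qed.

Lemma nrmD_cvg (T : Type) (F : set_system T) {FF : Filter F} (u v : T -> X) x y :
  nrm (u t - x) @[t --> F] --> (0 : R) -> nrm (v t - y) @[t --> F] --> (0 : R) ->
  nrm (u t + v t - (x + y)) @[t --> F] --> (0 : R).
Proof.
move=> ux vy.
have h : nrm (u t - x) + nrm (v t - y) @[t --> F] --> (0 + 0 : R) by apply: cvgD.
rewrite addr0 in h.
apply: squeeze_cvgr (cvg_cst 0) h; apply: nearW => t /=.
by rewrite nrm_ge0 opprD addrACA nrmD.
Qed.

Lemma nrmZ_cvg (T : Type) (F : set_system T) {FF : Filter F} (u : T -> X) x a :
  nrm (u t - x) @[t --> F] --> (0 : R) ->
  nrm (a *: u t - a *: x) @[t --> F] --> (0 : R).
Proof.
move=> ux; under eq_cvg do rewrite -scalerBr nrmZ.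
have h : Re `|a| * nrm (u t - x) @[t --> F] --> (Re `|a| * 0 : R).
  by apply: cvgM => //; apply: cvg_cst.
by rewrite mulr0 in h.
Qed.

Lemma nrm_cvg_uniq (u : nat -> X) x y :
  nrm (u n - x) @[n --> \oo] --> (0 : R) -> nrm (u n - y) @[n --> \oo] --> (0 : R) ->
  x = y.
Proof.
move=> ux uy; apply: rip_inj => z; rewrite !(ripC z).
have h1 : rip (u n) z @[n --> \oo] --> rip x z by exact: rip_cvgl.
have h2 : rip (u n) z @[n --> \oo] --> rip y z by exact: rip_cvgl.
by rewrite -(cvg_lim _ h1) // -(cvg_lim _ h2).
Qed.

Lemma denseP (A : set X) :
  dense A <-> forall x e, 0 < e -> exists2 a, A a & nrm (x - a) < e.
Proof.
split=> [dA x e e0|h O [x Ox] oO].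
  have [] := dA (ball x e%:C); first by exists x; apply: ballxx; rewrite ltcR.
    exact: ball_open.
  move=> a [+ Aa]; rewrite -ball_normE /= normE ltcR => xa; by exists a.
have /nbhs_ballP [e /= e0 eO] : nbhs x O by exact: open_nbhs_nbhs.
have er : e = (Re e)%:C by rewrite RRe_real // gtr0_real.
have [|a Aa xa] := h x (Re e); first by rewrite -ltcR -er.
by exists a; split=> //; apply: eO; rewrite -ball_normE /= normE er ltcR.
Qed.

Lemma dense_seq (A : set X) x : dense A ->
  exists2 u : nat -> X, (forall n, A (u n)) & nrm (u n - x) @[n --> \oo] --> (0 : R).
Proof.
move/denseP => dA.
have h n : exists a, A a /\ nrm (a - x) < n.+1%:R^-1.
  have [|a Aa xa] := dA x n.+1%:R^-1; first by rewrite invr_gt0.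
  by exists a; rewrite nrmBC.
exists (fun n => projT1 (cid (h n))).
  by move=> n; case: (cid (h n)) => a [].
apply: squeeze_cvgr (cvg_cst 0) (@cvg_harmonic R).
by apply: nearW => n; case: (cid (h n)) => a [? ?] /=; rewrite nrm_ge0 ltW.
Qed.

Lemma dense_rip0 (A : set X) x : dense A -> (forall a, A a -> rip a x = 0) -> x = 0.
Proof.
move=> /(dense_seq x) [u Au ux] h; apply: rip_eq0.
have : rip (u n) x @[n --> \oo] --> rip x x by exact: rip_cvgl.
by move/cvgn_cst_eq; apply => n; exact: h.
Qed.

End real_inner_product.

Section bounded_linear.
Context {R : realType}.

(** A predicate on plain functions with a real bound: limits, Riesz representatives and [hB] arise
    as bare functions, not as bundled operators. *)
Record blin (X Y : hilbertType R) (f : X -> Y) : Prop := Blin {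
  blin_lin : forall a x y, f (a *: x + y) = a *: f x + f y ;
  blin_bnd : exists2 c, 0 <= c & forall x, nrm (f x) <= c * nrm x }.

Section one.
Context {X Y : hilbertType R} {f : X -> Y}.
Hypothesis fl : forall a x y, f (a *: x + y) = a *: f x + f y.

Lemma linD x y : f (x + y) = f x + f y.
Proof. by have := fl 1 x y; rewrite !scale1r. Qed.
Lemma lin0 : f 0 = 0.
Proof. by have := linD 0 0; rewrite addr0 -[LHS]addr0 => /addrI. Qed.
Lemma linZ a x : f (a *: x) = a *: f x.
Proof. by have := fl a x 0; rewrite lin0 !addr0. Qed.
Lemma linN x : f (- x) = - f x.
Proof. by rewrite -scaleN1r linZ scaleN1r. Qed.
Lemma linB x y : f (x - y) = f x - f y.
Proof. by rewrite linD linN. Qed.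
Lemma lin_sum (I : Type) (r : seq I) (P : pred I) (F : I -> X) :
  f (\sum_(i <- r | P i) F i) = \sum_(i <- r | P i) f (F i).
Proof. exact: (big_morph _ linD lin0). Qed.
End one.

Lemma bop_blin (X Y : hilbertType R) (f : bop X Y) : blin f.
Proof.
split; first by move=> a x y; rewrite linearP.
have /linear_bounded_continuous/linear_boundedP := @bop_cont _ _ _ f.
move=> /pinfty_ex_gt0 [r r0 h].
have er : r = (Re r)%:C by rewrite RRe_real // gtr0_real.
exists (Re r) => [|x]; first by rewrite ltW // -ltcR -er.
by rewrite -lecR rmorphM /= -er -!normE.
Qed.

Lemma blin_comp (X Y Z : hilbertType R) (f : X -> Y) (g : Y -> Z) :
  blin f -> blin g -> blin (g \o f).
Proof.
move=> [fl [c c0 fc]] [gl [d d0 gd]]; split=> [a x y|/=]; first by rewrite /= fl gl.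
exists (d * c) => [|x]; first exact: mulr_ge0.
by rewrite (le_trans (gd _)) // -mulrA ler_wpM2l.
Qed.

Lemma blin_iter (X : hilbertType R) (f : X -> X) n : blin f -> blin (iter n f).
Proof.
move=> fb; elim: n => [|n ih]; last exact: (blin_comp ih fb).
by split => //; exists 1 => // x; rewrite mul1r.
Qed.

Lemma blin_cvg (X Y : hilbertType R) (f : X -> Y) (T : Type) (F : set_system T)
    {FF : Filter F} (u : T -> X) x :
  blin f -> nrm (u t - x) @[t --> F] --> (0 : R) ->
  nrm (f (u t) - f x) @[t --> F] --> (0 : R).
Proof.
move=> [fl [c c0 fc]] ux.
have h : c * nrm (u t - x) @[t --> F] --> (c * 0 : R).
  by apply: cvgM => //; apply: cvg_cst.
rewrite mulr0 in h.
apply: squeeze_cvgr (cvg_cst 0) h; apply: nearW => t.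
by rewrite nrm_ge0 -(linB fl) fc.
Qed.

End bounded_linear.

(** * Riesz representation and projections *)

Section semi_inner_product.
Context {R : realType} {V : lmodType R[i]}.

(** The axioms are restricted to [M] because the forms below are limits of partial sums or involve
    [papp], and are bilinear only on their domain. *)
Record sip (M : set V) (b : V -> V -> R) : Prop := Sip {
  sipM0 : M 0 ;
  sipMD : forall v w, M v -> M w -> M (v + w) ;
  sipMZ : forall (r : R) v, M v -> M (r%:C *: v) ;
  sipC : forall v w, M v -> M w -> b v w = b w v ;
  sipD : forall u v w, M u -> M v -> M w -> b (u + v) w = b u w + b v w ;
  sipZ : forall (r : R) v w, M v -> M w -> b (r%:C *: v) w = r * b v w ;
  sip_ge0 : forall v, M v -> 0 <= b v v }.

Definition sip_cauchy (b : V -> V -> R) (u : nat -> V) :=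
  forall e : R, 0 < e -> exists N, forall m n, (N <= m)%N -> (N <= n)%N ->
    b (u m - u n) (u m - u n) < e.

Definition sip_complete (M : set V) (b : V -> V -> R) :=
  forall u : nat -> V, (forall n, M (u n)) -> sip_cauchy b u ->
  exists2 w, M w & b (u n - w) (u n - w) @[n --> \oo] --> (0 : R).

Section theory.
Variables (M : set V) (b : V -> V -> R).
Hypothesis bM : sip M b.

Lemma sipMN v : M v -> M (- v).
Proof. by move=> /(sipMZ bM (-1)); rewrite rmorphN1 scaleN1r. Qed.
Lemma sipMB v w : M v -> M w -> M (v - w).
Proof. by move=> Mv Mw; apply: (sipMD bM) => //; apply: sipMN. Qed.
Lemma sipN v w : M v -> M w -> b (- v) w = - b v w.
Proof.
by move=> Mv Mw; have := sipZ bM (-1) Mv Mw; rewrite rmorphN1 scaleN1r mulN1r.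
Qed.
Lemma sipB u v w : M u -> M v -> M w -> b (u - v) w = b u w - b v w.
Proof.
by move=> Mu Mv Mw; rewrite (sipD bM) ?sipN//; apply: sipMN.
Qed.
Lemma sipDr u v w : M u -> M v -> M w -> b w (u + v) = b w u + b w v.
Proof.
move=> Mu Mv Mw; have Muv := sipMD bM Mu Mv.
by rewrite !(sipC bM Mw) // (sipD bM).
Qed.
Lemma sipBr u v w : M u -> M v -> M w -> b w (u - v) = b w u - b w v.
Proof.
move=> Mu Mv Mw; have Muv := sipMB Mu Mv.
by rewrite !(sipC bM Mw) // sipB.
Qed.
Lemma sipZr (r : R) v w : M v -> M w -> b w (r%:C *: v) = r * b w v.
Proof.
move=> Mv Mw; have Mrv := sipMZ bM r Mv.
by rewrite !(sipC bM Mw) // (sipZ bM).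
Qed.
Lemma sip0 v : M v -> b 0 v = 0.
Proof.
by move=> Mv; have := sipZ bM 0 Mv Mv; rewrite mul0r scale0r.
Qed.

Lemma sip_CS v w : M v -> M w -> b v w ^+ 2 <= b v v * b w w.
Proof.
move=> Mv Mw; apply: discriminant_le => [|t]; first exact: (sip_ge0 bM).
have Mt := sipMZ bM t Mv; have := sip_ge0 bM (sipMD bM Mt Mw).
rewrite (sipD bM) ?sipDr ?(sipZ bM) ?sipZr ?(sipC bM Mw Mv) //; last exact: (sipMD bM).
by move=> h; apply: le_trans h _; apply: eqW; ring.
Qed.

Lemma sip_cvgr v w (u : nat -> V) : M v -> (forall n, M (u n)) -> M w ->
  b (u n - w) (u n - w) @[n --> \oo] --> (0 : R) -> b v (u n) @[n --> \oo] --> b v w.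
Proof.
move=> Mv Mu Mw uw; apply/subr_cvg0; apply: (sqr_cvgn0 (c := b v v) uw) => n.
by rewrite -sipBr // sip_CS //; exact: sipMB.
Qed.

(* [u] is a minimizing sequence of [b v v - 2 phi v]; the parallelogram law makes it Cauchy. *)
Lemma riesz_sequence (phi : V -> R) (c : R) :
  0 <= c ->
  (forall v w, M v -> M w -> phi (v + w) = phi v + phi w) ->
  (forall (r : R) v, M v -> phi (r%:C *: v) = r * phi v) ->
  (forall v, M v -> phi v ^+ 2 <= c * b v v) ->
  exists u : nat -> V, [/\ forall n, M (u n), sip_cauchy b u &
    forall v, M v -> b v (u n) @[n --> \oo] --> phi v].
Proof.
move=> c0 phiD phiZ phib.
pose J v := b v v - 2 * phi v.
(* This is [2 phi v <= b v v + c], the arithmetic-geometric mean inequality applied to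
   [phi v ^+ 2 <= c * b v v] and checked by squaring. *)
have Jlb v : M v -> - c <= J v.
  move=> Mv; have bv := sip_ge0 bM Mv; have := phib v Mv; rewrite /J => h.
  rewrite -subr_ge0.
  have [/= p0|p0] := leP (phi v) 0; first by lra.
  have : 2 * phi v <= b v v + c.
    rewrite -(ler_pXn2r (n := 2)) ?nnegrE //; [|lra..].
    by have := sqr_ge0 (b v v - c); nra.
  by lra.
pose E := [set J v | v in M].
have E0 : has_inf E.
  split; first by exists (J 0); exists 0 => //; apply: (sipM0 bM).
  by exists (- c) => _ [v Mv <-]; apply: Jlb.
pose mu := inf E.
have muJ v : M v -> mu <= J v.
  by move=> Mv; apply: ge_inf; [case: E0|exists v].
have hu n : exists v, M v /\ J v < mu + n.+1%:R^-1.
  have [|_ [v Mv <-] h] := @inf_adherent _ E n.+1%:R^-1 _ E0; first by rewrite invr_gt0.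
  by exists v.
pose u n := projT1 (cid (hu n)).
have Mu n : M (u n) by rewrite /u; case: (cid (hu n)) => ? [].
have Ju n : J (u n) < mu + n.+1%:R^-1 by rewrite /u; case: (cid (hu n)) => ? [].
exists u; split => //.
- move=> e e0.
  have [N hN] : exists N, forall n, (N <= n)%N -> n.+1%:R^-1 < e / 4.
    have /cvgrPdist_lt/(_ (e / 4)) := @cvg_harmonic R.
    case; first by rewrite divr_gt0.
    move=> N _ hN; exists N => n /hN /=.
    by rewrite sub0r normrN ger0_norm ?invr_ge0.
  exists N => m n Nm Nn.
  have Mmn := sipMD bM (Mu m) (Mu n).
  have h1 := muJ _ (sipMZ bM (2^-1) Mmn).
  rewrite /J (sipZ bM) ?sipZr ?(sipD bM) ?sipDr ?phiZ ?phiD // in h1; last exact: (sipMZ bM).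
  rewrite sipB ?sipBr //; last exact: sipMB.
  rewrite (sipC bM (Mu n) (Mu m)) in h1 *.
  have := hN m Nm; have := hN n Nn; have := Ju m; have := Ju n.
  rewrite /J; set dn := n.+1%:R^-1; set dm := m.+1%:R^-1.
  by move: dn dm => dn dm *; lra.
- move=> v Mv; apply/subr_cvg0; apply: (@sqr_cvgn0 _ _ _ (b v v) cvg_harmonic) => n.
  (* [J (t v + u n)] is at least [mu], hence above [J (u n) - 1/(n+1)]: a quadratic in [t] bounded
     below, whose discriminant is the estimate. *)
  apply: discriminant_le => [|t]; first exact: (sip_ge0 bM).
  have Mt := sipMZ bM t Mv; have := muJ _ (sipMD bM Mt (Mu n)); have := Ju n.
  rewrite /J (sipD bM) ?sipDr ?(sipZ bM) ?sipZr ?phiD ?phiZ ?(sipC bM (Mu n) Mv) //;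
    last exact: (sipMD bM).
  by rewrite /harmonic /=; move: (n.+1%:R^-1 : R) => d h1 h2; nra.
Qed.

Lemma riesz_form (phi : V -> R) (c : R) : sip_complete M b ->
  0 <= c ->
  (forall v w, M v -> M w -> phi (v + w) = phi v + phi w) ->
  (forall (r : R) v, M v -> phi (r%:C *: v) = r * phi v) ->
  (forall v, M v -> phi v ^+ 2 <= c * b v v) ->
  exists2 w, M w & forall v, M v -> phi v = b v w.
Proof.
move=> bcomp c0 phiD phiZ phib.
have [u [Mu uC hu]] := riesz_sequence c0 phiD phiZ phib.
have [w Mw uw] := bcomp u Mu uC.
exists w => // v Mv.
exact: cvgn_uniq (hu v Mv) (sip_cvgr Mv Mu Mw uw).
Qed.

End theory.
End semi_inner_product.

Section riesz.
Context {R : realType} {X : hilbertType R}.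

Lemma sip_rip (M : set X) : M 0 -> (forall v w, M v -> M w -> M (v + w)) ->
  (forall (r : R) v, M v -> M (r%:C *: v)) -> sip M rip.
Proof.
move=> M0 MD MZ; split=> // *; [exact: ripC|exact: ripDl|exact: ripZl|exact: rip_ge0].
Qed.

Lemma sip_cauchy_rip (u : nat -> X) : sip_cauchy rip u ->
  exists w, nrm (u n - w) @[n --> \oo] --> (0 : R).
Proof.
move=> uC; apply: hilbert_complete => e e0.
have [|N hN] := uC (e ^+ 2); first by rewrite exprn_gt0.
exists N => m n Nm Nn.
by rewrite -(ltr_pXn2r (n := 2)) ?nnegrE ?nrm_ge0 ?(ltW e0) // nrm_sq hN.
Qed.

Lemma riesz (phi : X -> R) (c : R) :
  (forall v w, phi (v + w) = phi v + phi w) ->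
  (forall (r : R) v, phi (r%:C *: v) = r * phi v) ->
  (forall v, `|phi v| <= c * nrm v) ->
  exists w, forall v, phi v = rip v w.
Proof.
move=> phiD phiZ phib.
have T : sip [set: X] rip by exact: sip_rip.
have [|||||w _ h] := @riesz_form _ _ _ _ T phi (c ^+ 2).
- move=> u _ /sip_cauchy_rip [w uw]; exists w => //.
  under eq_cvg do rewrite -nrm_sq expr2.
  have h : nrm (u n - w) * nrm (u n - w) @[n --> \oo] --> (0 * 0 : R) by apply: cvgM.
  by rewrite mulr0 in h.
- exact: sqr_ge0.
- by move=> *; apply: phiD.
- by move=> *; apply: phiZ.
- move=> v _; rewrite -nrm_sq -exprMn -(real_normK (num_real (phi v))).
  rewrite ler_pXn2r ?nnegrE //; exact: le_trans (phib v).
- by exists w => v; apply: h.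
Qed.

Definition subspace (M : set X) :=
  [/\ M 0, forall v w, M v -> M w -> M (v + w) & forall a v, M v -> M (a *: v)].

Lemma subspaceN M v : subspace M -> M v -> M (- v).
Proof. by move=> [_ _ MZ] Mv; rewrite -scaleN1r; apply: MZ. Qed.
Lemma subspaceB M v w : subspace M -> M v -> M w -> M (v - w).
Proof. by move=> sM Mv Mw; case: (sM) => _ MD _; apply: MD => //; apply: subspaceN. Qed.

(* sequential form of the orthogonal projection of [x] on the closure of [M] *)
Lemma projection_sequence (M : set X) x : subspace M ->
  exists2 w, (forall v, M v -> rip v (x - w) = 0) &
    exists2 u : nat -> X, (forall n, M (u n)) &
      nrm (u n - w) @[n --> \oo] --> (0 : R).
Proof.
move=> [M0 MD MZ].
have T : sip M rip by apply: sip_rip => // r v; apply: MZ.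
have [||||u [Mu /sip_cauchy_rip [w uw] hu]] := @riesz_sequence _ _ _ _ T (rip^~ x) (rip x x).
- exact: rip_ge0.
- by move=> v w _ _; rewrite ripDl.
- by move=> r v _; rewrite ripZl.
- by move=> v _; rewrite mulrC; apply: rip_CS.
exists w; last by exists u.
move=> v Mv; apply/eqP; rewrite ripBr subr_eq0; apply/eqP; apply: cvgn_uniq (hu v Mv) _.
by under eq_cvg do rewrite ripC; rewrite ripC; apply: rip_cvgl.
Qed.

Lemma dense_subspace (M : set X) : subspace M ->
  (forall x, (forall v, M v -> rip v x = 0) -> x = 0) -> dense M.
Proof.
move=> sM h; apply/denseP => x e e0.
have [w hw [u Mu uw]] := projection_sequence x sM.
have xw : x = w by apply/subr0_eq/h.
rewrite -xw in uw.
have /cvgr0Pnorm_lt/(_ e e0) [N _ hN] := uw.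
by exists (u N) => //; rewrite nrmBC -[ltLHS]ger0_norm ?nrm_ge0 // hN /=.
Qed.

Lemma closure_seq (M : set X) (u : nat -> X) w :
  (forall n, M (u n)) -> nrm (u n - w) @[n --> \oo] --> (0 : R) -> closure M w.
Proof.
move=> Mu uw B /nbhs_ballP [e /= e0 eB].
have er : e = (Re e)%:C by rewrite RRe_real // gtr0_real.
have e0' : 0 < Re e by rewrite -ltcR -er.
have /cvgr0Pnorm_lt/(_ _ e0') [N _ hN] := uw.
exists (u N); split => //; apply: eB.
rewrite -ball_normE /= normE er ltcR nrmBC -[ltLHS]ger0_norm ?nrm_ge0 //.
exact: hN (leqnn N).
Qed.

End riesz.

Section adjoints.
Context {R : realType} {X Y : hilbertType R}.

Lemma rip_ip (x y : Y) (z w : X) :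
  rip x y = rip z w -> rip ('i *: x) y = rip ('i *: z) w -> ip x y = ip z w.
Proof. by move=> h1 h2; rewrite !ipE h1 h2. Qed.

(** [adjoint f y] is a chosen value of [padjoint (graph f)]; the Riesz vector of [x |-> rip (f x) y]
    shows that there is one to choose. *)
Lemma adjoint_ip (f : X -> Y) x y : blin f -> ip (f x) y = ip x (adjoint f y).
Proof.
move=> [fl [c c0 fc]].
have [||v|w hw] := @riesz _ X (fun x => rip (f x) y) (c * nrm y).
- by move=> v w; rewrite (linD fl) ripDl.
- by move=> r v; rewrite (linZ fl) ripZl.
- by rewrite (le_trans (rip_le _ _)) // mulrAC ler_wpM2r ?nrm_ge0.
have : padjoint (graph f) (y, w).
  move=> v z; rewrite /graph /= => ->; apply: rip_ip => //.
  by rewrite -(linZ fl) hw.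
move=> /(@xgetI _ 0 [set z | padjoint (graph f) (y, z)]) /= h.
exact: (h x (f x)).
Qed.

Lemma adjoint_rip (f : X -> Y) x y : blin f -> rip (f x) y = rip x (adjoint f y).
Proof. by move=> fb; rewrite /rip adjoint_ip. Qed.

End adjoints.

(** * Goursat's theorem for closed real 1-forms *)

Section integrals.
Context {R : realType}.
Implicit Types (f g : R -> R) (a b c d : R).

Definition itg a b f : R := (\int[@lebesgue_measure R]_(x in `[a, b]) f x)%R.
Definition cont_on a b f := forall x, a <= x <= b -> {for x, continuous f}.

Lemma cont_on_integrable a b f : cont_on a b f ->
  (@lebesgue_measure R).-integrable `[a, b] (EFin \o f).
Proof.
move=> fc; apply: continuous_compact_integrable; first exact: segment_compact.
apply: continuous_in_subspaceT => x /set_mem /=; rewrite in_itv /= => /fc.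
exact.
Qed.

Lemma cont_onD a b f g : cont_on a b f -> cont_on a b g -> cont_on a b (fun x => f x + g x).
Proof. by move=> fc gc x xab; apply: cvgD; [apply: fc|apply: gc]. Qed.
Lemma cont_onB a b f g : cont_on a b f -> cont_on a b g -> cont_on a b (fun x => f x - g x).
Proof. by move=> fc gc x xab; apply: cvgB; [apply: fc|apply: gc]. Qed.
Lemma cont_on_cst a b c : cont_on a b (fun=> c).
Proof. by move=> x _; apply: cvg_cst. Qed.

Lemma itgD a b f g : cont_on a b f -> cont_on a b g ->
  itg a b (fun x => f x + g x) = itg a b f + itg a b g.
Proof. by move=> fc gc; apply: RintegralD => //; apply: cont_on_integrable. Qed.
Lemma itgB a b f g : cont_on a b f -> cont_on a b g ->
  itg a b (fun x => f x - g x) = itg a b f - itg a b g.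
Proof. by move=> fc gc; apply: RintegralB => //; apply: cont_on_integrable. Qed.
Lemma itgZ a b c f : cont_on a b f -> itg a b (fun x => c * f x) = c * itg a b f.
Proof. by move=> fc; apply: RintegralZl => //; apply: cont_on_integrable. Qed.
Lemma itg_cst a b c : a <= b -> itg a b (fun=> c) = c * (b - a).
Proof.
by move=> ab; rewrite /itg Rintegral_cst //= lebesgue_measure_itv /= lte_fin;
  have [ab'|ba] := ltP a b => //=; rewrite (@le_anti _ _ a b) ?ab ?ba // subrr.
Qed.
Lemma eq_itg a b f g : (forall x, a <= x <= b -> f x = g x) -> itg a b f = itg a b g.
Proof.
by move=> fg; apply: eq_Rintegral => x /set_mem /=; rewrite in_itv /= => /fg.
Qed.
Lemma itg_le a b f g : cont_on a b f -> cont_on a b g ->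
  (forall x, a <= x <= b -> f x <= g x) -> itg a b f <= itg a b g.
Proof.
move=> fc gc fg; apply: le_Rintegral; [by []|exact: cont_on_integrable|exact: cont_on_integrable|].
by move=> x /=; rewrite in_itv /= => /fg.
Qed.
Lemma itg_abs_le a b f c : a <= b -> cont_on a b f ->
  (forall x, a <= x <= b -> `|f x| <= c) -> `|itg a b f| <= c * (b - a).
Proof.
move=> ab fc h; rewrite ler_norml -mulNr -!itg_cst //.
by apply/andP; split; apply: itg_le => //; try exact: cont_on_cst;
  move=> x /h; rewrite ler_norml => /andP[].
Qed.
Lemma itg_split a b c f : a <= b -> b <= c -> cont_on a c f ->
  itg a c f = itg a b f + itg b c f.
Proof.
move=> ab bc fc; apply/eqP; rewrite -subr_eq0 opprD addrA subr_eq0; apply/eqP.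
rewrite /itg Rintegral_itvB ?bnd_simp //; last exact: cont_on_integrable.
rewrite Rintegral_itv_obnd_cbnd //.
apply: integrableS (cont_on_integrable fc) => //.
by apply: subset_itvr; rewrite bnd_simp.
Qed.

End integrals.

Section goursat.
Context {R : realType}.
Implicit Types (u v : R -> R -> R).

(** Frechet differentiability at [(s, t)] with partial derivatives [p] and [q]. *)
Definition diff2 u (s t p q : R) := forall e, 0 < e -> exists2 dl : R, 0 < dl &
  forall s' t', `|s' - s| < dl -> `|t' - t| < dl ->
    `|u s' t' - u s t - p * (s' - s) - q * (t' - t)| <= e * (`|s' - s| + `|t' - t|).

Lemma diff2_cont1 u s t p q : diff2 u s t p q -> {for s, continuous (u^~ t)}.
Proof.
move=> ud; apply/cvgrPdist_lt => e e0.
have [dl dl0 h] := ud 1 ltr01.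
have p1 : 0 < `|p| + 1 by rewrite ltr_wpDl.
apply/nbhs_ballP; exists (Order.min dl (e / (`|p| + 1))) => /=.
  by rewrite lt_min dl0 divr_gt0.
move=> s'; rewrite /ball /= lt_min distrC => /andP[h1 h2].
have := h s' t h1; rewrite subrr normr0 mulr0 subr0 addr0 mul1r => /(_ dl0) h3.
rewrite ltr_pdivlMr // in h2.
rewrite distrC; apply: le_lt_trans h2.
rewrite mulrDr mulr1 -normrM.
have -> : u s' t - u s t = (s' - s) * p + (u s' t - u s t - p * (s' - s)) by ring.
by rewrite (le_trans (ler_normD _ _)) // lerD2l.
Qed.

Lemma diff2_swap u s t p q : diff2 u s t p q -> diff2 (fun x y => u y x) t s q p.
Proof.
move=> ud e e0; have [dl dl0 h] := ud e e0.
by exists dl => // t' s' h1 h2; rewrite [X in e * X]addrC -addrA [X in _ + X]addrC addrA h.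
Qed.

Lemma diff2_cont2 u s t p q : diff2 u s t p q -> {for t, continuous (u s)}.
Proof. by move=> /diff2_swap /diff2_cont1. Qed.

(** The 1-form [u ds + v dt] is closed at the point: the shared [q] is both the t-derivative of [u]
    and the s-derivative of [v]. *)
Definition closed_form_at u v s t := exists p q r, diff2 u s t p q /\ diff2 v s t q r.

(** The integral of [u ds + v dt] counterclockwise along the boundary of the rectangle. *)
Definition bdry_int u v (a b c d : R) :=
  itg a b (fun s => u s c - u s d) + itg c d (fun t => v b t - v a t).

Definition closed_form_on u v (a b c d : R) := forall s t, a <= s <= b -> c <= t <= d ->
  closed_form_at u v s t.

Lemma closed_form_cont1 u v a b c d t : c <= t <= d ->
  closed_form_on u v a b c d -> cont_on a b (u^~ t).
Proof.
move=> tcd uv s sab; have [p [q [r [h _]]]] := uv s t sab tcd.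
exact: diff2_cont1 h.
Qed.

Lemma closed_form_cont2 u v a b c d s : a <= s <= b ->
  closed_form_on u v a b c d -> cont_on c d (v s).
Proof.
move=> sab uv t tcd; have [p [q [r [_ h]]]] := uv s t sab tcd.
exact: diff2_cont2 h.
Qed.

Lemma closed_form_sub u v a b c d a' b' c' d' :
  a <= a' -> b' <= b -> c <= c' -> d' <= d ->
  closed_form_on u v a b c d -> closed_form_on u v a' b' c' d'.
Proof.
move=> aa bb cc dd uv s t /andP[h1 h2] /andP[h3 h4]; apply: uv.
  by rewrite (le_trans aa h1) (le_trans h2 bb).
by rewrite (le_trans cc h3) (le_trans h4 dd).
Qed.

Lemma bdry_int_splith u v a m b c d : a <= m -> m <= b -> c <= d ->
  closed_form_on u v a b c d ->
  bdry_int u v a b c d = bdry_int u v a m c d + bdry_int u v m b c d.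
Proof.
move=> am mb cd uv.
have ab := le_trans am mb.
have vc s : a <= s <= b -> cont_on c d (v s) by move=> sab; apply: closed_form_cont2 uv.
have uc t : c <= t <= d -> cont_on a b (u^~ t) by move=> sab; apply: closed_form_cont1 uv.
rewrite /bdry_int (@itg_split _ a m b) //; last first.
  by apply: cont_onB; apply: uc; rewrite ?lexx ?cd.
rewrite addrACA; congr (_ + _); rewrite -itgD.
- by apply: eq_itg => t _; ring.
- by apply: cont_onB; apply: vc; rewrite ?lexx ?ab ?am ?mb.
- by apply: cont_onB; apply: vc; rewrite ?lexx ?ab ?am ?mb.
Qed.

Lemma bdry_int_splitv u v a b c n d : a <= b -> c <= n -> n <= d ->
  closed_form_on u v a b c d ->
  bdry_int u v a b c d = bdry_int u v a b c n + bdry_int u v a b n d.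
Proof.
move=> ab cn nd uv.
have cd := le_trans cn nd.
have vc s : a <= s <= b -> cont_on c d (v s) by move=> sab; apply: closed_form_cont2 uv.
have uc t : c <= t <= d -> cont_on a b (u^~ t) by move=> sab; apply: closed_form_cont1 uv.
rewrite /bdry_int (@itg_split _ c n d) //; last first.
  by apply: cont_onB; apply: vc; rewrite ?lexx ?ab.
rewrite addrACA; congr (_ + _); rewrite -itgD.
- by apply: eq_itg => t _; ring.
- by apply: cont_onB; apply: uc; rewrite ?lexx ?cd ?cn ?nd.
- by apply: cont_onB; apply: uc; rewrite ?lexx ?cd ?cn ?nd.
Qed.

Lemma bdry_int_quarter u v a b c d : a <= b -> c <= d -> closed_form_on u v a b c d ->
  exists a' b' c' d', [/\ a <= a' /\ b' <= b, c <= c' /\ d' <= d,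
    b' - a' = (b - a) / 2, d' - c' = (d - c) / 2 &
    `|bdry_int u v a b c d| <= 4 * `|bdry_int u v a' b' c' d'|].
Proof.
move=> ab cd uv; pose m := (a + b) / 2; pose n := (c + d) / 2.
have am : a <= m by rewrite /m; lra.
have mb : m <= b by rewrite /m; lra.
have cn : c <= n by rewrite /n; lra.
have nd : n <= d by rewrite /n; lra.
have E : bdry_int u v a b c d = bdry_int u v a m c n + bdry_int u v a m n d
    + (bdry_int u v m b c n + bdry_int u v m b n d).
  rewrite (@bdry_int_splith _ _ a m b) // (@bdry_int_splitv _ _ a m c n d) //.
    by rewrite (@bdry_int_splitv _ _ m b c n d) //; apply: closed_form_sub uv.
  by apply: closed_form_sub uv.
have [h|h1] := leP `|bdry_int u v a b c d| (4 * `|bdry_int u v a m c n|).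
  by exists a, m, c, n; split => //; rewrite /m /n; lra.
have [h|h2] := leP `|bdry_int u v a b c d| (4 * `|bdry_int u v a m n d|).
  by exists a, m, n, d; split => //; rewrite /m /n; lra.
have [h|h3] := leP `|bdry_int u v a b c d| (4 * `|bdry_int u v m b c n|).
  by exists m, b, c, n; split => //; rewrite /m /n; lra.
exists m, b, n, d; split => //; try by rewrite /m /n; lra.
rewrite leNgt; apply/negP => h4.
have : `|bdry_int u v a b c d| <= `|bdry_int u v a m c n| + `|bdry_int u v a m n d|
    + (`|bdry_int u v m b c n| + `|bdry_int u v m b n d|).
  rewrite {1}E; apply: le_trans (ler_normD _ _) _.
  by apply: lerD; exact: ler_normD.
by lra.
Qed.

(** The affine part of the form integrates to zero: the horizontal sides contribute
    [q (c - d) (b - a)] and the vertical ones [q (b - a) (d - c)]. On each side the remaining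
    integrand is at most [e] times the half perimeter. *)
Lemma bdry_int_small u v a b c d s t p q r e dl : a <= b -> c <= d ->
  closed_form_on u v a b c d -> 0 <= e ->
  (forall s' t', `|s' - s| < dl -> `|t' - t| < dl ->
    `|u s' t' - u s t - p * (s' - s) - q * (t' - t)| <= e * (`|s' - s| + `|t' - t|)) ->
  (forall s' t', `|s' - s| < dl -> `|t' - t| < dl ->
    `|v s' t' - v s t - q * (s' - s) - r * (t' - t)| <= e * (`|s' - s| + `|t' - t|)) ->
  a <= s <= b -> c <= t <= d -> b - a < dl -> d - c < dl ->
  `|bdry_int u v a b c d| <= 2 * e * ((b - a) + (d - c)) ^+ 2.
Proof.
move=> ab cd uv e0 hu hv sab tcd bdl ddl.
have vc x : a <= x <= b -> cont_on c d (v x) by move=> xab; apply: closed_form_cont2 uv.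
have uc x : c <= x <= d -> cont_on a b (u^~ x) by move=> xab; apply: closed_form_cont1 uv.
set w := (b - a) + (d - c).
have near1 x : a <= x <= b -> `|x - s| <= b - a.
  by move=> /andP[? ?]; move: sab => /andP[? ?]; rewrite ler_norml; apply/andP; split; lra.
have near2 y : c <= y <= d -> `|y - t| <= d - c.
  by move=> /andP[? ?]; move: tcd => /andP[? ?]; rewrite ler_norml; apply/andP; split; lra.
have bu x y : a <= x <= b -> c <= y <= d ->
    `|u x y - u s t - p * (x - s) - q * (y - t)| <= e * w.
  move=> /near1 hx /near2 hy; apply: (le_trans (hu x y _ _)).
  - exact: le_lt_trans hx bdl.
  - exact: le_lt_trans hy ddl.
  - by rewrite ler_wpM2l // lerD.
have bv x y : a <= x <= b -> c <= y <= d ->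
    `|v x y - v s t - q * (x - s) - r * (y - t)| <= e * w.
  move=> /near1 hx /near2 hy; apply: (le_trans (hv x y _ _)).
  - exact: le_lt_trans hx bdl.
  - exact: le_lt_trans hy ddl.
  - by rewrite ler_wpM2l // lerD.
have lc : c <= c <= d by rewrite lexx.
have ld : c <= d <= d by rewrite lexx cd.
have la : a <= a <= b by rewrite lexx.
have lb : a <= b <= b by rewrite lexx ab.
have h1 : `|itg a b (fun s => u s c - u s d) - q * (c - d) * (b - a)| <= 2 * e * w * (b - a).
  rewrite -itg_cst // -itgB //; [|by apply: cont_onB; apply: uc|exact: cont_on_cst].
  apply: itg_abs_le => //.
    by apply: cont_onB; [apply: cont_onB; apply: uc|exact: cont_on_cst].
  move=> x xab; have := bu x c xab lc; have := bu x d xab ld.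
  rewrite !ler_norml => /andP[? ?] /andP[? ?]; apply/andP; split; lra.
have h2 : `|itg c d (fun t => v b t - v a t) - q * (b - a) * (d - c)| <= 2 * e * w * (d - c).
  rewrite -itg_cst // -itgB //; [|by apply: cont_onB; apply: vc|exact: cont_on_cst].
  apply: itg_abs_le => //.
    by apply: cont_onB; [apply: cont_onB; apply: vc|exact: cont_on_cst].
  move=> x xcd; have := bv b x lb xcd; have := bv a x la xcd.
  rewrite !ler_norml => /andP[? ?] /andP[? ?]; apply/andP; split; lra.
rewrite /bdry_int.
set I1 := itg a b _ in h1 *; set I2 := itg c d _ in h2 *.
have -> : 2 * e * w ^+ 2 = 2 * e * w * (b - a) + 2 * e * w * (d - c) by rewrite /w; ring.
have -> : I1 + I2 = (I1 - q * (c - d) * (b - a)) + (I2 - q * (b - a) * (d - c)) by ring.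
by rewrite (le_trans (ler_normD _ _)) // lerD.
Qed.

(* A closed form need only be differentiable, not C^1: bisect the rectangle and
   use the differential at the common point of the nested subrectangles. *)
Lemma goursat u v a b c d : a <= b -> c <= d -> closed_form_on u v a b c d ->
  bdry_int u v a b c d = 0.
Proof.
move=> ab cd uv.
pose P (q : R * R * R * R) := [/\ q.1.1.1 <= q.1.1.2, q.1.2 <= q.2,
  a <= q.1.1.1 /\ q.1.1.2 <= b & c <= q.1.2 /\ q.2 <= d].
pose rel (q q' : R * R * R * R) := [/\ q.1.1.1 <= q'.1.1.1 /\ q'.1.1.2 <= q.1.1.2,
    q.1.2 <= q'.1.2 /\ q'.2 <= q.2,
    q'.1.1.2 - q'.1.1.1 = (q.1.1.2 - q.1.1.1) / 2, q'.2 - q'.1.2 = (q.2 - q.1.2) / 2 &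
    `|bdry_int u v q.1.1.1 q.1.1.2 q.1.2 q.2| <=
      4 * `|bdry_int u v q'.1.1.1 q'.1.1.2 q'.1.2 q'.2|].
(* The implication sits under the existential, so that choice yields a total map on quadruples. *)
have step q : exists q', P q -> P q' /\ rel q q'.
  have [Pq|nPq] := pselect (P q); last by exists q.
  case: q Pq => [[[a1 b1] c1] d1] [/= ab1 cd1 [aa1 bb1] [cc1 dd1]].
  have [a' [b' [c' [d' [[h1 h2] [h3 h4] h5 h6 h7]]]]] :=
    bdry_int_quarter ab1 cd1 (closed_form_sub aa1 bb1 cc1 dd1 uv).
  exists (a', b', c', d') => _; split; last by split.
  split => /=.
  - by rewrite -subr_ge0 h5 divr_ge0 // subr_ge0.
  - by rewrite -subr_ge0 h6 divr_ge0 // subr_ge0.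
  - by split; [exact: le_trans h1|exact: le_trans bb1].
  - by split; [exact: le_trans h3|exact: le_trans dd1].
have [F hF] := choice step.
pose q n := iter n F (a, b, c, d).
have Pq n : P (q n).
  elim: n => [|n ih]; first by split => /=.
  by have [] := hF _ ih.
have relq n : rel (q n) (q n.+1) by have [] := hF _ (Pq n).
pose an n := (q n).1.1.1; pose bn n := (q n).1.1.2.
pose cn n := (q n).1.2; pose dn n := (q n).2.
have nested (x y : nat -> R) : (forall n, x n <= x n.+1) -> (forall n, y n.+1 <= y n) ->
    (forall n, x n <= y n) -> exists s, forall n, x n <= s <= y n.
  move=> xi yi xy.
  have xm : {homo x : n m / (n <= m)%N >-> n <= m} by apply: homo_leq => //; exact: le_trans.
  have ym m n : (m <= n)%N -> y n <= y m by move: m n; apply/nonincreasing_seqP.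
  have xym n m : x n <= y m.
    have [nm|mn] := leqP n m; first exact: le_trans (xm _ _ nm) (xy m).
    exact: le_trans (xy n) (ym _ _ (ltnW mn)).
  exists (sup (range x)) => n; apply/andP; split.
    by apply: ub_le_sup; [exists (y 0%N) => _ [k _ <-]|exists n].
  by apply: ge_sup; [exists (x 0%N), 0%N|move=> _ [k _ <-]].
have [|||s hs] := nested an bn.
- by move=> n; have [[]] := relq n.
- by move=> n; have [[]] := relq n.
- by move=> n; have [] := Pq n.
have [|||t ht] := nested cn dn.
- by move=> n; have [_ []] := relq n.
- by move=> n; have [_ []] := relq n.
- by move=> n; have [] := Pq n.
have wn n : bn n - an n = (b - a) / 2 ^+ n.
  elim: n => [|n ih]; first by rewrite expr0 divr1.
  have [_ _ h _ _] := relq n; rewrite /bn /an h -/(bn n) -/(an n) ih.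
  by rewrite exprS invfM mulrA mulrAC.
have hn n : dn n - cn n = (d - c) / 2 ^+ n.
  elim: n => [|n ih]; first by rewrite expr0 divr1.
  have [_ _ _ h _] := relq n; rewrite /dn /cn h -/(dn n) -/(cn n) ih.
  by rewrite exprS invfM mulrA mulrAC.
have In n : `|bdry_int u v a b c d| <= 4 ^+ n * `|bdry_int u v (an n) (bn n) (cn n) (dn n)|.
  elim: n => [|n ih]; first by rewrite expr0 mul1r.
  apply: le_trans ih _; rewrite exprSr -mulrA ler_wpM2l ?exprn_ge0 //.
  by have [] := relq n.
have sab : a <= s <= b by have := hs 0%N.
have tcd : c <= t <= d by have := ht 0%N.
have [p [q' [r [du dv]]]] := uv s t sab tcd.
(* The factor 4^n lost in the bisections is regained from the perimeter, which has shrunk by 2^n and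
   enters squared. *)
have bound e : 0 < e -> `|bdry_int u v a b c d| <= 2 * e * ((b - a) + (d - c)) ^+ 2.
  move=> e0; have [d1 d10 h1] := du e e0; have [d2 d20 h2] := dv e e0.
  pose dl := Order.min d1 d2.
  have dl0 : 0 < dl by rewrite lt_min d10.
  have [n hn'] : exists n, (b - a + (d - c)) / 2 ^+ n < dl.
    have h : (b - a + (d - c)) * (2^-1) ^+ n @[n --> \oo] --> ((b - a + (d - c)) * 0 : R).
      by apply: cvgM; [exact: cvg_cst|exact: cvg_half_expr].
    rewrite mulr0 in h; have /cvgr0Pnorm_lt/(_ _ dl0) [n _ /(_ n (leqnn n)) /=] := h.
    by move=> /(le_lt_trans (ler_norm _)); rewrite exprVn; exists n.
  have [anbn cndn [aan bnb] [ccn dnd]] := Pq n.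
  have pn : 0 < 2 ^+ n :> R by rewrite exprn_gt0.
  have wd : bn n - an n < dl.
    by rewrite wn; apply: le_lt_trans hn'; rewrite ler_pM2r ?invr_gt0 // lerDl subr_ge0.
  have hd : dn n - cn n < dl.
    by rewrite hn; apply: le_lt_trans hn'; rewrite ler_pM2r ?invr_gt0 // lerDr subr_ge0.
  apply: le_trans (In n) _.
  have := @bdry_int_small u v (an n) (bn n) (cn n) (dn n) s t p q' r e dl anbn cndn
    (closed_form_sub aan bnb ccn dnd uv) (ltW e0) _ _ (hs n) (ht n) wd hd.
  rewrite wn hn => key.
  have -> : 2 * e * (b - a + (d - c)) ^+ 2
    = 4 ^+ n * (2 * e * ((b - a) / 2 ^+ n + (d - c) / 2 ^+ n) ^+ 2).
    have -> : (4 : R) = 2 ^+ 2 by rewrite -natrX.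
    rewrite -exprM mulnC exprM; field; by rewrite gt_eqF.
  rewrite ler_pM2l ?exprn_gt0 //; apply: key.
    by move=> s' t'; rewrite !lt_min => /andP[? _] /andP[? _]; apply: h1.
  by move=> s' t'; rewrite !lt_min => /andP[_ ?] /andP[_ ?]; apply: h2.
apply/eqP; rewrite -normr_le0; apply/ler_addgt0Pr => e e0; rewrite add0r.
pose W := ((b - a) + (d - c)) ^+ 2.
have W0 : 0 <= W by rewrite sqr_ge0.
have W1 : 0 < 2 * (W + 1) by rewrite mulr_gt0 // ltr_wpDl.
apply: le_trans (bound (e / (2 * (W + 1))) (divr_gt0 e0 W1)) _.
rewrite -/W.
have -> : 2 * (e / (2 * (W + 1))) * W = e * (W / (W + 1)).
  by field; rewrite gt_eqF // ltr_wpDl.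
rewrite -[leRHS]mulr1 ler_pM2l // ler_pdivrMr ?mul1r ?lerDl //.
by rewrite ltr_wpDl.
Qed.

End goursat.

(** * Circle means of complex functions *)

Section complex_modulus.
Context {R : realType}.
Implicit Types z w : R[i].

Definition cn z : R := Re `|z|.

Lemma cnE z : `|z| = (cn z)%:C.
Proof. by rewrite /cn RRe_real // ger0_real. Qed.
Lemma cn_ge0 z : 0 <= cn z. Proof. by rewrite -ler0c -cnE. Qed.
Lemma cnM z w : cn (z * w) = cn z * cn w.
Proof. by apply: complexI; rewrite rmorphM /= -!cnE normrM. Qed.
Lemma cnD z w : cn (z + w) <= cn z + cn w.
Proof. by rewrite -lecR rmorphD /= -!cnE ler_normD. Qed.
Lemma cnN z : cn (- z) = cn z.
Proof. by rewrite /cn normrN. Qed.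
Lemma cnX z n : cn (z ^+ n) = cn z ^+ n.
Proof. by apply: complexI; rewrite rmorphXn /= -!cnE normrX. Qed.
Lemma cnV z : cn z^-1 = (cn z)^-1.
Proof. by apply: complexI; rewrite fmorphV /= -!cnE normfV. Qed.
Lemma cn0 : cn 0 = 0. Proof. by rewrite /cn normr0. Qed.
Lemma cnR (r : R) : cn r%:C = `|r|.
Proof. by rewrite /cn normc_def /= expr0n addr0 sqrtr_sqr. Qed.
Lemma cnJ z : cn z^* = cn z.
Proof. by rewrite /cn normcJ. Qed.
Lemma cn_eq0 z : (cn z == 0) = (z == 0).
Proof. by rewrite -(normr_eq0 z) cnE -(inj_eq (@complexI R)). Qed.
Lemma cn_gt0 z : (0 < cn z) = (z != 0).
Proof. by rewrite lt_neqAle eq_sym cn_eq0 cn_ge0 andbT. Qed.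
Lemma cn_Re z : `|Re z| <= cn z.
Proof. by rewrite -lecR -cnE normc_ge_Re. Qed.
Lemma cn_Im z : `|Im z| <= cn z.
Proof.
have := cn_Re (z * 'i); rewrite ReiNIm normrN => /le_trans; apply.
by rewrite cnM /cn normc_def /= expr0n expr1n add0r sqrtr1 mulr1.
Qed.
Lemma cn_le z : cn z <= `|Re z| + `|Im z|.
Proof.
rewrite {1}[z]complexE; apply: le_trans (cnD _ _) _.
by rewrite cnM !cnR /cn normc_def /= expr0n expr1n add0r sqrtr1 mul1r.
Qed.
Lemma cn_sq z : cn z ^+ 2 = Re z ^+ 2 + Im z ^+ 2.
Proof. by apply: complexI; rewrite rmorphXn /= -cnE -add_Re2_Im2. Qed.
Lemma ReB z w : Re (z - w) = Re z - Re w.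
Proof. by case: z w => [? ?] [? ?]. Qed.
Lemma ImB z w : Im (z - w) = Im z - Im w.
Proof. by case: z w => [? ?] [? ?]. Qed.
Lemma RemulJ z : Re (z^* * z) = cn z ^+ 2.
Proof. by rewrite cn_sq; case: z => a b /=; rewrite mulNr opprK !expr2. Qed.

Lemma Re_sum (I : Type) (r : seq I) (P : pred I) (F : I -> R[i]) :
  Re (\sum_(i <- r | P i) F i) = \sum_(i <- r | P i) Re (F i).
Proof. by apply: (big_morph _ _ (erefl _)) => -[? ?] [? ?]. Qed.

Lemma ler_geo_lim (x c q : R) : 0 <= q < 1 -> (forall N, x <= c * q ^+ N) -> x <= 0.
Proof.
move=> /andP[q0 q1] h.
have l : c * q ^+ n @[n --> \oo] --> (c * 0 : R).
  by apply: cvgM; [apply: cvg_cst|apply: cvg_expr; rewrite ger0_norm].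
rewrite mulr0 in l; apply: cvgr_to_ge l _; exact: nearW.
Qed.

End complex_modulus.

Section littleo.
Context {K : numFieldType}.

Lemma is_derive_littleo (f : K^o -> K^o) (z : K^o) (d : K) :
  is_derive z (1 : K^o) f d <-> forall e, 0 < e -> exists2 dl, 0 < dl &
    forall h : K, `|h| < dl -> `|f (z + h) - f z - h * d| <= e * `|h|.
Proof.
split.
- move=> [/cvg_ex [l hd] fd] e e0.
  have ld : l = d by rewrite -fd; apply/esym/cvg_lim; first exact: norm_hausdorff.
  rewrite ld in hd.
  move/cvgrPdist_le/(_ e e0)/nbhs_ballP : hd => [dl /= dl0 h]; exists dl => // k kdl.
  have [->|k0] := eqVneq k 0; first by rewrite addr0 subrr mul0r subr0 normr0 mulr0.
  have := h k _ k0; rewrite /ball /= sub0r normrN => /(_ kdl).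
  rewrite /= /shift /= [k *: _]mulr1 [k + z]addrC => h'.
  have -> : f (z + k) - f z - k * d = - (k * (d - k^-1 * (f (z + k) - f z))) by field.
  by rewrite normrN normrM mulrC ler_wpM2r.
- move=> hd; suff l : h^-1 *: ((f \o shift z) (h *: (1 : K^o)) - f z) @[h --> 0^'] --> (d : K^o).
    by split; [apply/cvg_ex; exists d|apply: cvg_lim; first exact: norm_hausdorff].
  apply/cvgrPdist_le => e e0; have [dl dl0 h] := hd e e0.
  apply/nbhs_ballP; exists dl => // k; rewrite /ball /= sub0r normrN => kdl k0.
  rewrite /= /shift /= [k *: _]mulr1 [k + z]addrC.
  have k0' : 0 < `|k| by rewrite normr_gt0.
  rewrite -(ler_pM2r k0') -normrM.
  have -> : (d - k^-1 *: (f (z + k) - f z)) * k = - (f (z + k) - f z - k * d).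
    by rewrite /GRing.scale /=; field.
  by rewrite normrN h.
Qed.

End littleo.

Section diff2_rules.
Context {R : realType}.

(** Applied below to [expR s * cos t] and [expR s * sin t], the coordinates of exp(s + it). *)
Lemma diff2_mul (f g : R -> R) (s t f' g' : R) :
  is_derive s (1 : R) f f' -> is_derive t (1 : R) g g' ->
  diff2 (fun s t => f s * g t) s t (f' * g t) (f s * g').
Proof.
have littleo (h : R -> R) x h' : is_derive x (1 : R) h h' -> forall e, 0 < e ->
    exists2 dl, 0 < dl & forall x', `|x' - x| < dl ->
      `|h x' - h x - h' * (x' - x)| <= e * `|x' - x|.
  move=> /(is_derive_littleo (h : R^o -> R^o)) hd e /hd [dl dl0 hh]; exists dl => // x' /hh.
  by rewrite mulrC [x + _]addrC subrK.
move=> /littleo fd /littleo gd e e0.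
(* [c] adds up the coefficients of [e1] in the three error terms of the product; the last one bounds
   the increment of [f] by [|f'| + 1] times that of its argument. *)
pose c := `|g t| + `|f s| + (`|f'| + 1).
have c0 : 0 < c by rewrite /c; have := normr_ge0 (g t); have := normr_ge0 (f s);
  have := normr_ge0 f'; lra.
pose e1 := e / c.
have e10 : 0 < e1 by rewrite divr_gt0.
have [d1 d10 h1] := fd e1 e10.
have [d2 d20 h2] := gd e1 e10.
have [d3 d30 h3] := fd 1 ltr01.
have [d4 d40 h4] := gd 1 ltr01.
have g1 : 0 < `|g'| + 1 by rewrite ltr_wpDl.
exists (Order.min (Order.min d1 d2) (Order.min (Order.min d3 d4) (e1 / (`|g'| + 1)))).
  by rewrite !lt_min d10 d20 d30 d40 divr_gt0.
move=> s' t'; rewrite !lt_min => /andP[/andP[sd1 _] /andP[/andP[sd3 _] _]].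
move=> /andP[/andP[_ td2] /andP[/andP[_ td4] td5]].
have k1 := h1 s' sd1; have k2 := h2 t' td2; have k3 := h3 s' sd3; have k4 := h4 t' td4.
set a := s' - s in k1 k3 sd1 sd3 *; set b := t' - t in k2 k4 td2 td4 td5 *.
have k5 : `|f s' - f s| <= (`|f'| + 1) * `|a|.
  have -> : f s' - f s = (f s' - f s - f' * a) + f' * a by ring.
  by apply: le_trans (ler_normD _ _) _; rewrite normrM; lra.
have k6 : `|g t' - g t| <= e1.
  have -> : g t' - g t = (g t' - g t - g' * b) + g' * b by ring.
  apply: le_trans (ler_normD _ _) _; rewrite normrM.
  by rewrite ltr_pdivlMr // in td5; lra.
have -> : f s' * g t' - f s * g t - f' * g t * a - f s * g' * b
  = (f s' - f s - f' * a) * g t + f s * (g t' - g t - g' * b)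
    + (f s' - f s) * (g t' - g t) by ring.
apply: le_trans (ler_normD _ _) _.
apply: (@le_trans _ _ (e1 * `|a| * `|g t| + `|f s| * (e1 * `|b|) + (`|f'| + 1) * `|a| * e1)).
  apply: lerD; last by rewrite normrM ler_pM.
  apply: le_trans (ler_normD _ _) _; rewrite !normrM.
  by apply: lerD; [apply: ler_wpM2r|apply: ler_wpM2l].
have -> : e = e1 * c by rewrite /e1 divfK // gt_eqF.
rewrite -!(mulrA e1) (mulrCA `|f s|) [X in _ + X <= _]mulrC.
rewrite -!mulrDr ler_pM2l // /c.
have a0 := normr_ge0 a; have b0 := normr_ge0 b.
have gt0 := normr_ge0 (g t); have fs0 := normr_ge0 (f s); have f0 := normr_ge0 f'.
rewrite -subr_ge0.
have -> : (`|g t| + `|f s| + (`|f'| + 1)) * (`|a| + `|b|) -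
    (`|a| * `|g t| + `|f s| * `|b| + (`|f'| + 1) * `|a|)
  = `|f s| * `|a| + (`|g t| + `|f'| + 1) * `|b| by ring.
by rewrite addr_ge0 // mulr_ge0 // !addr_ge0.
Qed.

End diff2_rules.

Section circles.
Context {R : realType}.
Implicit Types (f g : R[i] -> R[i]) (z w : R[i]).

Definition cdiff f z := exists d : R[i], forall e : R, 0 < e ->
  exists2 dl : R, 0 < dl &
    forall h, cn h < dl -> cn (f (z + h) - f z - h * d) <= e * cn h.

Lemma cdiffP f z : cdiff f z <-> derivable (f : R[i]^o -> R[i]^o) z 1.
Proof.
split=> [[d hd]|/derivableP /is_derive_littleo hd]; last first.
  exists ('D_1 (f : R[i]^o -> R[i]^o) z) => e e0.
  have [|dl dl0 h] := hd e%:C; first by rewrite ltcR.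
  have er : dl = (Re dl)%:C by rewrite RRe_real // gtr0_real.
  exists (Re dl) => [|k kdl]; first by rewrite -ltcR -er.
  by rewrite -lecR rmorphM /= -!cnE h // cnE er ltcR.
suff : is_derive (z : R[i]^o) (1 : R[i]^o) (f : R[i]^o -> R[i]^o) d by case.
apply/is_derive_littleo => e e0; have er : e = (Re e)%:C by rewrite RRe_real // gtr0_real.
have [|dl dl0 h] := hd (Re e); first by rewrite -ltcR -er.
exists dl%:C => [|k]; first by rewrite ltcR.
by rewrite !cnE ltcR => /h; rewrite er -rmorphM lecR.
Qed.

Lemma cdiff_cst c z : cdiff (fun=> c) z.
Proof. by apply/cdiffP; exact: derivable_cst. Qed.
Lemma cdiff_id z : cdiff (fun x => x) z.
Proof. by apply/cdiffP; exact: derivable_id. Qed.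
Lemma cdiffD f g z : cdiff f z -> cdiff g z -> cdiff (fun x => f x + g x) z.
Proof.
move=> /cdiffP fz /cdiffP gz; apply/cdiffP; have := derivableD fz gz.
by have -> : (fun x => f x + g x) = (f : R[i]^o -> R[i]^o) + g by [].
Qed.
Lemma cdiffB f g z : cdiff f z -> cdiff g z -> cdiff (fun x => f x - g x) z.
Proof.
move=> /cdiffP fz /cdiffP gz; apply/cdiffP; have := derivableB fz gz.
by have -> : (fun x => f x - g x) = (f : R[i]^o -> R[i]^o) - g by [].
Qed.
Lemma cdiffM f g z : cdiff f z -> cdiff g z -> cdiff (fun x => f x * g x) z.
Proof.
move=> /cdiffP fz /cdiffP gz; apply/cdiffP; have := derivableM fz gz.
by have -> : (fun x => f x * g x) = (f : R[i]^o -> R[i]^o) * g by [].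
Qed.
Lemma cdiffV f z : f z != 0 -> cdiff f z -> cdiff (fun x => (f x)^-1) z.
Proof.
move=> fz /cdiffP gz; apply/cdiffP.
by have := derivableV (f := (f : R[i]^o -> R[i]^o)) fz gz.
Qed.
Lemma cdiffX n z : cdiff (fun x => x ^+ n) z.
Proof.
elim: n => [|n ih]; first exact: cdiff_cst.
have -> : (fun x : R[i] => x ^+ n.+1) = (fun x => x * x ^+ n).
  by apply/funext => x; rewrite exprS.
exact: (cdiffM (cdiff_id z) ih).
Qed.
Lemma cdiff_sum n (F : nat -> R[i] -> R[i]) z : (forall k, cdiff (F k) z) ->
  cdiff (fun x => \sum_(0 <= k < n) F k x) z.
Proof.
move=> h; elim: n => [|n ih].
  have -> : (fun x => \sum_(0 <= k < 0) F k x) = fun=> 0 by apply/funext => x; rewrite big_geq.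
  exact: cdiff_cst.
have -> : (fun x => \sum_(0 <= k < n.+1) F k x) = fun x => \sum_(0 <= k < n) F k x + F n x.
  by apply/funext => x; rewrite big_nat_recr.
exact: cdiffD ih (h n).
Qed.

Definition ccont f z := forall e : R, 0 < e -> exists2 dl : R, 0 < dl &
  forall h, cn h < dl -> cn (f (z + h) - f z) < e.

Lemma cdiff_ccont f z : cdiff f z -> ccont f z.
Proof.
move=> [d hd] e e0.
have [dl dl0 h] := hd 1 ltr01.
have d1 : 0 < cn d + 1 by rewrite ltr_wpDl ?cn_ge0.
exists (Order.min dl (e / (cn d + 1))); first by rewrite lt_min dl0 divr_gt0.
move=> k; rewrite lt_min => /andP[/h h1]; rewrite ltr_pdivlMr // => h2.
have -> : f (z + k) - f z = (f (z + k) - f z - k * d) + k * d by ring.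
by rewrite (le_lt_trans (cnD _ _)) // cnM; lra.
Qed.

Definition circ (r t : R) : R[i] := (r * cos t) +i* (r * sin t).

Lemma cn_circ r t : 0 <= r -> cn (circ r t) = r.
Proof.
move=> r0; rewrite /cn normc_def /= !exprMn -mulrDr cos2Dsin2 mulr1.
by rewrite sqrtr_sqr ger0_norm.
Qed.

Lemma circM r s t : circ (r * s) t = r%:C * circ s t.
Proof. by rewrite /circ /GRing.mul /= !mul0r subr0 addr0 !mulrA. Qed.

Lemma circ_cont (r t e : R) : 0 < e -> \forall t' \near t, cn (circ r t' - circ r t) < e.
Proof.
move=> e0.
have r0 : 0 < 2 * (`|r| + 1) by rewrite mulr_gt0 // ltr_wpDl.
have h1 := continuous_cos (R := R) (x := t); have h2 := continuous_sin (R := R) (x := t).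
move/cvgrPdist_lt/(_ _ (divr_gt0 e0 r0)) : h1 => h1.
move/cvgrPdist_lt/(_ _ (divr_gt0 e0 r0)) : h2 => h2.
apply: filterS2 h1 h2 => t' h1 h2.
apply: le_lt_trans (cn_le _) _; rewrite ReB ImB /= -!mulrBr !normrM.
rewrite distrC in h1; rewrite distrC in h2.
have r1 : 0 < `|r| + 1 by rewrite ltr_wpDl.
rewrite -mulrDr.
apply: (@le_lt_trans _ _ ((`|r| + 1) * (`|cos t' - cos t| + `|sin t' - sin t|))).
  by rewrite ler_wpM2r ?addr_ge0 // lerDl.
rewrite mulrC -ltr_pdivlMr //.
have -> : e / (`|r| + 1) = e / (2 * (`|r| + 1)) + e / (2 * (`|r| + 1)).
  by field; rewrite gt_eqF.
exact: ltrD.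
Qed.

(** The real part of the integral of f(z) dz / (iz). Identities between complex means are recovered
    by applying it to [w * f z] with [w] arbitrary. *)
Definition circ_int (r : R) f : R := itg 0 (2 * pi) (fun t => Re (f (circ r t))).

Lemma Re_circ_cont r f : 0 <= r -> (forall z, cn z = r -> ccont f z) ->
  cont_on 0 (2 * pi) (fun t => Re (f (circ r t))).
Proof.
move=> r0 fc t _; apply/cvgrPdist_lt => e e0.
have [dl dl0 h] := fc (circ r t) (cn_circ t r0) e e0.
have := circ_cont r t dl0.
apply: filterS => t' /h; rewrite [circ r t + _]addrC subrK => h'.
by rewrite distrC -ReB (le_lt_trans (cn_Re _)).
Qed.

(** With z = exp(s + it), f(z) dz / z becomes f(z) (ds + i dt), whose imaginary part is this form.
    Since f(z) has differential z d (ds + i dt), closedness is the Cauchy-Riemann equations. *)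
Lemma closed_form_polar f s t : cdiff f (circ (expR s) t) ->
  closed_form_at (fun s t => Im (f (circ (expR s) t)))
                 (fun s t => Re (f (circ (expR s) t))) s t.
Proof.
move=> [d hd].
set z := circ (expR s) t.
exists (Im (z * d)), (Re (z * d)), (- Im (z * d)).
suff key (e : R) : 0 < e -> exists2 dl : R, 0 < dl & forall s' t' : R,
    `|s' - s| < dl -> `|t' - t| < dl ->
    cn (f (circ (expR s') t') - f z - ((s' - s) +i* (t' - t)) * (z * d))
      <= e * (`|s' - s| + `|t' - t|).
  split=> e e0; have [dl dl0 h] := key e e0; exists dl => // s' t' h1 h2;
    have := h s' t' h1 h2; set w := f (circ _ t'); set v := f z.
  - move/(le_trans (cn_Im _)); rewrite !ImB => h3; apply: le_trans h3.
    apply: eqW; congr `|_|.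
    by case: (z * d) => x y /=; ring.
  - move/(le_trans (cn_Re _)); rewrite !ReB => h3; apply: le_trans h3.
    apply: eqW; congr `|_|.
    by case: (z * d) => x y /=; ring.
move=> e0.
pose C := cn d + cn z + 1.
have C0 : 0 < C by rewrite /C; have := cn_ge0 d; have := cn_ge0 z; lra.
pose e1 := Order.min 1 (e / C).
have e10 : 0 < e1 by rewrite lt_min ltr01 divr_gt0.
have e11 : e1 <= 1 by rewrite ge_min lexx.
have e1C : e1 * C <= e by rewrite -ler_pdivlMr // ge_min lexx orbT.
have e20 : 0 < e1 / 2 by rewrite divr_gt0.
have [d1 d10 h1] := diff2_mul (is_derive_expR s) (is_derive_cos t) e20.
have [d2 d20 h2] := diff2_mul (is_derive_expR s) (is_derive_sin t) e20.
have [d3 d30 h3] := hd e1 e10.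
have z1 : 0 < 2 * (cn z + 1) by rewrite mulr_gt0 // ltr_wpDl ?cn_ge0.
exists (Order.min (Order.min d1 d2) (d3 / (2 * (cn z + 1)))).
  by rewrite !lt_min d10 d20 divr_gt0.
move=> s' t'; rewrite !lt_min => /andP[/andP[s1 s2] s3] /andP[/andP[t1 t2] t3].
set N := `|s' - s| + `|t' - t|.
have N0 : 0 <= N by rewrite addr_ge0.
set k := (s' - s) +i* (t' - t).
set w := circ (expR s') t'.
have wz : cn (w - z - k * z) <= e1 * N.
  apply: le_trans (cn_le _) _.
  have := h1 s' t' s1 t1; have := h2 s' t' s2 t2; rewrite -/N => k1 k2.
  have -> : e1 * N = e1 / 2 * N + e1 / 2 * N by field.
  rewrite !ReB !ImB; apply: lerD.
    apply: le_trans k2; apply: eqW; congr `|_|.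
    by rewrite /w /z /circ /=; ring.
  apply: le_trans k1; apply: eqW; congr `|_|.
  by rewrite /w /z /circ /=; ring.
have kN : cn k <= N by apply: le_trans (cn_le _) _.
have wz2 : cn (w - z) <= (cn z + 1) * N.
  have -> : w - z = (w - z - k * z) + k * z by ring.
  apply: le_trans (cnD _ _) _; rewrite cnM.
  rewrite mulrDl mul1r addrC; apply: lerD.
    by rewrite mulrC ler_wpM2l ?cn_ge0.
  by apply: le_trans wz _; rewrite -[leRHS]mul1r ler_wpM2r.
have wd3 : cn (w - z) < d3.
  apply: le_lt_trans wz2 _.
  rewrite ltr_pdivlMr // in s3; rewrite ltr_pdivlMr // in t3.
  by rewrite /N; lra.
have := h3 _ wd3; rewrite [z + _]addrC subrK => h4.
have -> : f w - f z - k * (z * d) = (f w - f z - (w - z) * d) + (w - z - k * z) * d by ring.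
apply: le_trans (cnD _ _) _; rewrite cnM.
apply: (@le_trans _ _ (e1 * C * N)); last by rewrite ler_wpM2r.
have -> : e1 * C * N = e1 * ((cn z + 1) * N) + e1 * N * cn d by rewrite /C; ring.
apply: lerD; first by apply: le_trans h4 _; rewrite ler_wpM2l // ltW.
by rewrite ler_wpM2r ?cn_ge0.
Qed.

(** In logarithmic polar coordinates the region between the circles is a rectangle; the sides t = 0
    and t = 2 pi cancel by periodicity, and the other two are the circle integrals. *)
Lemma circ_int_const f (al be r1 r2 : R) :
  (forall z, al < cn z < be -> cdiff f z) -> 0 <= al ->
  al < r1 < be -> al < r2 < be -> circ_int r1 f = circ_int r2 f.
Proof.
move=> fd al0.
wlog r12 : r1 r2 / r1 <= r2.
  move=> h h1 h2; have [|/ltW] := leP r1 r2; first by move=> ?; apply: h.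
  by move=> ?; apply/esym/h.
move=> /andP[a1 b1] /andP[a2 b2].
have r10 : 0 < r1 by exact: le_lt_trans a1.
have r20 : 0 < r2 by exact: le_lt_trans a2.
pose a := ln r1; pose b := ln r2.
have ab : a <= b by rewrite /a /b ler_ln ?posrE.
have ea : expR a = r1 by rewrite lnK ?posrE.
have eb : expR b = r2 by rewrite lnK ?posrE.
have pi0 : 0 <= 2 * pi :> R by rewrite mulr_ge0 // pi_ge0.
have uv : closed_form_on (fun s t => Im (f (circ (expR s) t)))
    (fun s t => Re (f (circ (expR s) t))) a b 0 (2 * pi).
  move=> s t /andP[sa sb] _; apply: closed_form_polar; apply: fd.
  rewrite cn_circ ?expR_ge0 //; apply/andP; split.
    by apply: lt_le_trans a1 _; rewrite -ea ler_expR.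
  by apply: le_lt_trans b2; rewrite -eb ler_expR.
have := goursat ab pi0 uv; rewrite /bdry_int.
rewrite (@eq_itg _ _ _ _ (fun=> 0)); last first.
  move=> s _; rewrite /circ -[2 * pi]add0r cosD sinD mulr_natl cos2pi sin2pi.
  by rewrite cos0 sin0 !(mulr0, mulr1, mul0r, addr0, subr0) subrr.
rewrite itg_cst // mul0r add0r itgB.
- by move/eqP; rewrite subr_eq0 /circ_int ea eb => /eqP.
- by apply: closed_form_cont2 uv; rewrite lexx ab.
- by apply: closed_form_cont2 uv; rewrite lexx ab.
Qed.

End circles.

(** * Taylor expansion on the unit disc *)

Section dominated.
Context {R : realType}.

Lemma itg_dominated (fn : nat -> R -> R) (f : R -> R) (a b c : R) :
  (forall n, cont_on a b (fn n)) -> cont_on a b f ->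
  {ae (@lebesgue_measure R), forall t, a <= t <= b -> fn n t @[n --> \oo] --> f t} ->
  (forall n t, a <= t <= b -> `|fn n t| <= c) ->
  itg a b (fn n) @[n --> \oo] --> itg a b f.
Proof.
move=> fnc fc fnf fnb.
have := @dominated_convergence _ _ R lebesgue_measure `[a, b] _
  (fun n => EFin \o fn n) (EFin \o f) (cst c%:E).
case => //.
- by move=> n; apply: measurable_int; apply: cont_on_integrable.
- by apply: measurable_int; apply: cont_on_integrable.
- apply: filterS fnf; first exact: (ae_filter_ringOfSetsType lebesgue_measure).
  move=> t h /=; rewrite in_itv /= => tab.
  by apply/fine_cvgP; split; [apply: nearW|exact: h].
- have -> : cst c%:E = EFin \o (fun=> c) by [].
  by apply: cont_on_integrable; exact: cont_on_cst.
- apply: aeW => t n /=; rewrite in_itv /= => tab.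
  by rewrite lee_fin; apply: fnb.
- move=> intf _ h; apply: fine_cvg; rewrite fineK //.
  by apply: integrable_fin_num.
Qed.

End dominated.

Lemma cvg_harmonicS (R : realType) : n.+2%:R^-1 @[n --> \oo] --> (0 : R).
Proof. by have := @cvg_harmonic R; rewrite -cvg_shiftS. Qed.

Lemma harmonicS01 (R : realType) n : 0 < (n.+2%:R^-1 : R) < 1.
Proof. by rewrite invr_gt0 invf_lt1 // ltr1n ltr0n. Qed.

(** The sequence starts at 1/2, so that every radius lies strictly between 0 and 1. *)
Definition radius {R : realType} n : R := 1 - n.+2%:R^-1.

Lemma radius01 (R : realType) n : 0 < @radius R n < 1.
Proof. by have /andP[h0 h1] := @harmonicS01 R n; rewrite subr_gt0 h1 ltrBlDr ltrDl. Qed.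

Lemma cvg_radius (R : realType) : @radius R @ \oo --> (1 : R).
Proof. by rewrite -[X in _ --> X](subr0 1); apply: cvgB; [exact: cvg_cst|exact: cvg_harmonicS]. Qed.

Section taylor.
Context {R : realType}.
Implicit Types (z w : R[i]).

Let pi2_ge0 : 0 <= 2 * pi :> R.
Proof. by rewrite mulr_ge0 // pi_ge0. Qed.
Let pi2_gt0 : 0 < 2 * pi :> R.
Proof. by rewrite mulr_gt0 // pi_gt0. Qed.

Lemma cdiff_powV w (m : nat) z : z != 0 -> cdiff (fun z => w * z ^- m) z.
Proof.
move=> z0; apply: cdiffM; first exact: cdiff_cst.
by apply: cdiffV; [rewrite expf_neq0|exact: cdiffX].
Qed.

Lemma circ_int_cst (r : R) w : circ_int r (fun=> w) = 2 * pi * Re w.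
Proof. by rewrite /circ_int itg_cst // subr0 mulrC. Qed.

Lemma eq_circ_int_Re (r : R) (f g : R[i] -> R[i]) : 0 <= r ->
  (forall z, cn z = r -> Re (f z) = Re (g z)) -> circ_int r f = circ_int r g.
Proof. by move=> r0 fg; apply: eq_itg => t _; rewrite fg ?cn_circ. Qed.

Lemma eq_circ_int (r : R) (f g : R[i] -> R[i]) : 0 <= r ->
  (forall z, cn z = r -> f z = g z) -> circ_int r f = circ_int r g.
Proof. by move=> r0 fg; apply: eq_circ_int_Re => // z /fg ->. Qed.

Lemma circ_intD (r : R) (f g : R[i] -> R[i]) : 0 <= r ->
  (forall z, cn z = r -> ccont f z) -> (forall z, cn z = r -> ccont g z) ->
  circ_int r (fun z => f z + g z) = circ_int r f + circ_int r g.
Proof.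
move=> r0 fc gc; rewrite /circ_int -itgD; try exact: Re_circ_cont.
by apply: eq_itg => t _; rewrite ReD.
Qed.

Lemma circ_intB (r : R) (f g : R[i] -> R[i]) : 0 <= r ->
  (forall z, cn z = r -> ccont f z) -> (forall z, cn z = r -> ccont g z) ->
  circ_int r (fun z => f z - g z) = circ_int r f - circ_int r g.
Proof.
move=> r0 fc gc; rewrite /circ_int -itgB; try exact: Re_circ_cont.
by apply: eq_itg => t _; rewrite ReB.
Qed.

Lemma circ_int_abs_le (r c : R) (f : R[i] -> R[i]) : 0 <= r ->
  (forall z, cn z = r -> ccont f z) -> (forall z, cn z = r -> cn (f z) <= c) ->
  `|circ_int r f| <= c * (2 * pi).
Proof.
move=> r0 fc fle; rewrite -[X in _ <= _ * X]subr0; apply: itg_abs_le => //.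
  exact: Re_circ_cont.
by move=> t _; apply: le_trans (cn_Re _) (fle _ _); rewrite cn_circ.
Qed.

(** For [m > 0] the integral does not depend on the radius, yet doubling the radius multiplies it by
    [2 ^- m]; hence it vanishes. *)
Lemma circ_int_powV (r : R) w (m : nat) : 0 < r ->
  circ_int r (fun z => w * z ^- m) = if m == 0%N then 2 * pi * Re w else 0.
Proof.
move=> r0; case: eqP => [->|/eqP m0].
  rewrite -(circ_int_cst r); apply: eq_itg => t _.
  by rewrite expr0 invr1 mulr1.
pose V s := circ_int s (fun z => w * z ^- m).
have Vc s : 0 < s -> V s = V 1.
  move=> s0; apply: (@circ_int_const _ _ 0 (s + 2)) => //.
  - by move=> z /andP[z0 _]; apply: cdiff_powV; rewrite -cn_gt0.
  - by rewrite s0 ltrDl ltr0n.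
  - by rewrite ltr01 /=; lra.
suff V1 : V 1 = 0 by rewrite -/(V r) Vc.
have cont : cont_on 0 (2 * pi) (fun t => Re (w * (circ 1 t) ^- m)).
  apply: (@Re_circ_cont _ 1 (fun z => w * z ^- m)) => // z z1.
  by apply: cdiff_ccont; apply: cdiff_powV; rewrite -cn_gt0 z1.
have V2 : V 2 = 2 ^- m * V 1.
  rewrite /V /circ_int -itgZ //; apply: eq_itg => t _.
  rewrite -{1}[2]mulr1 circM exprMn invfM mulrCA -rmorphXn -fmorphV.
  by rewrite -ReZ.
have : (1 - 2 ^- m) * V 1 = 0 by rewrite mulrBl mul1r -V2 Vc // subrr.
move/eqP; rewrite mulf_eq0 subr_eq0 => /orP[|/eqP //].
rewrite eq_sym => /eqP h; exfalso.
have : 2 ^- m < 1 :> R by rewrite invf_lt1 ?exprn_gt0 // exprn_egt1 // ltr1n.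
by rewrite h ltxx.
Qed.

Lemma circ_int_sum (r : R) (n : nat) (F : nat -> R[i] -> R[i]) : 0 <= r ->
  (forall k z, (k < n)%N -> cn z = r -> ccont (F k) z) ->
  circ_int r (fun z => \sum_(0 <= k < n) F k z) = \sum_(0 <= k < n) circ_int r (F k).
Proof.
move=> r0 Fc.
have C k : (k < n)%N -> cont_on 0 (2 * pi) (fun t => Re (F k (circ r t))).
  by move=> kn; apply: Re_circ_cont => // z zr; apply: Fc.
suff H : forall m, (m <= n)%N ->
    cont_on 0 (2 * pi) (fun t => Re (\sum_(0 <= k < m) F k (circ r t))) /\
    circ_int r (fun z => \sum_(0 <= k < m) F k z) = \sum_(0 <= k < m) circ_int r (F k).
  by have [_ ->] := H n (leqnn n).
elim=> [_|m ih mn].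
  split; first by under eq_fun do rewrite big_geq //; apply: cont_on_cst.
  rewrite big_geq //; transitivity (circ_int r (fun=> 0)).
    by apply: eq_circ_int => // z _; rewrite big_geq.
  by rewrite circ_int_cst mulr0.
have [ih1 ih2] := ih (ltnW mn).
have E t : Re (\sum_(0 <= k < m.+1) F k (circ r t))
    = Re (\sum_(0 <= k < m) F k (circ r t)) + Re (F m (circ r t)).
  by rewrite big_nat_recr //= ReD.
split; first by under eq_fun do rewrite E; apply: cont_onD => //; apply: C.
rewrite big_nat_recr //= -ih2 /circ_int -itgD //; last exact: C.
by apply: eq_itg => t _; rewrite E.
Qed.

Variables (f : R[i] -> R[i]) (a : nat -> R[i]) (M : R).
Hypothesis fd : forall z, cn z < 1 -> cdiff f z.
Hypothesis fM : forall z, cn z < 1 -> cn (f z) <= M.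
Hypothesis fa : forall N, exists c rho : R, [/\ 0 <= c, 0 < rho & forall z, cn z < rho ->
  cn (f z - \sum_(0 <= k < N) a k * z ^+ k) <= c * cn z ^+ N].

Let M0 : 0 <= M.
Proof. by apply: le_trans (cn_ge0 _) (fM (z := 0) _); rewrite cn0. Qed.

(** The integral does not depend on the radius, so it may be computed on circles of radius [s]
    tending to 0. There the expansion [fa] of order k + 1 replaces [f] by a polynomial with an error
    of order [s]; no power series for [f] is presupposed. *)
Lemma circ_int_coef (r : R) w (k : nat) : 0 < r < 1 ->
  circ_int r (fun z => w * (f z * z ^- k)) = 2 * pi * Re (w * a k).
Proof.
move=> r01; set V := fun s => circ_int s (fun z => w * (f z * z ^- k)).
have gd z : 0 < cn z < 1 -> cdiff (fun z => w * (f z * z ^- k)) z.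
  move=> /andP[z0 z1]; apply: cdiffM; first exact: cdiff_cst.
  apply: cdiffM; first exact: fd.
  by apply: cdiffV; [rewrite expf_neq0 // -cn_gt0|exact: cdiffX].
have Vc s : 0 < s < 1 -> V s = V r.
  by move=> s01; apply: (circ_int_const gd).
rewrite -/(V r).
have [c [rho [c0 rho0 hc]]] := fa k.+1.
apply/eqP; rewrite -subr_eq0 -normr_le0.
have key (s : R) : 0 < s -> s < 1 -> s < rho ->
    `|V r - 2 * pi * Re (w * a k)| <= cn w * c * s * (2 * pi).
  move=> s0 s1 srho.
  have z_neq0 z : cn z = s -> z != 0 by rewrite -cn_gt0 => ->.
  pose T z := \sum_(0 <= j < k.+1) (w * a j) * z ^- (k - j).
  have T_diff z : cn z = s -> cdiff T z.
    move=> zs; apply: (@cdiff_sum _ _ (fun j z => w * a j * z ^- (k - j))) => j.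
    by apply: cdiff_powV; exact: z_neq0.
  have <- : V s = V r by rewrite Vc // s0.
  have <- : circ_int s T = 2 * pi * Re (w * a k).
    rewrite circ_int_sum ?(ltW s0) //; last first.
      by move=> j z _ zs; apply: cdiff_ccont; apply: cdiff_powV; exact: z_neq0.
    rewrite big_nat_recr //= circ_int_powV // subnn eqxx big_nat big1 ?add0r //.
    by move=> j /andP[_ jk]; rewrite circ_int_powV // subn_eq0 leqNgt jk.
  have V_diff z : cn z = s -> cdiff (fun z => w * (f z * z ^- k)) z.
    by move=> zs; apply: gd; rewrite zs s0.
  rewrite /V -circ_intB ?(ltW s0) //; last 2 first.
  - by move=> z zs; apply: cdiff_ccont; exact: V_diff.
  - by move=> z zs; apply: cdiff_ccont; exact: T_diff.
  apply: circ_int_abs_le => [|z zs|z zs]; first exact: ltW.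
    by apply: cdiff_ccont; apply: cdiffB; [exact: V_diff|exact: T_diff].
  have z0 := z_neq0 z zs.
  have -> : w * (f z * z ^- k) - T z
      = w * (z ^- k * (f z - \sum_(0 <= j < k.+1) a j * z ^+ j)).
    rewrite /T !mulrBr (mulrC (f z)); congr (_ - _).
    rewrite !big_distrr /=; apply: eq_big_nat => j /andP[_ jk].
    rewrite -mulrA; congr (_ * _); rewrite mulrCA; congr (_ * _).
    by rewrite -{2}(subnK (ltnSE jk)) exprD; field; rewrite !expf_neq0.
  rewrite !cnM cnV cnX zs -!mulrA ler_wpM2l ?cn_ge0 //.
  rewrite mulrC ler_pdivrMr ?exprn_gt0 //.
  by rewrite -mulrA -exprS; have := hc z; rewrite zs; apply.
pose q := Order.min 1 rho.
have q0 : 0 < q by rewrite lt_min ltr01.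
apply: cvgr_to_ge (_ : cn w * c * (q * n.+2%:R^-1) * (2 * pi) @[n --> \oo] --> (0 : R)) _.
  rewrite -(mul0r (2 * pi)) -(mulr0 (cn w * c)) -(mulr0 q); apply: cvgM; last exact: cvg_cst.
  by do 2![apply: cvgM; first exact: cvg_cst]; exact: cvg_harmonicS.
apply: nearW => n; have /andP[n0 n1] := harmonicS01 R n.
have : q * n.+2%:R^-1 < q by rewrite gtr_pMr.
by rewrite lt_min => /andP[? ?]; apply: key => //; exact: mulr_gt0.
Qed.

(** Cauchy's estimate with [w] the conjugate of [a k], which turns the coefficient into
    [cn (a k) ^+ 2]; the radius then tends to 1. *)
Lemma taylor_coef_le k : cn (a k) <= M.
Proof.
have [->|ak] := eqVneq (a k) 0; first by rewrite cn0.
have ak0 : 0 < cn (a k) by rewrite cn_gt0.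
have key (r : R) : 0 < r < 1 -> r ^+ k * cn (a k) <= M.
  move=> /[dup] r01 /andP[r0 r1].
  have := circ_int_coef (a k)^* k r01; rewrite RemulJ => h.
  have : `|circ_int r (fun z => (a k)^* * (f z * z ^- k))|
      <= cn (a k) * (M * r ^- k) * (2 * pi).
    apply: circ_int_abs_le => [|z zr|z zr]; first exact: ltW.
      apply: cdiff_ccont; apply: cdiffM; first exact: cdiff_cst.
      apply: cdiffM; first by apply: fd; rewrite zr.
      by apply: cdiffV; [rewrite expf_neq0 // -cn_gt0 zr|exact: cdiffX].
    rewrite cnM cnJ ler_wpM2l ?cn_ge0 // cnM cnV cnX zr.
    by rewrite ler_wpM2r ?invr_ge0 ?exprn_ge0 ?(ltW r0) // fM // zr.
  move/(le_trans (ler_norm _)); rewrite h [X in X <= _]mulrC ler_pM2r //.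
  by rewrite expr2 ler_pM2l // ler_pdivlMr ?exprn_gt0 // mulrC.
have l : radius n ^+ k * cn (a k) @[n --> \oo] --> (1 ^+ k * cn (a k) : R).
  apply: cvgM; last exact: cvg_cst.
  apply: (@cvg_comp _ _ _ radius (fun x : R => x ^+ k)); last exact: exprn_continuous.
  exact: cvg_radius.
rewrite expr1n mul1r in l; apply: cvgr_to_le l _.
by apply: nearW => n; apply: key; exact: radius01.
Qed.

Lemma taylor_at0 : f 0 = a 0%N.
Proof.
have [c [rho [c0 rho0 h]]] := fa 1.
have := h 0; rewrite cn0 => /(_ rho0).
rewrite expr1 mulr0 big_nat1 expr0 mulr1 => h'.
by apply/subr0_eq/eqP; rewrite -cn_eq0 eq_le h' cn_ge0.
Qed.

(* Cauchy's formula: the means of [(f z - f z0) z / (z - z0)] over the circles of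
   radius [r < cn z0] and of radius [r > cn z0] are constant, and they agree at [cn z0]. *)
Lemma taylor_disc z0 : cn z0 < 1 -> exists c q : R, 0 <= q < 1 /\
  forall N, cn (f z0 - \sum_(0 <= k < N.+1) a k * z0 ^+ k) <= c * q ^+ N.
Proof.
move=> z01; have [->|z0n] := eqVneq z0 0.
  exists 0, 0; split; first by rewrite lexx ltr01.
  move=> N; rewrite big_nat_recl //= expr0 mulr1 big1 ?addr0 ?taylor_at0 ?subrr ?cn0 ?mul0r //.
  by move=> k _; rewrite expr0n mulr0.
have z00 : 0 < cn z0 by rewrite cn_gt0.
have [d hd] := fd z01.
(* The difference quotient extended by the derivative; at [z0] only its continuity is
   established. *)
pose h z := if z == z0 then d else (f z - f z0) / (z - z0).
have hE z : (f z - f z0) = h z * (z - z0).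
  rewrite /h; case: eqP => [->|/eqP zz]; first by rewrite !subrr mulr0.
  by rewrite divfK // subr_eq0.
have h_cont0 : ccont h z0.
  move=> e e0; have e2 : 0 < e / 2 by rewrite divr_gt0.
  have [dl dl0 hdl] := hd (e / 2) e2; exists dl => // k kdl.
  rewrite {2}/h eqxx /h; case: eqP => [_|/eqP kn]; first by rewrite subrr cn0.
  have k0 : k != 0 by apply: contraNneq kn => ->; rewrite addr0.
  have k0' : 0 < cn k by rewrite cn_gt0.
  rewrite -(ltr_pM2r k0') -cnM.
  rewrite [z0 + k - z0]addrAC subrr add0r mulrBl divfK // (mulrC d).
  by apply: le_lt_trans (hdl k kdl) _; rewrite ltr_pM2r //; lra.
have h_diff z : cn z < 1 -> z != z0 -> cdiff h z.
  move=> z1 zz0.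
  have [d' hd'] : cdiff (fun z => (f z - f z0) / (z - z0)) z.
    apply: cdiffM; first by apply: cdiffB; [exact: fd|exact: cdiff_cst].
    apply: cdiffV; first by rewrite subr_eq0.
    by apply: cdiffB; [exact: cdiff_id|exact: cdiff_cst].
  exists d' => e e0; have [dl dl0 hdl] := hd' e e0.
  have zz1 : 0 < cn (z0 - z) by rewrite cn_gt0 subr_eq0 eq_sym.
  exists (Order.min dl (cn (z0 - z))) => [|k]; first by rewrite lt_min dl0.
  rewrite lt_min => /andP[k1 k2].
  have -> : h (z + k) = (f (z + k) - f z0) / (z + k - z0).
    rewrite /h; case: eqP => // zk.
    by move: k2; rewrite -zk addrAC subrr add0r ltxx.
  by rewrite /h (negbTE zz0); apply: hdl.
have h_cont z : cn z < 1 -> ccont h z.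
  by move=> z1; have [->//|zz0] := eqVneq z z0; apply: cdiff_ccont; apply: h_diff.
have [K K0 hK] : exists2 K : R, 0 <= K & forall z, cn z < 1 -> cn (h z) <= K.
  have [dl dl0 hdl] := h_cont0 1 ltr01.
  exists (cn d + 1 + 2 * M / dl).
    by rewrite !addr_ge0 ?cn_ge0 // divr_ge0 ?mulr_ge0 // ltW.
  move=> z z1; have [zz|zz] := ltP (cn (z - z0)) dl.
    have := hdl _ zz; rewrite [z0 + _]addrC subrK {2}/h eqxx => h1.
    apply: (@le_trans _ _ (cn d + 1)); last by rewrite lerDl divr_ge0 ?mulr_ge0 // ltW.
    by rewrite -[h z](subrK d) (le_trans (cnD _ _)) // addrC lerD2l ltW.
  have zz0 : z != z0 by apply: contraTneq zz => ->; rewrite subrr cn0 -ltNge.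
  rewrite /h (negbTE zz0) cnM cnV.
  apply: (@le_trans _ _ (2 * M / dl)); last by rewrite lerDr addr_ge0 ?cn_ge0.
  apply: ler_pM; rewrite ?invr_ge0 ?cn_ge0 //.
    rewrite (le_trans (cnD _ _)) // cnN mulr_natl mulr2n.
    by apply: lerD; apply: fM.
  by rewrite lef_pV2 ?posrE // (lt_le_trans dl0).
(* A circle between [z0] and the unit circle; the rate of convergence will be [cn z0 / r]. *)
pose r := (1 + cn z0) / 2.
have r1 : r < 1 by rewrite /r; lra.
have rz : cn z0 < r by rewrite /r; lra.
have r0 : 0 < r by exact: lt_trans rz.
have G0 w : circ_int r (fun z => w * (h z * z)) = 0.
  pose G z := w * (h z * z); pose V s := circ_int s G.
  have G_diff z : cn z < 1 -> z != z0 -> cdiff G z.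
    move=> z1 zz; apply: cdiffM; first exact: cdiff_cst.
    by apply: cdiffM; [exact: h_diff|exact: cdiff_id].
  have G_bnd z : cn z < 1 -> cn (G z) <= cn w * K * cn z.
    move=> z1; rewrite !cnM -mulrA ler_wpM2l ?cn_ge0 // ler_wpM2r ?cn_ge0 //.
    exact: hK.
  have G_cont z : cn z < 1 -> ccont G z.
    move=> z1; have [->|zz] := eqVneq z z0; last by apply: cdiff_ccont; apply: G_diff.
    move=> e e0.
    pose c := cn w * (K + 1) + 1.
    have c0 : 0 < c by rewrite /c ltr_wpDl // mulr_ge0 ?cn_ge0 ?addr_ge0.
    have ec : 0 < e / c by rewrite divr_gt0.
    have [d1 d10 h1] := h_cont0 _ ec.
    exists (Order.min d1 (Order.min (e / c) (1 - cn z0))).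
      by rewrite !lt_min d10 ec subr_gt0.
    move=> k; rewrite !lt_min => /andP[/h1 k1 /andP[k2 k3]].
    have -> : G (z0 + k) - G z0 = w * ((h (z0 + k) - h z0) * z0 + h (z0 + k) * k).
      by rewrite /G; ring.
    rewrite cnM.
    have zk1 : cn (z0 + k) < 1 by rewrite (le_lt_trans (cnD _ _)) //; lra.
    have b1 : cn ((h (z0 + k) - h z0) * z0 + h (z0 + k) * k) <= (K + 1) * (e / c).
      rewrite (le_trans (cnD _ _)) // !cnM mulrDl mul1r addrC; apply: lerD.
        by apply: ler_pM; rewrite ?cn_ge0 ?hK // ltW.
      rewrite -[leRHS]mulr1; apply: ler_pM; rewrite ?cn_ge0 //; exact: ltW.
    apply: le_lt_trans (ler_wpM2l (cn_ge0 w) b1) _.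
    have -> : cn w * ((K + 1) * (e / c)) = e * (cn w * (K + 1) / c) by ring.
    rewrite -[ltRHS]mulr1 ltr_pM2l // ltr_pdivrMr // mul1r.
    by rewrite /c ltrDl.
  (* Constancy in the radius stops at the circle through [z0], where [G] is only continuous;
     dominated convergence carries it across. *)
  have Vlim (s : nat -> R) (s0 : R) : 0 <= s0 < 1 -> (forall n, 0 <= s n < 1) ->
      s n @[n --> \oo] --> s0 -> V (s n) @[n --> \oo] --> V s0.
    move=> /andP[s00 s01] sn01 ss.
    apply: (@itg_dominated _ _ _ _ _ (cn w * K)).
    - move=> n; have /andP[n0 n1] := sn01 n; apply: Re_circ_cont => // z zn.
      by apply: G_cont; rewrite zn.
    - by apply: Re_circ_cont => // z zs; apply: G_cont; rewrite zs.
    - apply: aeW => t _; apply/cvgrPdist_lt => e e0.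
      have zs : cn (circ s0 t) < 1 by rewrite cn_circ.
      have [dl dl0 hG] := G_cont _ zs e e0.
      move/cvgrPdist_lt/(_ _ dl0) : ss; apply: filterS => n sn.
      rewrite distrC -ReB; apply: le_lt_trans (cn_Re _) _.
      have -> : circ (s n) t = circ s0 t + (s n - s0)%:C * circ 1 t.
        by rewrite -circM mulr1 /circ; congr (_ +i* _); ring.
      by apply: hG; rewrite cnM cnR cn_circ // mulr1 distrC.
    - move=> n t _; have /andP[n0 n1] := sn01 n.
      apply: le_trans (cn_Re _) _; apply: le_trans (G_bnd _ _) _; rewrite cn_circ //.
      by rewrite -[leRHS]mulr1 ler_wpM2l ?mulr_ge0 ?cn_ge0 // ltW.
  have Vin s : 0 < s < cn z0 -> V s = V (cn z0 / 2).
    move=> s0; apply: (@circ_int_const _ _ 0 (cn z0)) => //.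
      move=> z /andP[_ zz]; apply: G_diff; first exact: lt_trans z01.
      by apply: contraTneq zz => ->; rewrite ltxx.
    by apply/andP; split; lra.
  have Vout s : cn z0 < s < 1 -> V s = V r.
    move=> s0; apply: (@circ_int_const _ _ (cn z0) 1) => //; last first.
    - by rewrite rz.
    - exact: cn_ge0.
    move=> z /andP[zz z1]; apply: G_diff => //.
    by apply: contraTneq zz => ->; rewrite ltxx.
  have Veq v (s : nat -> R) (s0 : R) : 0 <= s0 < 1 -> s @ \oo --> s0 ->
      (forall n, 0 <= s n < 1 /\ V (s n) = v) -> V s0 = v.
    move=> s01 ss sv; apply: (@cvgn_cst_eq _ (V \o s)); last by move=> n; have [] := sv n.
    by apply: Vlim => // n; have [] := sv n.
  have V1 : V (cn z0) = V (cn z0 / 2).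
    apply: (Veq _ (fun n => cn z0 * radius n)); first by rewrite cn_ge0.
      by rewrite -[X in _ --> X]mulr1; apply: cvgM; [exact: cvg_cst|exact: cvg_radius].
    move=> n; move: (radius n : R) (radius01 R n) => x /andP[? ?].
    by split; [|apply: Vin]; apply/andP; split; nra.
  have V2 : V (cn z0) = V r.
    apply: (Veq _ (fun n => cn z0 + (1 - cn z0) * n.+2%:R^-1)); first by rewrite cn_ge0.
      rewrite -[X in _ --> X]addr0 -(mulr0 (1 - cn z0)); apply: cvgD; first exact: cvg_cst.
      by apply: cvgM; [exact: cvg_cst|exact: cvg_harmonicS].
    move=> n; move: (n.+2%:R^-1) (harmonicS01 R n) => x /andP[? ?].
    by split; [|apply: Vout]; apply/andP; split; nra.
  (* The circle of radius 0 is the origin, where [G] vanishes; this fixes the common value as 0. *)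
  have V3 : V 0 = V (cn z0 / 2).
    apply: (Veq _ (fun n => cn z0 * n.+2%:R^-1)); first by rewrite lexx ltr01.
      by rewrite -[X in _ --> X](mulr0 (cn z0)); apply: cvgM; [exact: cvg_cst|exact: cvg_harmonicS].
    move=> n; move: (n.+2%:R^-1) (harmonicS01 R n) => x /andP[? ?].
    by split; [|apply: Vin]; apply/andP; split; nra.
  rewrite -/G -/(V r) -V2 V1 -V3 /V /circ_int.
  rewrite (@eq_itg _ _ _ _ (fun=> 0)) ?itg_cst ?mul0r // => t _.
  by rewrite /G /circ !mul0r -[0 +i* 0]/(0 : R[i]) !mulr0.
pose q := cn z0 / r.
have q01 : 0 <= q < 1 by rewrite divr_ge0 ?cn_ge0 ?ltW //= ltr_pdivrMr // mul1r.
exists K, q; split => // N.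
set D := f z0 - _.
(* [D] is paired with an arbitrary [w], set to its conjugate at the end, because [circ_int] sees
   real parts only. *)
have DE w : 2 * pi * Re (w * D) <= 2 * pi * (cn w * K * q ^+ N).
  have zr1 z : cn z = r -> cn z < 1 by move=> ->.
  have zr0 z : cn z = r -> z != 0 by rewrite -cn_gt0 => ->.
  have zrz z : cn z = r -> z != z0.
    by move=> zr; apply: contraTneq rz => <-; rewrite zr ltxx.
  have c1 z : cn z = r -> cdiff (fun z => w * (h z * z)) z.
    move=> zr; apply: cdiffM; first exact: cdiff_cst.
    by apply: cdiffM; [apply: h_diff; [exact: zr1|exact: zrz]|exact: cdiff_id].
  have c2 k z : cn z = r -> cdiff (fun z => w * z0 ^+ k * (f z * z ^- k)) z.
    move=> zr; apply: cdiffM; first exact: cdiff_cst.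
    apply: cdiffM; first by apply: fd; exact: zr1.
    by apply: cdiffV; [rewrite expf_neq0 // zr0|exact: cdiffX].
  have c3 k z : cn z = r -> cdiff (fun z => w * f z0 * z0 ^+ k * z ^- k) z.
    by move=> zr; apply: cdiff_powV; exact: zr0.
  pose S1 z := \sum_(0 <= k < N.+1) w * z0 ^+ k * (f z * z ^- k).
  pose S2 z := \sum_(0 <= k < N.+1) w * f z0 * z0 ^+ k * z ^- k.
  have I1 : circ_int r S1 = 2 * pi * Re (w * \sum_(0 <= k < N.+1) a k * z0 ^+ k).
    rewrite circ_int_sum ?(ltW r0) //; last by move=> k z _ zr; apply: cdiff_ccont; exact: c2.
    rewrite big_distrr /= Re_sum big_distrr /=; apply: eq_bigr => k _.
    by rewrite circ_int_coef ?r0 //; congr (_ * Re _); ring.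
  have I2 : circ_int r S2 = 2 * pi * Re (w * f z0).
    rewrite circ_int_sum ?(ltW r0) //; last by move=> k z _ zr; apply: cdiff_ccont; exact: c3.
    rewrite big_nat_recl //= circ_int_powV // eqxx expr0 mulr1 big1 ?addr0 // => k _.
    by rewrite circ_int_powV.
  have S1_diff z : cn z = r -> cdiff S1 z.
    by move=> zr; apply: (@cdiff_sum _ _ (fun k z => w * z0 ^+ k * (f z * z ^- k))) => k; exact: c2.
  have S2_diff z : cn z = r -> cdiff S2 z.
    by move=> zr; apply: (@cdiff_sum _ _ (fun k z => w * f z0 * z0 ^+ k * z ^- k)) => k; exact: c3.
  have E : 2 * pi * Re (w * D) = circ_int r (fun z => S2 z - S1 z).
    rewrite /D mulrBr ReB mulrBr -I1 -I2 circ_intB ?(ltW r0) // => z zr; apply: cdiff_ccont.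
      exact: S2_diff.
    exact: S1_diff.
  (* As f(z) - f(z0) = h(z) (z - z0), the geometric sum in z0 / z telescopes. The second term
     integrates to 0 by [G0], the first carries the decay. *)
  have S12 z : cn z = r -> S2 z - S1 z = w * (h z * (z0 ^+ N.+1 * z ^- N)) - w * (h z * z).
    move=> zr; rewrite /S1 /S2 -sumrB.
    under eq_bigr => k _.
      have -> : w * f z0 * z0 ^+ k * z ^- k - w * z0 ^+ k * (f z * z ^- k)
        = - w * (z0 ^+ k * z ^- k * (f z - f z0)) by ring.
      rewrite hE.
      over.
    have zn := zr0 z zr.
    elim: (N) => [|n ih]; first by rewrite big_nat1 !expr0 expr1 invr1; ring.
    rewrite big_nat_recr //= ih.
    have -> : z0 ^+ n.+2 = z0 ^+ n.+1 * z0 by rewrite exprSr.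
    have -> : z ^- n = z ^- n.+1 * z by rewrite exprSr; field; rewrite zn expf_neq0.
    by ring.
  pose T z := w * (h z * (z0 ^+ N.+1 * z ^- N)).
  have T_diff z : cn z = r -> cdiff T z.
    move=> zr; apply: cdiffM; first exact: cdiff_cst.
    apply: cdiffM; first by apply: h_diff; [exact: zr1|exact: zrz].
    by apply: cdiff_powV; exact: zr0.
  have -> : 2 * pi * Re (w * D) = circ_int r T.
    rewrite E -[RHS]subr0 -(G0 w) -circ_intB ?(ltW r0) //; last 2 first.
    - by move=> z zr; apply: cdiff_ccont; exact: T_diff.
    - by move=> z zr; apply: cdiff_ccont; exact: c1.
    by apply: eq_circ_int => [|z /S12]; first exact: ltW.
  apply: le_trans (ler_norm _) _; rewrite mulrC.
  apply: circ_int_abs_le => [|z zr|z zr]; first exact: ltW.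
    by apply: cdiff_ccont; exact: T_diff.
  rewrite /T cnM -mulrA ler_wpM2l ?cn_ge0 // cnM; apply: ler_pM; rewrite ?cn_ge0 //.
    by apply: hK; exact: zr1.
  rewrite cnM cnV !cnX zr /q (expr_div_n (cn z0))  ler_wpM2r ?invr_ge0 ?exprn_ge0 ?(ltW r0) //.
  by rewrite exprS ger_pMl ?exprn_gt0 // ltW.
have := DE D^*; rewrite RemulJ cnJ ler_pM2l //.
have [->|D0] := eqVneq D 0.
  by rewrite cn0 mulr_ge0 // exprn_ge0 //; case/andP: q01.
by rewrite expr2 -mulrA ler_pM2l // cn_gt0.
Qed.

End taylor.

(** * Parseval's identity for vector-valued polynomials *)

Section vector_valued.
Context {R : realType} {Y : hilbertType R}.
Implicit Types (F : R[i] -> Y) (z : R[i]).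

(** The real inequality, applied to [x] multiplied by the conjugate of [ip x y], which makes the
    product real and nonnegative. *)
Lemma ip_cn_le (x y : Y) : cn (ip x y) <= nrm x * nrm y.
Proof.
have [->|c0] := eqVneq (ip x y) 0; first by rewrite cn0 mulr_ge0 ?nrm_ge0.
rewrite -(ler_pM2l (x := cn (ip x y))) ?cn_gt0 // -expr2 -RemulJ.
have -> : Re (conjc (ip x y) * ip x y) = rip (conjc (ip x y) *: x) y.
  by rewrite /rip linearZl_LR.
apply: le_trans (ler_norm _) _; apply: le_trans (rip_le _ _) _.
by rewrite nrmZ -/(cn _) cnJ mulrA.
Qed.

Lemma ipZl (a : R[i]) (x y : Y) : ip (a *: x) y = a * ip x y.
Proof. by rewrite linearZl_LR. Qed.
Lemma ipZZ (a b : R[i]) (x y : Y) : ip (a *: x) (b *: y) = a * conjc b * ip x y.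
Proof. by rewrite ipZl ipC ipZl rmorphM /= mulrA -ipC. Qed.

Definition hcont F z := forall e : R, 0 < e -> exists2 dl : R, 0 < dl &
  forall h, cn h < dl -> nrm (F (z + h) - F z) < e.

Lemma hcont_cst (y : Y) z : hcont (fun=> y) z.
Proof. by move=> e e0; exists 1 => // h _; rewrite subrr nrm0. Qed.

Lemma hcontD F G z : hcont F z -> hcont G z -> hcont (fun z => F z + G z) z.
Proof.
move=> Fz Gz e e0; have e2 : 0 < e / 2 by rewrite divr_gt0.
have [d1 d10 h1] := Fz _ e2; have [d2 d20 h2] := Gz _ e2.
exists (Order.min d1 d2) => [|h]; first by rewrite lt_min d10.
rewrite lt_min => /andP[/h1 k1 /h2 k2].
by rewrite opprD addrACA (le_lt_trans (nrmD _ _)) //; lra.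
Qed.

Lemma hcont_sum n (F : nat -> R[i] -> Y) z : (forall k, hcont (F k) z) ->
  hcont (fun z => \sum_(0 <= k < n) F k z) z.
Proof.
move=> h; elim: n => [|n ih].
  have -> : (fun z => \sum_(0 <= k < 0) F k z) = fun=> 0.
    by apply/funext => x; rewrite big_geq.
  exact: hcont_cst.
have -> : (fun z => \sum_(0 <= k < n.+1) F k z) = fun z => \sum_(0 <= k < n) F k z + F n z.
  by apply/funext => x; rewrite big_nat_recr.
exact: hcontD ih (h n).
Qed.

Lemma hcontZ (c : R[i] -> R[i]) F z : ccont c z -> hcont F z ->
  hcont (fun z => c z *: F z) z.
Proof.
move=> cz Fz e e0.
pose K := cn (c z) + nrm (F z) + 1.
have K0 : 0 < K by rewrite ltr_wpDl ?addr_ge0 ?cn_ge0 ?nrm_ge0.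
have eK : 0 < Order.min 1 (e / K) by rewrite lt_min ltr01 divr_gt0.
have [d1 d10 h1] := cz _ eK; have [d2 d20 h2] := Fz _ eK.
exists (Order.min d1 d2) => [|h]; first by rewrite lt_min d10.
rewrite lt_min => /andP[/h1 + /h2]; rewrite !lt_min => /andP[k1 k2] /andP[k3 k4].
have -> : c (z + h) *: F (z + h) - c z *: F z
  = (c (z + h) - c z) *: (F (z + h) - F z) + ((c (z + h) - c z) *: F z + c z *: (F (z + h) - F z)).
  by rewrite addrA -scalerDr subrK scalerBl scalerBr addrA subrK.
apply: le_lt_trans (nrmD _ _) _; apply: le_lt_trans (lerD (lexx _) (nrmD _ _)) _.
rewrite !nrmZ -!/(cn _).
have -> : e = e / K * K by rewrite divfK // gt_eqF.
have a0 := cn_ge0 (c z); have b0 := nrm_ge0 (F z).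
have c0 := cn_ge0 (c (z + h) - c z); have d0 := nrm_ge0 (F (z + h) - F z).
move: (e / K) k2 k4 => q k2 k4; rewrite /K.
have k5 : cn (c (z + h) - c z) * nrm (F (z + h) - F z) < q.
  by apply: le_lt_trans k4; rewrite -[leRHS]mul1r ler_wpM2r // ltW.
have k6 : cn (c (z + h) - c z) * nrm (F z) <= q * nrm (F z) by rewrite ler_wpM2r // ltW.
have k7 : cn (c z) * nrm (F (z + h) - F z) <= q * cn (c z) by rewrite mulrC ler_wpM2r // ltW.
by rewrite !mulrDr mulr1; lra.
Qed.

Lemma hcont_nrm2 F z : hcont F z -> ccont (fun z => (nrm (F z) ^+ 2)%:C) z.
Proof.
move=> Fz e e0.
pose K := 2 * nrm (F z) + 1.
have K0 : 0 < K by rewrite ltr_wpDl ?mulr_ge0 ?nrm_ge0.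
have eK : 0 < Order.min 1 (e / K) by rewrite lt_min ltr01 divr_gt0.
have [d1 d10 h1] := Fz _ eK; exists d1 => // h /h1.
rewrite lt_min => /andP[k1 k2].
rewrite -rmorphB cnR.
have k3 := nrmB_ge (F (z + h)) (F z); have k4 := nrmB_ge (F z) (F (z + h)).
rewrite nrmBC in k4.
have -> : nrm (F (z + h)) ^+ 2 - nrm (F z) ^+ 2
  = (nrm (F (z + h)) - nrm (F z)) * (nrm (F (z + h)) - nrm (F z) + 2 * nrm (F z)) by ring.
have k5 : `|nrm (F (z + h)) - nrm (F z)| <= nrm (F (z + h) - F z).
  by rewrite ler_norml; apply/andP; split; lra.
rewrite normrM; move: (nrm (F (z + h) - F z)) k1 k2 k5 => p k1 k2 k5.
rewrite ltr_pdivlMr // in k2; apply: le_lt_trans k2; apply: ler_pM => //.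
apply: le_trans (ler_normD _ _) _; rewrite (ger0_norm (x := 2 * _)) ?mulr_ge0 ?nrm_ge0 //.
by rewrite /K; lra.
Qed.

Definition circ_energy (r : R) F := circ_int r (fun z => (nrm (F z) ^+ 2)%:C).

Definition psum (y : nat -> Y) N z := \sum_(0 <= k < N) z ^+ k *: y k.

Lemma psum_hcont (y : nat -> Y) N z : hcont (psum y N) z.
Proof.
apply: (@hcont_sum _ (fun k z => z ^+ k *: y k)) => k; apply: hcontZ.
  by apply: cdiff_ccont; exact: cdiffX.
exact: hcont_cst.
Qed.

(** On a circle about 0 the conjugate of z is |z|^2 / z, so such products become multiples of
    negative powers, the shape that [circ_int_powV] integrates. *)
Lemma conjX_circ (z : R[i]) k N : z != 0 -> (k <= N)%N ->
  z ^+ k * (conjc z) ^+ N = (cn z ^+ 2)%:C ^+ N * z ^- (N - k).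
Proof.
move=> z0 kN.
have -> : conjc z = (cn z ^+ 2)%:C * z^-1.
  by rewrite rmorphXn /= -cnE sqr_normc mulrAC divff ?mul1r.
rewrite exprMn mulrCA; congr (_ * _).
by rewrite -{1}(subnK kN) exprVn exprD; field; rewrite !expf_neq0.
Qed.

(** Induction on the degree: the cross terms with the top coefficient are, on the circle, multiples
    of [z ^- (N - k)] with [k < N], and integrate to zero. *)
Lemma psum_parseval (y : nat -> Y) N (r : R) : 0 < r ->
  circ_energy r (psum y N) = 2 * pi * \sum_(0 <= k < N) nrm (y k) ^+ 2 * r ^+ (2 * k).
Proof.
move=> r0; have r0' := ltW r0.
elim: N => [|N ih].
  rewrite big_geq // mulr0 /circ_energy; transitivity (circ_int r (fun=> 0)); last first.
    by rewrite circ_int_cst mulr0.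
  by apply: eq_circ_int => // z _; rewrite /psum big_geq // nrm0 expr0n.
pose T z := \sum_(0 <= k < N) ((2 * (r ^+ 2) ^+ N)%:C * ip (y k) (y N)) * z ^- (N - k).
have zn z : cn z = r -> z != 0 by rewrite -cn_gt0 => ->.
have Tc z : cn z = r -> ccont T z.
  move=> zr; apply: cdiff_ccont.
  apply: (@cdiff_sum _ _ (fun k z => ((2 * (r ^+ 2) ^+ N)%:C * ip (y k) (y N)) * z ^- (N - k))) => k.
  by apply: cdiff_powV; exact: zn.
have T0 : circ_int r T = 0.
  rewrite circ_int_sum //; last first.
    by move=> k z _ zr; apply: cdiff_ccont; apply: cdiff_powV; exact: zn.
  rewrite big_nat big1 // => k /andP[_ kN].
  by rewrite circ_int_powV // subn_eq0 leqNgt kN.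
pose c := nrm (y N) ^+ 2 * r ^+ (2 * N).
have E z : cn z = r -> Re (nrm (psum y N.+1 z) ^+ 2)%:C
    = Re ((nrm (psum y N z) ^+ 2)%:C + (T z + c%:C)).
  move=> zr; rewrite [LHS]/= !ReD [Re (_)%:C in RHS]/= [Re c%:C]/=.
  rewrite /psum big_nat_recr //= !nrm_sq ripDl !ripDr -!nrm_sq nrmZ -/(cn _) cnX zr.
  rewrite (ripC (z ^+ N *: _)).
  have -> : Re (T z) = 2 * rip (\sum_(0 <= k < N) z ^+ k *: y k) (z ^+ N *: y N).
    rewrite /rip linear_sumlz /= !Re_sum big_distrr /=.
    apply: eq_big_nat => k /andP[_ kN].
    rewrite ipZZ rmorphXn /=.
    rewrite -ReZ; congr Re; rewrite conjX_circ ?zn ?(ltnW kN) //.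
    by rewrite zr rmorphM /= rmorphXn /=; ring.
  by rewrite /c exprMn -!exprM (mulnC N); ring.
rewrite big_nat_recr //= mulrDr -ih -/c.
have -> : 2 * pi * c = circ_int r (fun=> c%:C) by rewrite circ_int_cst.
rewrite -[X in _ + X]add0r -T0 -!circ_intD //.
- exact: eq_circ_int_Re.
- by move=> z _; apply: hcont_nrm2; exact: psum_hcont.
- move=> z zr e e0; have [d d0 h] := Tc z zr e e0; exists d => // k /h.
  by rewrite opprD addrACA subrr addr0.
- by move=> z _; apply: cdiff_ccont; exact: cdiff_cst.
Qed.

End vector_valued.

(** * Energy identity for inner functions *)

Section energy.
Context {R : realType} {X U Y : hilbertType R}.
Variables (S : system X U Y) (theta : R[i] -> bop U Y).

Local Notation A := (sysA S).
Local Notation B := (sysB S).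
Local Notation C := (sysC S).
Local Notation D := (sysD S).

Fixpoint traj (u : nat -> U) (n : nat) : X :=
  if n is n'.+1 then A (traj u n') + B (u n') else 0.
Definition outp (u : nat -> U) (n : nat) : Y := C (traj u n) + D (u n).

Lemma psum_sub_le (u : nat -> U) L N z : (forall n, (L <= n)%N -> u n = 0) -> cn z <= 1 ->
  nrm (psum u L z - psum u N z) <= cn z ^+ N * \sum_(0 <= k < L) nrm (u k).
Proof.
move=> u0 z1; have [LN|/ltnW NL] := leqP L N.
  rewrite /psum [X in _ - X](big_cat_nat _ (n := L)) //= [X in _ - (_ + X)]big_nat.
  rewrite [X in _ - (_ + X)]big1 ?addr0 ?subrr ?nrm0; last first.
    by move=> k /andP[/u0 -> _]; rewrite scaler0.
  by rewrite mulr_ge0 ?exprn_ge0 ?cn_ge0 ?sumr_ge0 // => k _; rewrite nrm_ge0.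
rewrite /psum [X in X - _](big_cat_nat _ (n := N)) //= addrAC subrr add0r.
apply: (@le_trans _ _ (\sum_(N <= k < L) cn z ^+ N * nrm (u k))).
  elim: L {u0 NL} => [|L ih]; first by rewrite !big_geq // nrm0.
  have [NL|LN] := leqP N L; last by rewrite !big_geq // nrm0.
  rewrite !big_nat_recr //=; apply: le_trans (nrmD _ _) _; apply: lerD => //.
  rewrite nrmZ -/(cn _) cnX ler_wpM2r ?nrm_ge0 //.
  by rewrite ler_wiXn2l ?cn_ge0.
rewrite -big_distrr /= ler_wpM2l ?exprn_ge0 ?cn_ge0 //.
rewrite [leRHS](big_cat_nat _ (n := N)) //= lerDr sumr_ge0 // => k _.
exact: nrm_ge0.
Qed.

(** The generating function of the trajectory satisfies (I - zA) x(z) = z B u(z); the last term is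
    the price of truncation. *)
Lemma traj_psum (u : nat -> U) N z :
  psum (traj u) N.+1 z - z *: A (psum (traj u) N.+1 z)
  = z *: B (psum u N z) - z ^+ N.+1 *: A (traj u N).
Proof.
have [Al _] := bop_blin A; have [Bl _] := bop_blin B.
elim: N => [|N ih].
  by rewrite /psum big_nat1 big_geq //= !(scaler0, lin0 Al, lin0 Bl).
rewrite /psum big_nat_recr //= -/(psum _ _ _) [in RHS]big_nat_recr //= -/(psum _ _ _).
rewrite !(linD Al) !(linD Bl) !scalerDr opprD addrACA ih.
rewrite (linD Al) !(linZ Al) (linZ Bl) !scalerDr !scalerA -!exprS.
by rewrite !addrA subrK.
Qed.

Lemma transfer_state z v : tf_dom S z ->
  exists2 w, w - z *: A w = B v & transfer S z v = D v + z *: C w.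
Proof.
move=> [Q [_ hQ]].
pose T := [set y | (graph (fun x => x - z *: A x))^-1%relation (B v, y)].
have : T (papp (graph (fun x => x - z *: A x))^-1%relation (B v)).
  by apply: (@xgetI _ _ T (Q (B v))); rewrite /T /= /graph /= hQ.
rewrite /T /= /graph /= => h.
by exists (papp (graph (fun x => x - z *: A x))^-1%relation (B v)).
Qed.

Lemma near0_cn (P : R[i] -> Prop) : (\forall l \near (0 : R[i]^o), P l) ->
  exists2 rho : R, 0 < rho & forall z, cn z < rho -> P z.
Proof.
move=> /nbhs_ballP [e /= e0 h].
have er : e = (Re e)%:C by rewrite RRe_real // gtr0_real.
exists (Re e) => [|z ze]; first by rewrite -ltcR -er.
by apply: h; rewrite -ball_normE /= sub0r normrN cnE er ltcR.
Qed.

Hypothesis real : is_realization S theta.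

(** The exact state solves (I - zA) W = z B u(z), and the truncated trajectory solves it up to order
    N. Near 0 the operator I - zA is bounded below, so the states, and then the outputs, differ by
    order N. *)
Lemma realization_expansion (u : nat -> U) L : (forall n, (L <= n)%N -> u n = 0) ->
  forall N, exists c rho : R, [/\ 0 <= c, 0 < rho & forall z, cn z < rho ->
    nrm (theta z (psum u L z) - psum (outp u) N z) <= c * cn z ^+ N].
Proof.
move=> u0 N.
have [rho rho0 hrho] := near0_cn real.
have [Al [nA nA0 hA]] := bop_blin A; have [Bl [nB nB0 hB]] := bop_blin B.
have [Cl [nC nC0 hC]] := bop_blin C; have [Dl [nD nD0 hD]] := bop_blin D.
set SU := \sum_(0 <= k < L) nrm (u k).
have SU0 : 0 <= SU by rewrite sumr_ge0 // => k _; rewrite nrm_ge0.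
pose K := nB * SU + nrm (A (traj u N)).
have K0 : 0 <= K by rewrite addr_ge0 ?mulr_ge0 ?nrm_ge0.
exists (nD * SU + nC * (2 * K) + nrm (C (traj u N))).
(* The last radius gives [nrm (z *: A e) <= 2^-1 * nrm e], a term that can then be absorbed. *)
exists (Order.min rho (Order.min 1 (2 * (nA + 1))^-1)).
have nA1 : 0 < 2 * (nA + 1) by rewrite mulr_gt0 // ltr_wpDl.
split.
- by rewrite !addr_ge0 ?mulr_ge0 ?nrm_ge0.
- by rewrite !lt_min rho0 ltr01 invr_gt0.
move=> z; rewrite !lt_min => /andP[/hrho [zdom ztheta] /andP[/ltW z1 z2]].
have [w hw hw2] := transfer_state (psum u L z) zdom.
rewrite -ztheta hw2.
pose W := z *: w.
have hW : W - z *: A W = z *: B (psum u L z).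
  by rewrite /W (linZ Al) -scalerBr hw.
pose e := W - psum (traj u) N.+1 z.
have zN : 0 <= cn z ^+ N by rewrite exprn_ge0 ?cn_ge0.
have he : e - z *: A e = z *: B (psum u L z - psum u N z) + z ^+ N.+1 *: A (traj u N).
  have -> : e - z *: A e = (W - z *: A W)
      - (psum (traj u) N.+1 z - z *: A (psum (traj u) N.+1 z)).
    by rewrite /e (linB Al) scalerBr !opprD !opprK addrACA.
  by rewrite traj_psum hW (linB Bl) scalerBr opprB addrA addrAC.
have e1 : nrm (e - z *: A e) <= cn z ^+ N * K.
  rewrite he; apply: le_trans (nrmD _ _) _; rewrite !nrmZ -!/(cn _) cnX /K mulrDr.
  apply: lerD; last by rewrite ler_wpM2r ?nrm_ge0 // exprS ler_piMl.
  apply: (@le_trans _ _ (1 * (nB * (cn z ^+ N * SU)))); last first.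
    by rewrite mul1r mulrCA.
  apply: ler_pM; rewrite ?cn_ge0 ?nrm_ge0 //.
  apply: le_trans (hB _) _; rewrite ler_wpM2l //.
  exact: psum_sub_le.
have e2 : nrm e <= cn z ^+ N * (2 * K).
  have h1 : nrm e <= nrm (e - z *: A e) + nrm (z *: A e).
    by rewrite -{1}(subrK (z *: A e) e) nrmD.
  have h2 : nrm (z *: A e) <= 2^-1 * nrm e.
    rewrite nrmZ -/(cn _); apply: le_trans (ler_wpM2l (cn_ge0 _) (hA _)) _.
    rewrite mulrA ler_wpM2r ?nrm_ge0 //.
    rewrite -[(2 * _)^-1]mul1r ltr_pdivlMr // in z2.
    have := cn_ge0 z; nra.
  by rewrite mulrCA; lra.
have -> : D (psum u L z) + z *: C w - psum (outp u) N z
   = D (psum u L z - psum u N z) + (C e + z ^+ N *: C (traj u N)).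
  have -> : psum (outp u) N z = C (psum (traj u) N z) + D (psum u N z).
    rewrite /psum (lin_sum Cl) (lin_sum Dl) -big_split /=; apply: eq_bigr => k _.
    by rewrite (linZ Cl) (linZ Dl) -scalerDr.
  rewrite /e /psum [in RHS]big_nat_recr //= -/(psum _ _ _) -!/(psum _ _ _).
  rewrite (linB Cl) (linD Cl) (linB Dl) /W !(linZ Cl).
  set a := D _; set b := z *: _; set c := C (psum _ _ _); set d := D _.
  set f := _ *: C (traj _ _).
  have -> : b - (c + f) + f = b - c by rewrite opprD addrA subrK.
  by rewrite [c + d]addrC opprD addrACA.
apply: le_trans (nrmD _ _) _; apply: le_trans (lerD (lexx _) (nrmD _ _)) _.
rewrite nrmZ -/(cn _) cnX addrA mulrDl mulrDl; apply: lerD; last by rewrite mulrC.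
apply: lerD.
  apply: le_trans (hD _) _; rewrite -mulrA ler_wpM2l //.
  by rewrite mulrC psum_sub_le.
by apply: le_trans (hC _) _; rewrite -mulrA ler_wpM2l // mulrC.
Qed.

Hypothesis schur : schur_class theta.

Lemma theta_hcont v z : cn z < 1 -> hcont (fun z => theta z v) z.
Proof.
move=> z1 e e0; have [[T hT] _] : (exists T : bop U Y, forall e : R[i], 0 < e ->
    \forall h \near (0 : R[i]^o), forall u,
      `|theta (z + h) u - theta z u - h *: T u| <= e * `|h| * `|u|) /\ True.
  by split => //; apply: schur.1; rewrite cnE ltcR.
have [rho rho0 h] := near0_cn (hT 1 ltr01).
pose K := nrm v + nrm (T v) + 1.
have K0 : 0 < K by rewrite ltr_wpDl // addr_ge0 ?nrm_ge0.
exists (Order.min rho (e / K)) => [|k]; first by rewrite lt_min rho0 divr_gt0.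
rewrite lt_min => /andP[/h /(_ v)]; rewrite !normE cnE mul1r -rmorphM lecR => h1.
rewrite ltr_pdivlMr // => h2; apply: le_lt_trans h2.
rewrite -[theta (z + k) v - _](subrK (k *: T v)).
apply: le_trans (nrmD _ _) _; rewrite nrmZ -/(cn _).
by have := cn_ge0 k; rewrite /K; nra.
Qed.

Lemma theta_cdiff v y z : cn z < 1 -> cdiff (fun z => ip (theta z v) y) z.
Proof.
move=> z1; have [T hT] : (exists T : bop U Y, forall e : R[i], 0 < e ->
    \forall h \near (0 : R[i]^o), forall u,
      `|theta (z + h) u - theta z u - h *: T u| <= e * `|h| * `|u|).
  by apply: schur.1; rewrite cnE ltcR.
exists (ip (T v) y) => e e0.
pose K := nrm v * nrm y + 1.
have K0 : 0 < K by rewrite ltr_wpDl // mulr_ge0 ?nrm_ge0.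
have eK : 0 < e / K by rewrite divr_gt0.
have [|rho rho0 h] := near0_cn (hT (e / K)%:C _); first by rewrite ltcR.
exists rho => // k /h /(_ v); rewrite !normE cnE -!rmorphM lecR => h1.
have -> : ip (theta (z + k) v) y - ip (theta z v) y - k * ip (T v) y
   = ip (theta (z + k) v - theta z v - k *: T v) y.
  by rewrite -ipZl !linearBl.
apply: le_trans (ip_cn_le _ _) _; apply: le_trans (ler_wpM2r (nrm_ge0 y) h1) _.
have -> : e * cn k = e / K * cn k * K by field; rewrite gt_eqF.
rewrite -(mulrA _ (nrm v)); apply: ler_wpM2l; last by rewrite /K lerDl.
by rewrite mulr_ge0 ?cn_ge0 // ltW.
Qed.

Lemma theta_le z v : cn z < 1 -> nrm (theta z v) <= nrm v.
Proof. by move=> z1; rewrite -lecR -!normE schur.2 // cnE ltcR. Qed.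

Lemma psum_le (u : nat -> U) L z : cn z <= 1 ->
  nrm (psum u L z) <= \sum_(0 <= k < L) nrm (u k).
Proof.
move=> z1; elim: L => [|L ih]; first by rewrite /psum !big_geq // nrm0.
rewrite /psum !big_nat_recr //=; apply: le_trans (nrmD _ _) _; apply: lerD => //.
by rewrite nrmZ -/(cn _) cnX ler_piMl ?nrm_ge0 // exprn_ile1 ?cn_ge0.
Qed.

Lemma cn_ipxx (Z : hilbertType R) (e : Z) : cn (ip e e) = nrm e ^+ 2.
Proof.
rewrite ipE; have -> : rip ('i *: e) e = 0.
  by have := rip_iC e e; rewrite [rip e _]ripC => h; lra.
by rewrite oppr0 cnR -nrm_sq ger0_norm ?sqr_ge0.
Qed.

Section fixed_input.
Variables (u : nat -> U) (L : nat).
Hypothesis u0 : forall n, (L <= n)%N -> u n = 0.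
Let F z := theta z (psum u L z).
Let SU := \sum_(0 <= k < L) nrm (u k).

Let SU0 : 0 <= SU.
Proof. by rewrite sumr_ge0 // => k _; rewrite nrm_ge0. Qed.

Let FE z : F z = \sum_(0 <= k < L) z ^+ k *: theta z (u k).
Proof.
have [tl _] := bop_blin (theta z); rewrite /F /psum (lin_sum tl).
by apply: eq_bigr => k _; rewrite (linZ tl).
Qed.

Let F_le z : cn z < 1 -> nrm (F z) <= SU.
Proof.
by move=> z1; apply: le_trans (theta_le _ z1) _; apply: psum_le; exact: ltW.
Qed.

Let F_hcont z : cn z < 1 -> hcont F z.
Proof.
move=> z1; have -> : F = fun z => \sum_(0 <= k < L) z ^+ k *: theta z (u k).
  by apply/funext => x; exact: FE.
apply: (@hcont_sum _ _ _ (fun k z => z ^+ k *: theta z (u k))) => k; apply: hcontZ.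
  by apply: cdiff_ccont; exact: cdiffX.
exact: theta_hcont.
Qed.

Let Fy_diff y z : cn z < 1 -> cdiff (fun z => ip (F z) y) z.
Proof.
move=> z1; have -> : (fun z => ip (F z) y)
    = fun z => \sum_(0 <= k < L) z ^+ k * ip (theta z (u k)) y.
  apply/funext => x; rewrite FE linear_sumlz /=; apply: eq_bigr => k _.
  by rewrite ipZl.
apply: (@cdiff_sum _ _ (fun k z => z ^+ k * ip (theta z (u k)) y)) => k.
by apply: cdiffM; [exact: cdiffX|exact: theta_cdiff].
Qed.

Let Fy_le y z : cn z < 1 -> cn (ip (F z) y) <= SU * nrm y.
Proof.
move=> z1; apply: le_trans (ip_cn_le _ _) _.
by rewrite ler_wpM2r ?nrm_ge0 // F_le.
Qed.

Let ip_psum (y : nat -> Y) N z v :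
  ip (psum y N z) v = \sum_(0 <= k < N) ip (y k) v * z ^+ k.
Proof.
by rewrite /psum linear_sumlz /=; apply: eq_bigr => k _; rewrite ipZl mulrC.
Qed.

Let Fy_exp y N : exists c rho : R, [/\ 0 <= c, 0 < rho & forall z, cn z < rho ->
  cn (ip (F z) y - \sum_(0 <= k < N) ip (outp u k) y * z ^+ k) <= c * cn z ^+ N].
Proof.
have [c [rho [c0 rho0 h]]] := realization_expansion u0 N.
exists (c * nrm y), rho; split => //; first by rewrite mulr_ge0 ?nrm_ge0.
move=> z /h hz; rewrite -ip_psum -linearBl mulrAC.
by apply: le_trans (ip_cn_le _ _) _; rewrite ler_wpM2r ?nrm_ge0.
Qed.

(** Cauchy's estimate for the scalar function [ip (F z) (outp u k)], whose k-th coefficient is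
    [nrm (outp u k) ^+ 2]. *)
Lemma outp_le k : nrm (outp u k) <= SU.
Proof.
have := taylor_coef_le (Fy_diff (outp u k)) (Fy_le (outp u k)) (Fy_exp (outp u k)) k.
rewrite cn_ipxx expr2.
have [->|k0] := eqVneq (nrm (outp u k)) 0; first by [].
by rewrite ler_pM2r // lt_neqAle eq_sym k0 nrm_ge0.
Qed.

(** The scalar Taylor theorem has a constant depending on the functional. Pairing the remainder [e]
    with itself removes it: the part beyond order N + n tends to 0 with [n], and what is left is a
    geometric tail controlled by [outp_le]. *)
Lemma outp_psum_cvg z N : cn z < 1 ->
  nrm (F z - psum (outp u) N z) <= SU / (1 - cn z) * cn z ^+ N.
Proof.
move=> z1; set r := cn z; have r0 : 0 <= r := cn_ge0 z.
have r1 : 0 < 1 - r by rewrite subr_gt0.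
set e := F z - _.
have tail n : nrm (psum (outp u) (N + n) z - psum (outp u) N z)
    <= SU / (1 - r) * (r ^+ N - r ^+ (N + n)).
  elim: n => [|n ih]; first by rewrite addn0 !subrr nrm0 mulr0.
  rewrite addnS {1}/psum big_nat_recr //= -/(psum _ _ _) addrAC.
  apply: le_trans (nrmD _ _) _; apply: le_trans (lerD ih (lexx _)) _.
  rewrite nrmZ -/(cn _) cnX -/r.
  have -> : SU / (1 - r) * (r ^+ N - r ^+ (N + n).+1)
     = SU / (1 - r) * (r ^+ N - r ^+ (N + n)) + r ^+ (N + n) * SU.
    by rewrite exprS; field; rewrite gt_eqF.
  by rewrite lerD2l ler_wpM2l ?exprn_ge0 // outp_le.
have [c [q [q01 hq]]] := taylor_disc (Fy_diff e) (Fy_le e) (Fy_exp e) z1.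
have key n : cn (ip e e) - SU / (1 - r) * r ^+ N * nrm e <= c * q ^+ N * q ^+ n.
  have hn := hq (N + n)%N; rewrite -ip_psum -linearBl /= in hn.
  have t := tail n.+1; rewrite addnS in t.
  have eE : e = (F z - psum (outp u) (N + n).+1 z)
     + (psum (outp u) (N + n).+1 z - psum (outp u) N z) by rewrite addrA subrK.
  rewrite lerBlDr {1}eE linearDl -mulrA -exprD.
  apply: le_trans (cnD _ _) _; apply: lerD; first exact: hn.
  apply: le_trans (ip_cn_le _ _) _; rewrite ler_wpM2r ?nrm_ge0 //.
  apply: le_trans t _; rewrite ler_wpM2l ?divr_ge0 ?(ltW r1) //.
  by rewrite gerBl exprn_ge0.
have := ler_geo_lim q01 key; rewrite subr_le0 cn_ipxx expr2.
have [-> _|k0] := eqVneq (nrm e) 0; last by rewrite ler_pM2r // lt_neqAle eq_sym k0 nrm_ge0.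
by rewrite mulr_ge0 ?exprn_ge0 // divr_ge0 // ltW.
Qed.

Lemma circ_energy_outp (r : R) : 0 < r < 1 ->
  circ_energy r (psum (outp u) N) @[N --> \oo] --> circ_energy r F.
Proof.
move=> /andP[r0 r1]; have r0' := ltW r0.
have cr t : cn (circ r t) = r by rewrite cn_circ.
have K0 : 0 <= SU / (1 - r) by rewrite divr_ge0 // subr_ge0 ltW.
apply: (@itg_dominated _ _ _ _ _ ((SU + SU / (1 - r)) ^+ 2)).
- move=> N; apply: (@Re_circ_cont _ r (fun z => (nrm (psum (outp u) N z) ^+ 2)%:C)) => // z _.
  by apply: hcont_nrm2; exact: psum_hcont.
- apply: (@Re_circ_cont _ r (fun z => (nrm (F z) ^+ 2)%:C)) => // z zr.
  by apply: hcont_nrm2; apply: F_hcont; rewrite zr.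
- apply: aeW => t _ /=.
  have l : nrm (psum (outp u) N (circ r t) - F (circ r t)) @[N --> \oo] --> (0 : R).
    have l0 : SU / (1 - r) * r ^+ N @[N --> \oo] --> (SU / (1 - r) * 0 : R).
      by apply: cvgM; [exact: cvg_cst|apply: cvg_expr; rewrite ger0_norm].
    rewrite mulr0 in l0; apply: squeeze_cvgr (cvg_cst 0) l0; apply: nearW => N.
    rewrite nrm_ge0 /= nrmBC.
    have := @outp_psum_cvg (circ r t) N; rewrite cr; exact.
  by under eq_cvg do rewrite expr2; rewrite expr2; apply: cvgM; exact: nrm_cvg.
- move=> N t _ /=; rewrite ger0_norm ?sqr_ge0 // ler_pXn2r ?nnegrE ?nrm_ge0 ?addr_ge0 //.
  have := @outp_psum_cvg (circ r t) N; rewrite cr => /(_ r1) h1.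
  have h2 : nrm (F (circ r t)) <= SU by apply: F_le; rewrite cr.
  have h3 := nrmB_ge (psum (outp u) N (circ r t)) (F (circ r t)).
  rewrite nrmBC in h3.
  have h4 : SU / (1 - r) * r ^+ N <= SU / (1 - r).
    by rewrite ler_piMr // exprn_ile1 // ltW.
  by lra.
Qed.

Hypothesis bdry : {ae (@lebesgue_measure R), forall t : R, 0 <= t <= 2 * pi ->
    exists2 T : bop U Y, boundary_value theta t T & forall u, adjoint T (T u) = u}.

Lemma circ_energy_boundary :
  circ_energy (radius n) F @[n --> \oo] --> circ_energy 1 (psum u L).
Proof.
pose r n : R := radius n.
have rn n : 0 < r n < 1 := radius01 R n.
have rlim : r n @[n --> \oo] --> (1 : R) := @cvg_radius R.
have rn0 n : 0 <= r n by have /andP[/ltW] := rn n.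
have rn1 n : r n < 1 by have /andP[] := rn n.
have rleft : r n @[n --> \oo] --> (1 : R)^'-.
  move=> P /= /nbhs_ballP [e /= e0 he].
  move/cvgrPdist_lt/(_ e e0) : rlim; apply: filterS => n h.
  by apply: he => //=; exact: rn1.
apply: (@itg_dominated _ (fun n t => Re ((nrm (F (circ (r n) t)) ^+ 2)%:C)) _ _ _ (SU ^+ 2)).
- move=> n; apply: (@Re_circ_cont _ (r n) (fun z => (nrm (F z) ^+ 2)%:C)) => // z zr.
  by apply: hcont_nrm2; apply: F_hcont; rewrite zr.
- apply: (@Re_circ_cont _ 1 (fun z => (nrm (psum u L z) ^+ 2)%:C)) => // z zr.
  by apply: hcont_nrm2; exact: psum_hcont.
- apply: filterS bdry; first exact: (ae_filter_ringOfSetsType lebesgue_measure).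
  move=> t ht tpi; have [T hT TT] := ht tpi; rewrite /=.
  set v := psum u L (circ 1 t).
  (* Here the isometry of the boundary value enters. *)
  have -> : nrm v = nrm (T v).
    apply/eqP; rewrite -(eqrXn2 (n := 2)) ?nrm_ge0 // !nrm_sq.
    by rewrite (adjoint_rip _ _ (bop_blin T)) TT.
  have l1 : nrm (theta (circ (r n) t) v - T v) @[n --> \oo] --> (0 : R).
    apply/cvgr0Pnorm_lt => e e0.
    have l2 : theta (circ (r n) t) v @[n --> \oo] --> T v.
      exact: (cvg_comp r (fun s => theta (circ s t) v) rleft (hT v)).
    move/cvgrPdist_lt/(_ e%:C) : l2; rewrite ltcR => /(_ e0); apply: filterS => n.
    by rewrite normE ltcR nrmBC ger0_norm ?nrm_ge0.
  have l2 : nrm (psum u L (circ (r n) t) - v) @[n --> \oo] --> (0 : R).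
    apply/cvgr0Pnorm_lt => e e0.
    have [dl dl0 hd] := @psum_hcont _ _ u L (circ 1 t) e e0.
    move/cvgrPdist_lt/(_ _ dl0) : rlim; apply: filterS => n sn.
    rewrite ger0_norm ?nrm_ge0 //.
    have -> : circ (r n) t = circ 1 t + (r n - 1)%:C * circ 1 t.
      by rewrite -circM mulr1 /circ; congr (_ +i* _); ring.
    by apply: hd; rewrite cnM cnR cn_circ // mulr1 distrC.
  (* Operator and vector both move with the radius: contractivity of [theta] replaces the vector by
     [v], and the radial limit at the fixed [v] does the rest. *)
  have l3 : nrm (F (circ (r n) t) - T v) @[n --> \oo] --> (0 : R).
    have l4 : nrm (psum u L (circ (r n) t) - v) + nrm (theta (circ (r n) t) v - T v)
        @[n --> \oo] --> (0 + 0 : R) by apply: cvgD.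
    rewrite addr0 in l4; apply: squeeze_cvgr (cvg_cst 0) l4; apply: nearW => n.
    rewrite nrm_ge0 /=; apply: le_trans (nrmB_tri (theta (circ (r n) t) v) _ _) _.
    rewrite lerD2r; have [tl _] := bop_blin (theta (circ (r n) t)).
    by rewrite /F -(linB tl) theta_le // cn_circ.
  by under eq_cvg do rewrite expr2; rewrite expr2; apply: cvgM; exact: nrm_cvg.
- move=> n t _ /=; rewrite ger0_norm ?sqr_ge0 // ler_pXn2r ?nnegrE ?nrm_ge0 //.
  by apply: F_le; rewrite cn_circ.
Qed.

(** An Abel summation: at a fixed radius the weighted sums tend to the mean energy of [F], and these
    means tend to [E]. As all terms are nonnegative, the limits are compared by one inequality in
    each direction. *)
Theorem energy_identity :
  \sum_(0 <= k < N) nrm (outp u k) ^+ 2 @[N --> \oo] --> \sum_(0 <= k < L) nrm (u k) ^+ 2.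
Proof.
set E := \sum_(0 <= k < L) _.
pose r n : R := radius n.
have rn n : 0 < r n < 1 := radius01 R n.
have rlim : r n @[n --> \oo] --> (1 : R) := @cvg_radius R.
have pi2 : 0 < 2 * pi :> R by rewrite mulr_gt0 // pi_gt0.
pose a k := nrm (outp u k) ^+ 2.
have a0 k : 0 <= a k by exact: sqr_ge0.
pose s N := \sum_(0 <= k < N) a k.
pose G n := circ_energy (r n) F / (2 * pi).
have Glim : G n @[n --> \oo] --> E.
  have -> : E = circ_energy 1 (psum u L) / (2 * pi).
    rewrite psum_parseval // mulrAC mulfV ?gt_eqF // mul1r.
    by apply: eq_bigr => k _; rewrite expr1n mulr1.
  by apply: cvgM; [exact: circ_energy_boundary|exact: cvg_cst].
pose sr n N := \sum_(0 <= k < N) a k * r n ^+ (2 * k).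
have srlim n : sr n N @[N --> \oo] --> G n.
  have /andP[r0 _] := rn n.
  have -> : sr n = fun N => circ_energy (r n) (psum (outp u) N) / (2 * pi).
    by apply/funext => N; rewrite psum_parseval // mulrAC mulfV ?gt_eqF // mul1r.
  by apply: cvgM; [exact: circ_energy_outp|exact: cvg_cst].
have sr_mono n : nondecreasing_seq (sr n).
  apply/nondecreasing_seqP => N; rewrite /sr big_nat_recr //= lerDl mulr_ge0 //.
  by rewrite exprn_ge0 // ltW //; case/andP: (rn n).
have sr_le n N : sr n N <= G n by exact: nondecreasing_cvgn_to_le (sr_mono n) (srlim n) N.
have s_le N : s N <= E.
  have l : sr n N @[n --> \oo] --> s N.
    have -> : s N = \sum_(0 <= k < N) a k * 1 ^+ (2 * k).
      by apply: eq_bigr => k _; rewrite expr1n mulr1.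
    rewrite /sr; elim: N => [|N ih].
      by rewrite big_geq //; under eq_cvg do rewrite big_geq //; exact: cvg_cst.
    rewrite big_nat_recr //=; under eq_cvg do rewrite big_nat_recr //=.
    apply: cvgD => //; apply: cvgM; first exact: cvg_cst.
    by apply: (@cvg_comp _ _ _ r (fun x : R => x ^+ (2 * N))); [exact: rlim|exact: exprn_continuous].
  by apply: (ler_cvg_to l Glim); apply: nearW => n; exact: sr_le.
have s_mono : nondecreasing_seq s.
  by apply/nondecreasing_seqP => N; rewrite /s big_nat_recr //= lerDl.
have s_cvg : cvgn s.
  by apply: nondecreasing_is_cvgn => //; exists E => _ [N _ <-].
suff -> : E = limn s by [].
apply/eqP; rewrite eq_le; apply/andP; split; last first.
  by apply: limr_le => //; exact: nearW.
apply: cvgr_to_le Glim _; apply: nearW => n; apply: cvgr_to_le (srlim n) _.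
apply: nearW => N; apply: le_trans (nondecreasing_cvgn_le s_mono s_cvg N).
apply: ler_sum => k _; rewrite ler_piMr // exprn_ile1 //; have /andP[/ltW ? /ltW ?] := rn n => //.
Qed.

End fixed_input.
End energy.

(** * Square roots *)

Section bounded_square_root.
Context {R : realType} {X : hilbertType R}.
Implicit Types (T V : X -> X).

Definition rsym T := forall x y, rip (T x) y = rip x (T y).

Section iteration.
Variable T : X -> X.
Hypothesis Tb : blin T.
Hypothesis Ts : rsym T.
Hypothesis T1 : forall x, nrm (T x) <= nrm x.

(** Iteration for W = (T + W^2) / 2, that is (1 - W)^2 = 1 - T: the limit is 1 minus a square root
    of 1 - T. [sqrt_bound] is the same iteration for the scalar T = 1 and serves as a majorant. *)
Fixpoint sqrt_iter n (x : X) : X :=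
  if n is n'.+1 then (2^-1)%:C *: (T x + sqrt_iter n' (sqrt_iter n' x)) else 0.
Fixpoint sqrt_bound n : R := if n is n'.+1 then 2^-1 * (1 + sqrt_bound n' ^+ 2) else 0.

Local Notation W := sqrt_iter.
Local Notation w := sqrt_bound.

Lemma sqrt_iterS n x : W n.+1 x = (2^-1)%:C *: (T x + W n (W n x)).
Proof. by []. Qed.

Lemma sqrt_iter_lin n a x y : W n (a *: x + y) = a *: W n x + W n y.
Proof.
elim: n x y => [|n ih] x y /=; first by rewrite scaler0 addr0.
have [Tl _] := Tb.
by rewrite Tl !ih addrACA -scalerDr [LHS]scalerDr !scalerA (mulrC a).
Qed.

Lemma sqrt_bound01 n : 0 <= w n <= 1.
Proof.
elim: n => [|n /andP[h1 h2]] /=; first by rewrite lexx ler01.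
by apply/andP; split; nra.
Qed.

Lemma sqrt_iter_le n x : nrm (W n x) <= w n * nrm x.
Proof.
elim: n x => [|n ih] x /=; first by rewrite nrm0 mul0r.
have /andP[w0 w1] := sqrt_bound01 n.
rewrite nrmZr ger0_norm ?invr_ge0 // -mulrA ler_wpM2l ?invr_ge0 //.
apply: le_trans (nrmD _ _) _; rewrite mulrDl mul1r; apply: lerD => //.
by apply: le_trans (ih _) _; rewrite expr2 -mulrA ler_wpM2l.
Qed.

(** Comparison with the bounded increasing scalar sequence makes contractivity of [T] enough for
    convergence, without an order between operators. *)
Lemma sqrt_iter_step n x : nrm (W n.+1 x - W n x) <= (w n.+1 - w n) * nrm x.
Proof.
elim: n x => [|n ih] x.
  rewrite /= subr0 addr0 subr0 expr0n addr0 mulr1 nrmZr ger0_norm ?invr_ge0 //.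
  by rewrite ler_wpM2l ?invr_ge0.
(* The difference of squares is split as W'(W' - W) + (W' - W)W, which needs no commutation. *)
have -> : W n.+2 x - W n.+1 x
   = (2^-1)%:C *: (W n.+1 (W n.+1 x - W n x) + (W n.+1 (W n x) - W n (W n x))).
  rewrite (linB (sqrt_iter_lin n.+1)) addrA subrK.
  rewrite (sqrt_iterS n.+1) [X in _ - X = _]sqrt_iterS.
  by rewrite -scalerBr opprD addrACA subrr add0r.
rewrite nrmZr ger0_norm ?invr_ge0 //.
have /andP[w0 w1] := sqrt_bound01 n; have /andP[w2 w3] := sqrt_bound01 n.+1.
have h1 : nrm (W n.+1 (W n.+1 x - W n x)) <= w n.+1 * ((w n.+1 - w n) * nrm x).
  by apply: le_trans (sqrt_iter_le _ _) _; rewrite ler_wpM2l.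
have wn : 0 <= w n.+1 - w n by rewrite /=; nra.
have h2 : nrm (W n.+1 (W n x) - W n (W n x)) <= (w n.+1 - w n) * (w n * nrm x).
  by apply: le_trans (ih _) _; rewrite ler_wpM2l // sqrt_iter_le.
have -> : (w n.+2 - w n.+1) * nrm x
    = 2^-1 * (w n.+1 * ((w n.+1 - w n) * nrm x) + (w n.+1 - w n) * (w n * nrm x)).
  rewrite -[w n.+2]/(2^-1 * (1 + w n.+1 ^+ 2)) -[X in _ - X]/(2^-1 * (1 + w n ^+ 2)).
  by ring.
by rewrite ler_wpM2l ?invr_ge0 // (le_trans (nrmD _ _)) // lerD.
Qed.

Lemma sqrt_bound_mono : nondecreasing_seq w.
Proof.
apply/nondecreasing_seqP => n; have /andP[w0 w1] := sqrt_bound01 n.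
by rewrite /=; nra.
Qed.

Lemma sqrt_iter_dist n m x : (n <= m)%N -> nrm (W m x - W n x) <= (w m - w n) * nrm x.
Proof.
move=> /subnK <-; elim: (m - n)%N => [|k ih]; first by rewrite add0n !subrr nrm0 mul0r.
apply: le_trans (nrmB_tri (W (k + n) x) _ _) _; rewrite addSn.
apply: le_trans (lerD (sqrt_iter_step _ _) ih) _.
by rewrite -mulrDl addrA subrK.
Qed.

Lemma sqrt_iter_cvg x : exists y, nrm (W n x - y) @[n --> \oo] --> (0 : R).
Proof.
apply: hilbert_complete => e e0.
have wc : cvgn w.
  apply: nondecreasing_is_cvgn; first exact: sqrt_bound_mono.
  by exists 1 => _ [n _ <-]; have /andP[] := sqrt_bound01 n.
have e1 : 0 < e / (nrm x + 1) by rewrite divr_gt0 // ltr_wpDl ?nrm_ge0.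
have /cvgrPdist_lt/(_ _ e1) [N _ hN] := wc.
exists N.
have key n m : (N <= n)%N -> (n <= m)%N -> nrm (W m x - W n x) < e.
  move=> Nn nm; apply: le_lt_trans (sqrt_iter_dist _ nm) _.
  have h1 : w m - w n < e / (nrm x + 1).
    have h2 := nondecreasing_cvgn_le sqrt_bound_mono wc m.
    have := hN n Nn => /=; rewrite ger0_norm; first by move=> h; lra.
    by rewrite subr_ge0; exact: (nondecreasing_cvgn_le sqrt_bound_mono wc n).
  rewrite ltr_pdivlMr in h1; last by rewrite ltr_wpDl ?nrm_ge0.
  by apply: le_lt_trans h1; rewrite mulrDr mulr1 lerDl subr_ge0; exact: sqrt_bound_mono.
move=> m n Nm Nn; have [nm|/ltnW mn] := leqP n m; first exact: key.
by rewrite nrmBC; exact: key.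
Qed.

Lemma sqrt_iter_sym n x y : rip (W n x) y = rip x (W n y).
Proof.
elim: n x y => [|n ih] x y /=; first by rewrite rip0l rip0r.
by rewrite ripZl ripZr ripDl ripDr Ts !ih.
Qed.

Lemma sqrt_iter_comm V n x : blin V -> (forall x, V (T x) = T (V x)) ->
  V (W n x) = W n (V x).
Proof.
move=> [Vl _] VT; elim: n x => [|n ih] x /=; first exact: lin0 Vl.
by rewrite (linZ Vl) (linD Vl) VT !ih.
Qed.

Lemma sqrt_limit : exists Wl : X -> X,
  [/\ forall a x y, Wl (a *: x + y) = a *: Wl x + Wl y,
      forall x, nrm (Wl x) <= nrm x, rsym Wl,
      forall x, Wl (Wl x) = Wl x + Wl x - T x &
      forall V, blin V -> (forall x, V (T x) = T (V x)) -> forall x, V (Wl x) = Wl (V x)].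
Proof.
have [Wl hW] := choice sqrt_iter_cvg; exists Wl.
have Wl1 x : nrm (Wl x) <= nrm x.
  apply: cvgr_to_le (nrm_cvg (hW x)) _; apply: nearW => n; apply: le_trans (sqrt_iter_le n x) _.
  by rewrite ler_piMl ?nrm_ge0 //; have /andP[] := sqrt_bound01 n.
split => //.
- move=> a x y; apply: nrm_cvg_uniq (hW _) _.
  under eq_cvg do rewrite sqrt_iter_lin.
  by apply: nrmD_cvg => //; exact: nrmZ_cvg.
- move=> x y.
  have h1 : rip (W n x) y @[n --> \oo] --> rip (Wl x) y by exact: rip_cvgl.
  have h2 : rip (W n x) y @[n --> \oo] --> rip x (Wl y).
    under eq_cvg do rewrite sqrt_iter_sym ripC.
    by rewrite ripC; exact: rip_cvgl.
  exact: cvgn_uniq h1 h2.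
- move=> x.
  have h1 : nrm (W n (W n x) - Wl (Wl x)) @[n --> \oo] --> (0 : R).
    have l : nrm (W n x - Wl x) + nrm (W n (Wl x) - Wl (Wl x)) @[n --> \oo] --> (0 + 0 : R).
      by apply: cvgD.
    rewrite addr0 in l; apply: squeeze_cvgr (cvg_cst 0) l; apply: nearW => n.
    rewrite nrm_ge0 /=; apply: le_trans (nrmB_tri (W n (Wl x)) _ _) _.
    rewrite lerD2r -(linB (sqrt_iter_lin n)); apply: le_trans (sqrt_iter_le _ _) _.
    by rewrite ler_piMl ?nrm_ge0 //; have /andP[] := sqrt_bound01 n.
  have h2 : nrm (W n.+1 x - (2^-1)%:C *: (T x + Wl (Wl x))) @[n --> \oo] --> (0 : R).
    apply: nrmZ_cvg; apply: nrmD_cvg => //.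
    by under eq_cvg do rewrite subrr nrm0; exact: cvg_cst.
  have h3 : nrm (W n.+1 x - Wl x) @[n --> \oo] --> (0 : R).
    by rewrite (cvg_shiftS (fun n => nrm (W n x - Wl x))).
  have E := nrm_cvg_uniq h3 h2.
  have E2 : Wl x + Wl x = T x + Wl (Wl x).
    rewrite {1 2}E -scalerDl -rmorphD.
    have -> : 2^-1 + 2^-1 = 1 :> R by field.
    by rewrite scale1r.
  by rewrite E2 addrAC subrr add0r.
- move=> V Vb VT x; apply: nrm_cvg_uniq (blin_cvg Vb (hW x)) _.
  by under eq_cvg do rewrite (sqrt_iter_comm _ x Vb VT); exact: hW.
Qed.

End iteration.

(** The iteration is run with T = 1 - K. The root satisfies the same hypotheses as [K], so that a
    root can be taken again. *)
Lemma bounded_sqrt (K : X -> X) : blin K -> rsym K ->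
  (forall x, nrm (x - K x) <= nrm x) ->
  exists P : X -> X, [/\ blin P, rsym P, forall x, nrm (x - P x) <= nrm x,
    forall x, P (P x) = K x &
    forall V, blin V -> (forall x, V (K x) = K (V x)) -> forall x, V (P x) = P (V x)].
Proof.
move=> Kb Ks K1; have [Kl _] := Kb.
have Tb : blin (fun x => x - K x).
  split; last by exists 1 => // x; rewrite mul1r.
  by move=> a x y; rewrite Kl opprD addrACA -scalerBr.
have Ts : rsym (fun x => x - K x) by move=> x y; rewrite ripBl ripBr Ks.
have [Wl [Wlin W1 Ws WW Wc]] := sqrt_limit Tb Ts K1.
exists (fun x => x - Wl x).
have Plin a x y : a *: x + y - Wl (a *: x + y) = a *: (x - Wl x) + (y - Wl y).
  by rewrite Wlin opprD addrACA -scalerBr.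
split => //.
- split => //; exists 2 => // x; apply: le_trans (nrmD _ _) _.
  by rewrite nrmN mulrDl mul1r lerD.
- by move=> x y; rewrite ripBl ripBr Ws.
- by move=> x; rewrite opprB addrC subrK.
- move=> x; rewrite (linB Wlin) WW.
  set a := Wl x; set b := K x.
  have -> : a - (a + a - (x - b)) = x - b - a.
    by rewrite -addrA opprD addrA subrr add0r opprB.
  by rewrite opprB addrA subrK opprB addrC subrK.
- move=> V Vb VK x; have [Vl _] := Vb.
  rewrite (linB Vl) Wc // => y; by rewrite (linB Vl) VK.
Qed.

(** The order of [R[i]] also demands a zero imaginary part, which symmetry provides. *)
Lemma rsym_ip (M : X -> X) x : blin M -> rsym M -> 0 <= rip (M x) x -> 0 <= ip (M x) x.
Proof.
move=> [Ml _] Ms h; rewrite ipE lecE /= h andbT oppr_eq0; apply/eqP.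
have E : rip ('i *: M x) x = - rip ('i *: M x) x.
  by rewrite {1}rip_iC Ms (linZ Ml) ripC.
lra.
Qed.

End bounded_square_root.

(** * Selfadjoint operators given by pairs of bounded ones *)

Section unbounded.
Context {R : realType}.

Lemma padjoint_rip (X Y : hilbertType R) (T : pop X Y) (x : Y) (y : X) :
  (forall a v w, T (v, w) -> T (a *: v, a *: w)) ->
  padjoint T (x, y) <-> forall v w, T (v, w) -> rip w x = rip v y.
Proof.
move=> Tz; split=> h v w Tvw; first by have /= := h v w Tvw; rewrite /rip => ->.
by apply: rip_ip; [exact: h|apply: h; exact: Tz].
Qed.

Lemma is_operatorZ (X Y : hilbertType R) (T : pop X Y) : is_operator T ->
  forall a v w, T (v, w) -> T (a *: v, a *: w).
Proof. by move=> [T0 TD _] a v w Tvw; have := TD a _ _ _ _ Tvw T0; rewrite !addr0. Qed.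

Definition linear_relation (X Y : hilbertType R) (T : pop X Y) :=
  T (0, 0) /\ forall a x y x' y', T (x, y) -> T (x', y') -> T (a *: x + x', a *: y + y').

Lemma operator_linear (X Y : hilbertType R) (T : pop X Y) : is_operator T -> linear_relation T.
Proof. by case. Qed.

Lemma linear_relationV (X Y : hilbertType R) (T : pop X Y) :
  linear_relation T -> linear_relation T^-1%relation.
Proof. by move=> [T0 TD]; split=> // a x y x' y' h h'; exact: TD. Qed.

Lemma pimage_subspace (X Y : hilbertType R) (T : pop X Y) V : linear_relation T ->
  subspace V -> subspace (pimage T V).
Proof.
move=> [T0 TD] [V0 VD VZ]; split; first by exists 0.
  move=> y y' [x Vx Tx] [x' Vx' Tx']; exists (1 *: x + x').
    by apply: VD => //; exact: VZ.
  by rewrite -[y](scale1r y); exact: TD.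
move=> a y [x Vx Tx]; exists (a *: x); first exact: VZ.
by have := TD a _ _ _ _ Tx T0; rewrite !addr0.
Qed.

Lemma range_subspace (X Y : hilbertType R) (T : pop X Y) : linear_relation T -> subspace T.`2.
Proof.
move=> Tl; suff -> : T.`2 = pimage T setT by exact: pimage_subspace.
by apply/seteqP; split=> y [x]; exists x.
Qed.

Lemma dom_subspace (X Y : hilbertType R) (T : pop X Y) : linear_relation T -> subspace T.`1.
Proof. by move=> /linear_relationV /range_subspace. Qed.

Section paired_graph.
Context {X : hilbertType R}.
Variables P Q : X -> X.
Hypotheses (Pb : blin P) (Qb : blin Q) (Ps : rsym P) (Qs : rsym Q).
Hypothesis PQ : forall x, P (Q x) = Q (P x).
Hypothesis Pinj : forall x, P x = 0 -> x = 0.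

Definition paired_graph : pop X X := [set p | exists g, p = (P g, Q g)].

Lemma paired_graph_operator : is_operator paired_graph.
Proof.
have [[Pl _] [Ql _]] := (Pb, Qb); split.
- by exists 0; rewrite (lin0 Pl) (lin0 Ql).
- by move=> a _ _ _ _ [h [-> ->]] [h' [-> ->]]; exists (a *: h + h'); rewrite Pl Ql.
- move=> x y y' [h [-> ->]] [h' [E ->]]; congr Q.
  by apply/subr0_eq/Pinj; rewrite (linB Pl) E subrr.
Qed.

(** A pair [(x, y)] lies in the adjoint exactly when [Q x = P y]; the hypothesis thus says that the
    adjoint is no larger than the graph. *)
Lemma paired_graph_selfadjoint : (forall x y, Q x = P y -> paired_graph (x, y)) ->
  selfadjoint paired_graph.
Proof.
move=> Pmax; have op := paired_graph_operator; split => //.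
- apply: dense_subspace; first exact: dom_subspace (operator_linear op).
  move=> x hx; apply: Pinj; apply: rip_inj => z; rewrite rip0r -Ps.
  by apply: hx; exists (Q z), z.
- apply/seteqP; split=> -[x y].
    move=> /(padjoint_rip _ _ (is_operatorZ op)) h.
    by apply: Pmax; apply: rip_inj => z; rewrite -Qs -Ps; apply: h; exists z.
  move=> [h [-> ->]]; apply/(padjoint_rip _ _ (is_operatorZ op)) => _ _ [g [-> ->]].
  by rewrite Qs Ps PQ.
Qed.

End paired_graph.

Section root_of_resolvent.
Context {X : hilbertType R}.
Variable K : X -> X.
Hypothesis Kb : blin K.
Hypothesis Ks : rsym K.
Hypothesis K1 : forall x, nrm (K x) <= nrm x.
Hypothesis K2 : forall x, nrm (x - K x) <= nrm x.
Hypothesis Kinj : forall x, K x = 0 -> x = 0.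

(** The operator K^-1 - 1, whose resolvent at -1 is [K]. *)
Definition resolvent_graph : pop X X := paired_graph K (fun h => h - K h).

Let Jb : blin (fun x => x - K x).
Proof.
have [Kl _] := Kb; split; last by exists 1 => // x; rewrite mul1r.
by move=> a x y; rewrite Kl opprD addrACA -scalerBr.
Qed.

Let Js : rsym (fun x => x - K x).
Proof. by move=> x y; rewrite ripBl ripBr Ks. Qed.

Lemma resolvent_graph_selfadjoint : selfadjoint resolvent_graph.
Proof.
have [Kl _] := Kb; apply: paired_graph_selfadjoint => // [x|x y /eqP].
  by rewrite (linB Kl).
rewrite subr_eq -(linD Kl) addrC => /eqP E.
by exists (x + y); rewrite -E addrAC subrr add0r.
Qed.

(* With [P = K^(1/2)], [Q = (1 - K)^(1/2)], the graph [{(P g, Q g)}] is [(K^-1 - 1)^(1/2)]. *)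
Lemma resolvent_graph_sqrt : exists S : pop X X,
  [/\ selfadjoint S, nonnegative S & (S \; S)%relation = resolvent_graph].
Proof.
have [Kl _] := Kb.
have [P [Pb Ps P1 PP Pc]] := bounded_sqrt Kb Ks K2.
have [|Q [Qb Qs Q1 QQ Qc]] := bounded_sqrt Jb Js.
  by move=> x; rewrite opprB addrC subrK.
(* The fourth root of [K] serves for nonnegativity: [rip (P (Q g)) g] equals
   [rip (Q (Rt g)) (Rt g)]. *)
have [Rt [Rb Rs _ RR Rc]] := bounded_sqrt Pb Ps P1.
have [Pl _] := Pb; have [Ql _] := Qb; have [Rl _] := Rb.
have PK x : P (K x) = K (P x) by rewrite -PP PP -PP.
have PQ x : P (Q x) = Q (P x) by apply: Qc => // y; rewrite (linB Pl) PK.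
have QP x : Q (P x) = P (Q x) by rewrite PQ.
have QR x : Q (Rt x) = Rt (Q x) by apply: Rc.
have Qpos x : 0 <= rip (Q x) x.
  have := Q1 x; rewrite -(ler_pXn2r (n := 2)) ?nnegrE ?nrm_ge0 // !nrm_sq.
  rewrite ripBl !ripBr (ripC x) => h.
  by have := rip_ge0 (Q x); lra.
have Pinj x : P x = 0 -> x = 0.
  by move=> Px; apply: Kinj; rewrite -PP Px (lin0 Pl).
(* This recovers a parameter [g] from the pair [(P g, Q g)] and is the source of the witnesses
   below. *)
have PQ1 x : P (P x) + Q (Q x) = x by rewrite PP QQ addrC subrK.
exists (paired_graph P Q); split.
- apply: paired_graph_selfadjoint => // x y E; exists (P x + Q y); congr (_, _).
    by rewrite (linD Pl) PQ -E PQ1.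
  by rewrite (linD Ql) QP E PQ1.
- move=> _ _ [g [-> ->]].
  have M : blin (P \o Q) by exact: blin_comp.
  have Ms : rsym (P \o Q) by move=> x y /=; rewrite Ps Qs QP.
  have -> : ip (Q g) (P g) = ip ((P \o Q) g) g.
    apply: rip_ip => /=; first by rewrite Ps.
    by rewrite -(linZ Ql) -(linZ Pl) Ps -(linZ Ql).
  apply: rsym_ip => //=.
  by rewrite -RR Rs -QR Qpos.
- apply/seteqP; split=> -[x z].
    case=> y [g [-> ->]] [g' [E ->]]; exists (P g + Q g').
    have EP : P (P g + Q g') = g by rewrite (linD Pl) PQ -E PQ1.
    have EQ : Q (P g + Q g') = g' by rewrite (linD Ql) QP E PQ1.
    by congr (_, _); [rewrite -PP EP|rewrite -QQ EQ].
  move=> [h [-> ->]]; exists (P (Q h)).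
    by exists (P h); rewrite PP PQ.
  by exists (Q h); rewrite QQ.
Qed.

End root_of_resolvent.
End unbounded.

(** * Complete forms *)

Section forms.
Context {R : realType} {X : hilbertType R}.

(** A closed form, encoded by its form inner product: by [cform_ge], limits for [b] are also norm
    limits. *)
Record cform (M : set X) (b : X -> X -> R) : Prop := Cform {
  cform_sip : sip M b ;
  cform_complete : sip_complete M b ;
  cform_ge : forall x, M x -> nrm x ^+ 2 <= b x x }.

Lemma sip_cvg_diag (M : set X) b (u : nat -> X) w : sip M b -> (forall n, M (u n)) -> M w ->
  b (u n - w) (u n - w) @[n --> \oo] --> (0 : R) ->
  b (u n) (u n) @[n --> \oo] --> b w w.
Proof.
move=> bM Mu Mw h.
have l : b (u n - w) (u n - w) + 2 * b w (u n) - b w w @[n --> \oo] --> (0 + 2 * b w w - b w w : R).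
  apply: cvgB; last exact: cvg_cst.
  by apply: cvgD => //; apply: cvgM; [exact: cvg_cst|exact: (sip_cvgr bM)].
have -> : b w w = 0 + 2 * b w w - b w w by ring.
suff E n : b (u n) (u n) = b (u n - w) (u n - w) + 2 * b w (u n) - b w w.
  by under eq_cvg do rewrite E.
by rewrite !(sipB bM, sipBr bM) ?(sipC bM (Mu n) Mw) //; [ring|exact: (sipMB bM)].
Qed.

(* The range of [K] is dense for the form norm, by the projection theorem. *)
Lemma cform_core (M : set X) b (K : X -> X) x : cform M b -> blin K ->
  (forall f, M (K f)) -> (forall f v, M v -> rip v f = b v (K f)) -> M x ->
  exists f : nat -> X, b (K (f n) - x) (K (f n) - x) @[n --> \oo] --> (0 : R).
Proof.
move=> [bM bc _] [Kl _] MK bK Mx.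
pose N := range K.
have NM v : N v -> M v by move=> [f _ <-].
have bN : sip N b.
  split.
  - by exists 0 => //; rewrite (lin0 Kl).
  - by move=> _ _ [f _ <-] [g _ <-]; exists (f + g) => //; rewrite (linD Kl).
  - by move=> r _ [f _ <-]; exists (r%:C *: f) => //; rewrite (linZ Kl).
  - by move=> v w /NM Mv /NM Mw; exact: (sipC bM).
  - by move=> u v w /NM Mu /NM Mv /NM Mw; exact: (sipD bM).
  - by move=> r v w /NM Mv /NM Mw; exact: (sipZ bM).
  - by move=> v /NM Mv; exact: (sip_ge0 bM).
have [||||u [Nu uC hu]] := @riesz_sequence _ _ _ _ bN (b^~ x) (b x x).
- exact: (sip_ge0 bM).
- by move=> v w /NM Mv /NM Mw; exact: (sipD bM).
- by move=> r v /NM Mv; exact: (sipZ bM).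
- by move=> v /NM Mv; rewrite mulrC; apply: (sip_CS bM).
have Mu n : M (u n) by exact: NM.
have [w Mw uw] := bc u Mu uC.
have xw : w = x.
  apply: rip_inj => f; rewrite !(ripC f) !bK //.
  have h1 := hu (K f) (ex_intro2 _ _ f I erefl).
  rewrite (sipC bM Mw) // (sipC bM Mx) //; apply: cvgn_uniq (sip_cvgr bM (MK f) Mu Mw uw) h1.
rewrite xw in uw.
have hf n : exists f, K f = u n by have [f _ <-] := Nu n; exists f.
have [f hf'] := choice hf.
have uE : u = K \o f by apply/funext => n /=.
by rewrite uE in uw; exists f.
Qed.

Lemma cform_cvg_nrm (M : set X) b (u : nat -> X) x : cform M b -> (forall n, M (u n)) -> M x ->
  b (u n - x) (u n - x) @[n --> \oo] --> (0 : R) -> nrm (u n - x) @[n --> \oo] --> (0 : R).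
Proof.
move=> F Mu Mx h; apply: (@sqr_cvgn0 _ _ _ 1 h) => n; rewrite mul1r.
by apply: (cform_ge F); apply: (sipMB (cform_sip F)).
Qed.

Lemma sip_cvg_cauchy (M : set X) b (u : nat -> X) x : sip M b -> (forall n, M (u n)) -> M x ->
  b (u n - x) (u n - x) @[n --> \oo] --> (0 : R) -> sip_cauchy b u.
Proof.
move=> bM Mu Mx h e e0; have e4 : 0 < e / 4 by rewrite divr_gt0.
have /cvgr0Pnorm_lt/(_ _ e4) [N _ hN] := h.
exists N => m n Nm Nn.
have := le_lt_trans (ler_norm _) (hN m Nm); have := le_lt_trans (ler_norm _) (hN n Nn).
have Mm := sipMB bM (Mu m) Mx; have Mn := sipMB bM (Mu n) Mx.
have -> : u m - u n = (u m - x) - (u n - x) by rewrite opprB addrA subrK.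
move: (u m - x) (u n - x) Mm Mn => v w Mv Mw.
have := sip_ge0 bM (sipMD bM Mv Mw).
rewrite (sipD bM Mv Mw (sipMD bM Mv Mw)) (sipB bM Mv Mw (sipMB bM Mv Mw)).
rewrite !(sipBr bM Mv Mw) // !(sipDr bM Mv Mw) // (sipC bM Mw Mv).
by lra.
Qed.

(** The sequence is Cauchy for both forms, and its two limits coincide because each form norm
    dominates the norm of [X]. *)
Lemma cform_transfer (M1 M2 L : set X) b1 b2 : cform M1 b1 -> cform M2 b2 ->
  (forall v, L v -> M1 v) -> (forall v, L v -> M2 v) ->
  (forall v w, L v -> L w -> L (v - w)) -> (forall v, L v -> b1 v v = b2 v v) ->
  forall (u : nat -> X) x, (forall n, L (u n)) -> M1 x ->
    b1 (u n - x) (u n - x) @[n --> \oo] --> (0 : R) -> M2 x /\ b1 x x = b2 x x.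
Proof.
move=> F1 F2 LM1 LM2 LB E u x Lu Mx ux.
have Mu1 n := LM1 _ (Lu n); have Mu2 n := LM2 _ (Lu n).
have uC2 : sip_cauchy b2 u.
  move=> e /(sip_cvg_cauchy (cform_sip F1) Mu1 Mx ux) [N hN].
  by exists N => m n Nm Nn; rewrite -E; [exact: hN|exact: LB].
have [w Mw uw] := cform_complete F2 Mu2 uC2.
have xw : x = w.
  exact: nrm_cvg_uniq (cform_cvg_nrm F1 Mu1 Mx ux) (cform_cvg_nrm F2 Mu2 Mw uw).
split; first by rewrite xw.
rewrite -xw in uw Mw.
have l1 := sip_cvg_diag (cform_sip F1) Mu1 Mx ux.
have l2 := sip_cvg_diag (cform_sip F2) Mu2 Mw uw.
by apply: cvgn_uniq l1 _; under eq_cvg do rewrite E //.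
Qed.

(** The range of [K] is dense for the first form norm, and on it both forms reduce to [rip v f].
    Used in both directions, this says that the resolvent determines the form. *)
Lemma cform_sub (M1 M2 : set X) b1 b2 (K : X -> X) : cform M1 b1 -> cform M2 b2 -> blin K ->
  (forall f, M1 (K f)) -> (forall f v, M1 v -> rip v f = b1 v (K f)) ->
  (forall f, M2 (K f)) -> (forall f v, M2 v -> rip v f = b2 v (K f)) ->
  forall x, M1 x -> M2 x /\ b1 x x = b2 x x.
Proof.
move=> F1 F2 Kb MK1 bK1 MK2 bK2 x Mx; have [Kl _] := Kb.
have [f fx] := cform_core F1 Kb MK1 bK1 Mx.
apply: (@cform_transfer _ _ (range K) _ _ F1 F2 _ _ _ _ (K \o f)).
- by move=> _ [g _ <-].
- by move=> _ [g _ <-].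
- by move=> _ _ [g _ <-] [h _ <-]; exists (g - h) => //; rewrite (linB Kl).
- by move=> _ [g _ <-]; rewrite -bK1 // -bK2.
- by move=> n; exists (f n).
- exact: Mx.
- exact: fx.
Qed.

Lemma sip_polar (M : set X) b v w : sip M b -> M v -> M w ->
  b v w = (b (v + w) (v + w) - b (v - w) (v - w)) / 4.
Proof.
move=> bM Mv Mw; have Mvw := sipMD bM Mv Mw; have Mvw' := sipMB bM Mv Mw.
rewrite (sipD bM Mv Mw Mvw) (sipB bM Mv Mw Mvw').
rewrite !(sipBr bM Mv Mw) // !(sipDr bM Mv Mw) // (sipC bM Mw Mv).
by field.
Qed.

Section selfadjoint_form.
Variable S : pop X X.
Hypothesis Ssa : selfadjoint S.

Local Notation s := (papp S).

Lemma pappP v : S.`1 v -> S (v, s v).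
Proof. by move=> [w hw]; exact: (@xgetI _ 0 [set y | S (v, y)] w). Qed.

Lemma pappE v w : S (v, w) -> s v = w.
Proof.
move=> h; have [[_ _ f] _ _] := Ssa; apply: (f v) => //.
by apply: pappP; exists w.
Qed.

Lemma dom_lin a v w : S.`1 v -> S.`1 w -> S (a *: v + w, a *: s v + s w).
Proof. by move=> /pappP hv /pappP hw; have [[_ Sl _] _ _] := Ssa; exact: Sl. Qed.

Lemma pappP_lin a v w : S.`1 v -> S.`1 w -> s (a *: v + w) = a *: s v + s w.
Proof. by move=> hv hw; apply: pappE; exact: dom_lin. Qed.

Lemma selfadjoint_dom : subspace S.`1.
Proof. by have [/operator_linear op _ _] := Ssa; exact: dom_subspace. Qed.

Lemma papp0 : s 0 = 0.
Proof. by have [[S0 _ _] _ _] := Ssa; exact: pappE. Qed.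

Lemma pappD v w : S.`1 v -> S.`1 w -> s (v + w) = s v + s w.
Proof. by move=> hv hw; have := pappP_lin 1 hv hw; rewrite !scale1r. Qed.
Lemma pappZ a v : S.`1 v -> s (a *: v) = a *: s v.
Proof.
move=> hv; have [h0 _ _] := selfadjoint_dom.
by have := pappP_lin a hv h0; rewrite papp0 !addr0.
Qed.
Lemma pappB v w : S.`1 v -> S.`1 w -> s (v - w) = s v - s w.
Proof.
move=> hv hw; have h := subspaceN selfadjoint_dom hw.
by rewrite pappD // -scaleN1r pappZ // scaleN1r.
Qed.

Lemma selfadjointP x y : S (x, y) <-> forall v, S.`1 v -> rip (s v) x = rip v y.
Proof.
have [op _ adj] := Ssa; have Sz := is_operatorZ op.
rewrite -{1}adj; rewrite (padjoint_rip _ _ Sz); split=> h v.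
  by move=> hv; apply: h; exact: pappP.
move=> w hw; rewrite -(pappE hw); apply: h; by exists w.
Qed.

Lemma papp_sym x y : S.`1 x -> S.`1 y -> rip (s x) y = rip x (s y).
Proof. by move=> hx /pappP /selfadjointP /(_ x hx). Qed.

Lemma selfadjoint_closed (u : nat -> X) x y : (forall n, S.`1 (u n)) ->
  nrm (u n - x) @[n --> \oo] --> (0 : R) -> nrm (s (u n) - y) @[n --> \oo] --> (0 : R) ->
  S (x, y).
Proof.
move=> hu ux uy; apply/selfadjointP => v hv.
have h1 : rip (u n) (s v) @[n --> \oo] --> rip x (s v) by exact: rip_cvgl.
have h2 : rip (s (u n)) v @[n --> \oo] --> rip y v by exact: rip_cvgl.
rewrite ripC (ripC v); apply: cvgn_uniq h1 _.
by under eq_cvg do rewrite -papp_sym //.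
Qed.

(** The graph inner product; its completeness is the closedness of [S]. *)
Definition gform (v w : X) : R := rip v w + rip (s v) (s w).

Lemma gform_cform : cform S.`1 gform.
Proof.
have [D0 DD DZ] := selfadjoint_dom.
have T : sip S.`1 gform.
  split => //.
  - by move=> r v; exact: DZ.
  - by move=> v w _ _; rewrite /gform ripC [X in _ + X]ripC.
  - by move=> u v w hu hv _; rewrite /gform pappD // !ripDl; ring.
  - by move=> r v w hv _; rewrite /gform pappZ // !ripZl; ring.
  - by move=> v _; rewrite addr_ge0 ?rip_ge0.
split => //; last by move=> x _; rewrite /gform nrm_sq lerDl rip_ge0.
move=> u hu uC.
have hB m n : S.`1 (u m - u n) by apply: subspaceB selfadjoint_dom _ _.
have C1 : sip_cauchy rip u.
  move=> e /uC [N hN]; exists N => m n Nm Nn; apply: le_lt_trans (hN m n Nm Nn).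
  by rewrite /gform lerDl rip_ge0.
have C2 : sip_cauchy rip (s \o u).
  move=> e /uC [N hN]; exists N => m n Nm Nn; apply: le_lt_trans (hN m n Nm Nn).
  by rewrite /gform /= pappB // lerDr rip_ge0.
have [x ux] := sip_cauchy_rip C1; have [y uy] := sip_cauchy_rip C2.
have Sxy : S (x, y) by exact: selfadjoint_closed ux uy.
have hx : S.`1 x by exists y.
exists x => //; rewrite /gform.
have l : nrm (u n - x) * nrm (u n - x) + nrm (s (u n) - y) * nrm (s (u n) - y) @[n --> \oo]
   --> (0 * 0 + 0 * 0 : R) by apply: cvgD; apply: cvgM.
rewrite mulr0 addr0 in l.
under eq_cvg => n do rewrite pappB // (pappE Sxy) -!nrm_sq !expr2.
exact: l.
Qed.

(** [s x] has the image [z] under [S] exactly when it does under the adjoint; the square is thus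
    described by the form of [S]. *)
Lemma sqrt_relP x z : (S \; S)%relation (x, z) <->
  S.`1 x /\ forall v, S.`1 v -> rip (s v) (s x) = rip v z.
Proof.
split=> [[y Sxy Syz]|[hx h]].
  split; first by exists y.
  move=> v hv; have -> : s x = y by exact: pappE.
  by move/selfadjointP: Syz; exact.
exists (s x); first exact: pappP.
by apply/selfadjointP.
Qed.

End selfadjoint_form.
End forms.

(** * The operator of a sum of squares *)

Section summable_form.
Context {R : realType} {X Y : hilbertType R}.
Variable c : nat -> X -> Y.
Hypothesis cb : forall k, blin (c k).

Let cl k := blin_lin (cb k).

Definition qsum N v w : R := \sum_(0 <= k < N) rip (c k v) (c k w).
Definition qfin v := exists M : R, forall N, qsum N v v <= M.
(** The limit is total; it is meaningful when both arguments satisfy [qfin], where the sums converge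
    by polarization. *)
Definition qform v w : R := limn (fun N => qsum N v w).

Lemma qsumC N v w : qsum N v w = qsum N w v.
Proof. by apply: eq_bigr => k _; rewrite ripC. Qed.
Lemma qsumDl N u v w : qsum N (u + v) w = qsum N u w + qsum N v w.
Proof. by rewrite -big_split; apply: eq_bigr => k _; rewrite (linD (cl k)) ripDl. Qed.
Lemma qsumZl N (r : R) v w : qsum N (r%:C *: v) w = r * qsum N v w.
Proof. by rewrite big_distrr; apply: eq_bigr => k _; rewrite (linZ (cl k)) ripZl. Qed.
Lemma qsum_i N v w : qsum N ('i *: v) w = - qsum N v ('i *: w).
Proof. by rewrite -sumrN; apply: eq_bigr => k _; rewrite !(linZ (cl k)) rip_iC. Qed.
Lemma qsum_ge0 N v : 0 <= qsum N v v.
Proof. by apply: sumr_ge0 => k _; exact: rip_ge0. Qed.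
Lemma qsum_mono v : nondecreasing_seq (fun N => qsum N v v).
Proof.
by apply/nondecreasing_seqP => N; rewrite {2}/qsum big_nat_recr //= lerDl rip_ge0.
Qed.

Lemma sip_qsum N : sip [set: X] (qsum N).
Proof.
split=> // *; [exact: qsumC|exact: qsumDl|exact: qsumZl|exact: qsum_ge0].
Qed.

Lemma qsum_add_le N v w : qsum N (v + w) (v + w) <= 2 * qsum N v v + 2 * qsum N w w.
Proof.
have := qsum_ge0 N (v - w).
rewrite (sipB (sip_qsum N)) // !(sipBr (sip_qsum N)) // (qsumC N w v).
rewrite (sipD (sip_qsum N)) // !(sipDr (sip_qsum N)) // (qsumC N w v).
by lra.
Qed.

Lemma qfinD v w : qfin v -> qfin w -> qfin (v + w).
Proof.
move=> [M hM] [M' hM']; exists (2 * M + 2 * M') => N.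
by apply: le_trans (qsum_add_le N v w) _; have := hM N; have := hM' N; lra.
Qed.

Lemma qfinZ a v : qfin v -> qfin (a *: v).
Proof.
move=> [M hM]; exists (cn a ^+ 2 * M) => N.
have -> : qsum N (a *: v) (a *: v) = cn a ^+ 2 * qsum N v v.
  rewrite big_distrr; apply: eq_bigr => k _.
  by rewrite (linZ (cl k)) -!nrm_sq nrmZ exprMn.
by rewrite ler_wpM2l ?sqr_ge0.
Qed.

Lemma qfinN v : qfin v -> qfin (- v).
Proof. by rewrite -scaleN1r; exact: qfinZ. Qed.

Lemma qfinB v w : qfin v -> qfin w -> qfin (v - w).
Proof. by move=> hv hw; apply: qfinD => //; exact: qfinN. Qed.

Lemma qsum_cvgxx v : qfin v -> cvgn (fun N => qsum N v v).
Proof.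
move=> [M hM]; apply: nondecreasing_is_cvgn; first exact: qsum_mono.
by exists M => _ [N _ <-].
Qed.

Lemma qsum_cvg v w : qfin v -> qfin w -> qsum N v w @[N --> \oo] --> qform v w.
Proof.
move=> hv hw.
have E N : qsum N v w = (qsum N (v + w) (v + w) - qsum N (v - w) (v - w)) / 4.
  by apply: (sip_polar (sip_qsum N)).
suff : cvgn (fun N => qsum N v w) by [].
under eq_fun do rewrite E.
apply: is_cvgM; last exact: is_cvg_cst.
by apply: is_cvgB; apply: qsum_cvgxx; [exact: qfinD|exact: qfinB].
Qed.

Lemma qform_unique v w l : qsum N v w @[N --> \oo] --> (l : R) -> qform v w = l.
Proof. exact: (cvg_lim (@Rhausdorff R)). Qed.

Lemma qformC v w : qform v w = qform w v.
Proof. by rewrite /qform; under eq_fun do rewrite qsumC. Qed.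
Lemma qformDl u v w : qfin u -> qfin v -> qfin w ->
  qform (u + v) w = qform u w + qform v w.
Proof.
move=> hu hv hw; apply: qform_unique; under eq_cvg do rewrite qsumDl.
by apply: cvgD; exact: qsum_cvg.
Qed.
Lemma qformZl (r : R) v w : qfin v -> qfin w -> qform (r%:C *: v) w = r * qform v w.
Proof.
move=> hv hw; apply: qform_unique; under eq_cvg do rewrite qsumZl.
by apply: cvgM; [exact: cvg_cst|exact: qsum_cvg].
Qed.
Lemma qform_i v w : qfin v -> qfin w -> qform ('i *: v) w = - qform v ('i *: w).
Proof.
move=> hv hw; apply: qform_unique; under eq_cvg do rewrite qsum_i.
by apply: cvgN; apply: qsum_cvg => //; exact: qfinZ.
Qed.
Lemma qsum_le_qform N v : qfin v -> qsum N v v <= qform v v.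
Proof. by move=> hv; apply: nondecreasing_cvgn_le; [exact: qsum_mono|exact: qsum_cvgxx]. Qed.
Lemma qform_ge0 v : qfin v -> 0 <= qform v v.
Proof. by move=> /(qsum_le_qform 0); rewrite /qsum big_geq. Qed.
Lemma qform_le v (M : R) : qfin v -> (forall N, qsum N v v <= M) -> qform v v <= M.
Proof. by move=> hv h; apply: limr_le; [exact: qsum_cvgxx|exact: nearW]. Qed.
Lemma qfin0 : qfin 0.
Proof. by exists 0 => N; rewrite -(scale0r 0) qsumZl mul0r. Qed.

Lemma sip_qform : sip qfin qform.
Proof.
split; [exact: qfin0|exact: qfinD|by move=> r v; exact: qfinZ|..].
- by move=> v w _ _; exact: qformC.
- exact: qformDl.
- exact: qformZl.
- exact: qform_ge0.
Qed.

Lemma qsum_cvg_nrm N (u : nat -> X) x : nrm (u n - x) @[n --> \oo] --> (0 : R) ->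
  qsum N (u n) (u n) @[n --> \oo] --> qsum N x x.
Proof.
move=> ux; elim: N => [|N ih].
  by rewrite /qsum big_geq //; under eq_cvg do rewrite big_geq //; exact: cvg_cst.
rewrite {2}/qsum big_nat_recr //=; under eq_cvg do rewrite {1}/qsum big_nat_recr //=.
apply: cvgD; first exact: ih.
by apply: rip_cvg; exact: blin_cvg.
Qed.

Variable L : set X.
Hypothesis Lsub : subspace L.
Hypothesis Lfin : forall x, L x -> qfin x.

Let L0 : L 0. Proof. by case: Lsub. Qed.
Let LD v w : L v -> L w -> L (v + w). Proof. by case: Lsub => _ h _; exact: h. Qed.
Let LZ a v : L v -> L (a *: v). Proof. by case: Lsub => _ _; exact. Qed.

(* the completion of [L] for the norm [|x|^2 + sum_k |c_k x|^2], realized inside [X] *)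
Definition qdom x := forall e : R, 0 < e -> exists2 v, L v &
  forall N, nrm (x - v) ^+ 2 + qsum N (x - v) (x - v) <= e.

Lemma qdom_L x : L x -> qdom x.
Proof.
move=> Lx e e0; exists x => // N; rewrite subrr nrm0 expr0n add0r.
by rewrite -(scale0r 0) qsumZl mul0r ltW.
Qed.

Lemma qdom_fin x : qdom x -> qfin x.
Proof.
move=> /(_ 1 ltr01) [v Lv h]; rewrite -(subrK v x); apply: qfinD; last exact: Lfin.
by exists 1 => N; apply: le_trans (h N); rewrite lerDr sqr_ge0.
Qed.

Lemma nrm2D (v w : X) : nrm (v + w) ^+ 2 <= 2 * nrm v ^+ 2 + 2 * nrm w ^+ 2.
Proof.
rewrite !nrm_sq; have := rip_ge0 (v - w).
by rewrite !ripBl !ripBr !ripDl !ripDr (ripC w v); lra.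
Qed.

Lemma qdom_approx x : (forall e : R, 0 < e -> exists2 y, qdom y &
  forall N, nrm (x - y) ^+ 2 + qsum N (x - y) (x - y) <= e) -> qdom x.
Proof.
move=> h e e0; have e4 : 0 < e / 4 by rewrite divr_gt0.
have [y hy xy] := h _ e4; have [v Lv yv] := hy _ e4.
exists v => // N.
have -> : x - v = (x - y) + (y - v) by rewrite addrA subrK.
have := nrm2D (x - y) (y - v); have := qsum_add_le N (x - y) (y - v).
by have := xy N; have := yv N; lra.
Qed.

Lemma qdomD x y : qdom x -> qdom y -> qdom (x + y).
Proof.
move=> hx hy e e0; have e4 : 0 < e / 4 by rewrite divr_gt0.
have [v Lv xv] := hx _ e4; have [w Lw yw] := hy _ e4.
exists (v + w) => [|N]; first exact: LD.
rewrite opprD addrACA.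
have := nrm2D (x - v) (y - w); have := qsum_add_le N (x - v) (y - w).
by have := xv N; have := yw N; lra.
Qed.

Lemma qdomZ a x : qdom x -> qdom (a *: x).
Proof.
move=> hx e e0; have ce : 0 < e / (cn a ^+ 2 + 1) by rewrite divr_gt0 // ltr_wpDl ?sqr_ge0.
have [v Lv xv] := hx _ ce; exists (a *: v) => [|N]; first exact: LZ.
rewrite -scalerBr nrmZ -/(cn a) exprMn.
have -> : qsum N (a *: (x - v)) (a *: (x - v)) = cn a ^+ 2 * qsum N (x - v) (x - v).
  rewrite big_distrr; apply: eq_bigr => k _.
  by rewrite (linZ (cl k)) -!nrm_sq nrmZ exprMn.
rewrite -mulrDr; have := xv N; rewrite ler_pdivlMr ?ltr_wpDl ?sqr_ge0 //.
move=> h; apply: le_trans h; rewrite mulrC ler_wpM2l ?lerDl //.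
by rewrite addr_ge0 ?sqr_ge0 ?qsum_ge0.
Qed.

Lemma qdom_sub : subspace qdom.
Proof. by split; [apply: qdom_L|exact: qdomD|exact: qdomZ]. Qed.

Lemma qdomB x y : qdom x -> qdom y -> qdom (x - y).
Proof. by move=> hx hy; apply: subspaceB qdom_sub _ _. Qed.

Definition qgform v w : R := rip v w + qform v w.

Lemma qgform_sip : sip qdom qgform.
Proof.
have T := sip_qform; have F := qdom_fin.
split; [exact: qdom_L|exact: qdomD|by move=> r v; exact: qdomZ|..].
- by move=> v w _ _; rewrite /qgform ripC qformC.
- by move=> u v w /F hu /F hv /F hw; rewrite /qgform ripDl qformDl //; ring.
- by move=> r v w /F hv /F hw; rewrite /qgform ripZl qformZl //; ring.
- by move=> v /F hv; rewrite addr_ge0 ?rip_ge0 // qform_ge0.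
Qed.

Lemma qgform_ge x N : qdom x -> nrm x ^+ 2 + qsum N x x <= qgform x x.
Proof. by move=> /qdom_fin hx; rewrite /qgform nrm_sq lerD2l qsum_le_qform. Qed.

Lemma qgform_le x (e : R) : qdom x -> (forall N, nrm x ^+ 2 + qsum N x x <= e) ->
  qgform x x <= e.
Proof.
move=> hx h; rewrite /qgform -nrm_sq addrC -lerBrDr; apply: qform_le; first exact: qdom_fin.
by move=> N; have := h N; lra.
Qed.

Lemma qgform_core x : qdom x ->
  exists2 v : nat -> X, (forall n, L (v n)) &
    qgform (v n - x) (v n - x) @[n --> \oo] --> (0 : R).
Proof.
move=> hx.
have h n : exists v, L v /\ qgform (v - x) (v - x) <= n.+1%:R^-1.
  have [|v Lv xv] := hx n.+1%:R^-1; first by rewrite invr_gt0.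
  exists v; split=> //; apply: qgform_le; first by apply: qdomB => //; exact: qdom_L.
  move=> N; have := xv N.
  have -> : v - x = (-1)%:C *: (x - v) by rewrite rmorphN1 scaleN1r opprB.
  by rewrite qsumZl qsumC qsumZl mulN1r mulN1r opprK nrmZr normrN1 mul1r.
exists (fun n => projT1 (cid (h n))); first by move=> n; case: (cid (h n)) => ? [].
apply: squeeze_cvgr (cvg_cst 0) (@cvg_harmonic R); apply: nearW => n.
case: (cid (h n)) => v [Lv hv] /=; rewrite hv andbT.
by apply: (sip_ge0 qgform_sip); apply: qdomB => //; exact: qdom_L.
Qed.

(** Closability: each [qsum K] is norm continuous, so a bound on the increments of a Cauchy sequence
    that is uniform in [K] survives the norm limit. *)
Lemma qgform_cform : cform qdom qgform.
Proof.
split; [exact: qgform_sip| |by move=> x /(qgform_ge 0); rewrite /qsum big_geq // addr0].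
move=> u hu uC.
have hB m n : qdom (u m - u n) by exact: qdomB.
have C1 : sip_cauchy rip u.
  move=> e /uC [N hN]; exists N => m n Nm Nn; apply: le_lt_trans (hN m n Nm Nn).
  by have := qgform_ge 0 (hB m n); rewrite /qsum big_geq // addr0 nrm_sq.
have [x ux] := sip_cauchy_rip C1.
have key e : 0 < e -> exists N, forall n, (N <= n)%N -> forall K,
    nrm (u n - x) ^+ 2 + qsum K (u n - x) (u n - x) <= e.
  move=> e0; have [N hN] := uC e e0; exists N => n Nn K.
  have l1 : nrm (u n - u m - (u n - x)) @[m --> \oo] --> (0 : R).
    under eq_cvg do rewrite opprB addrC addrA subrK nrmBC.
    exact: ux.
  have l : nrm (u n - u m) * nrm (u n - u m) + qsum K (u n - u m) (u n - u m) @[m --> \oo]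
      --> nrm (u n - x) * nrm (u n - x) + qsum K (u n - x) (u n - x).
    apply: cvgD; first by apply: cvgM; exact: nrm_cvg.
    exact: qsum_cvg_nrm.
  rewrite expr2; apply: cvgr_to_le l _.
  exists N => // m Nm; rewrite -expr2; apply: le_trans (qgform_ge K (hB n m)) _.
  by apply: ltW; exact: hN.
have hx : qdom x.
  apply: qdom_approx => e /key [N hN]; exists (u N) => // K.
  have := hN N (leqnn N) K.
  have -> : u N - x = (-1)%:C *: (x - u N) by rewrite rmorphN1 scaleN1r opprB.
  by rewrite qsumZl qsumC qsumZl mulN1r mulN1r opprK nrmZr normrN1 mul1r.
exists x => //; apply/cvgr0Pnorm_lt => e e0.
have e2 : 0 < e / 2 by rewrite divr_gt0.
have [N hN] := key _ e2; exists N => // n /= Nn.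
have hux : qdom (u n - x) by exact: qdomB.
rewrite ger0_norm; last exact: (sip_ge0 qgform_sip).
by apply: le_lt_trans (qgform_le hux (hN n Nn)) _; lra.
Qed.

Hypothesis Ldense : dense L.
Hypothesis cinj : forall x, (forall k, c k x = 0) -> x = 0.

Lemma qform_eq0 x : qdom x -> qform x x = 0 -> x = 0.
Proof.
move=> /qdom_fin hx h; apply: cinj => k; apply: rip_eq0; apply/eqP.
rewrite eq_le rip_ge0 andbT -h; apply: le_trans (qsum_le_qform k.+1 hx).
by rewrite /qsum big_nat_recr //= lerDr qsum_ge0.
Qed.

(** [K f] is the Riesz vector of [rip^~ f] for the form inner product, that is, [K] inverts 1 + H
    for the operator H of the form. *)
Lemma qform_resolvent : exists K : X -> X, [/\
   [/\ blin K, rsym K, forall x, nrm (K x) <= nrm x, forall x, nrm (x - K x) <= nrm x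
     & forall x, K x = 0 -> x = 0],
   forall f, qdom (K f),
   forall f v, qdom v -> rip v f = qgform v (K f) &
   forall f w, qdom w -> (forall v, qdom v -> rip v f = qgform v w) -> w = K f].
Proof.
have T := cform_sip qgform_cform.
have F := qdom_fin.
have ex f : exists w, qdom w /\ forall v, qdom v -> rip v f = qgform v w.
  have [||||w hw h] := riesz_form T (phi := rip^~ f) (c := rip f f) (cform_complete qgform_cform).
  - exact: rip_ge0.
  - by move=> v w _ _; exact: ripDl.
  - by move=> r v _; exact: ripZl.
  - move=> v hv; apply: le_trans (rip_CS v f) _; rewrite mulrC ler_wpM2l ?rip_ge0 //.
    by rewrite -nrm_sq (cform_ge qgform_cform).
  by exists w.
have [K hK] := choice ex.
have KD f : qdom (K f) by case: (hK f).
have KE f v : qdom v -> rip v f = qgform v (K f) by case: (hK f) => _; exact.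
have Ku f w : qdom w -> (forall v, qdom v -> rip v f = qgform v w) -> w = K f.
  move=> hw h; have hwK := qdomB hw (KD f).
  apply/subr0_eq/nrm0_eq0/eqP; rewrite -sqrf_eq0 eq_le sqr_ge0 andbT.
  apply: le_trans (cform_ge qgform_cform hwK) _.
  by rewrite (sipBr T) // -h // -KE // subrr.
have KDD f g : K (f + g) = K f + K g.
  apply/esym/Ku; first exact: qdomD.
  by move=> v hv; rewrite ripDr (sipDr T) // -!KE.
have KZ (r : R) f : K (r%:C *: f) = r%:C *: K f.
  apply/esym/Ku; first exact: qdomZ.
  by move=> v hv; rewrite ripZr (sipZr T) // -!KE.
(* The Riesz theorem used is real, so homogeneity for ['i] is checked apart through [qform_i]. *)
have Ki f : K ('i *: f) = 'i *: K f.
  apply/esym/Ku; first exact: qdomZ.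
  move=> v hv; have hv' := qdomZ 'i hv.
  have := KE f _ hv'; rewrite /qgform !rip_iC (qform_i (F _ hv) (F _ (KD f))).
  by lra.
have KL a x y : K (a *: x + y) = a *: K x + K y.
  rewrite KDD; congr (_ + _); rewrite {1}[a]complexE scalerDl -scalerA KDD KZ Ki KZ.
  by rewrite scalerA -scalerDl -complexE.
have Kle x : rip (K x) (K x) <= rip (K x) x.
  by rewrite (KE x) // /qgform lerDl qform_ge0 //; exact: F.
have K1 x : nrm (K x) <= nrm x.
  have [->|k0] := eqVneq (nrm (K x)) 0; first exact: nrm_ge0.
  rewrite -(ler_pM2l (x := nrm (K x))); last by rewrite lt_neqAle eq_sym k0 nrm_ge0.
  rewrite -expr2 nrm_sq; apply: le_trans (Kle x) _.
  by apply: le_trans (ler_norm _) _; exact: rip_le.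
exists K; split => //; split => //.
- by split => //; exists 1 => // x; rewrite mul1r.
- by move=> x y; rewrite (KE y) // ripC (KE x) // (sipC T).
- move=> x; rewrite -(ler_pXn2r (n := 2)) ?nnegrE ?nrm_ge0 // !nrm_sq ripBl !ripBr.
  by have := Kle x; have := rip_ge0 (K x); rewrite (ripC x); lra.
- move=> x Kx; apply: (dense_rip0 Ldense) => v Lv.
  rewrite (KE x); last exact: qdom_L.
  by rewrite Kx (sipC T) ?(sip0 T) //; exact: qdom_L.
Qed.

(** The last clause speaks of every selfadjoint root because [psqrt] is a chosen one. The graph form
    of any root has [K] as its resolvent, so [cform_sub] in both directions identifies it with
    [qgform]. *)
Theorem qform_operator : exists H : pop X X, [/\ selfadjoint H,
  exists S, [/\ selfadjoint S, nonnegative S & (S \; S)%relation = H],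
  forall x z, H (x, z) <-> qdom x /\ forall v, qdom v -> qform v x = rip v z &
  forall S, selfadjoint S -> (S \; S)%relation = H ->
   (forall x, S.`1 x <-> qdom x) /\
   (forall x y, qdom x -> qdom y -> rip (papp S x) (papp S y) = qform x y)].
Proof.
have [K [[Kb Ks K1 K2 Kinj] KD KE Ku]] := qform_resolvent.
exists (resolvent_graph K); split.
- exact: resolvent_graph_selfadjoint.
- exact: resolvent_graph_sqrt.
- move=> x z; split=> [[h [-> ->]]|[hx h]].
    by split=> // v hv; rewrite ripBr (KE h) // /qgform addrAC subrr add0r.
  have xK : x = K (x + z) by apply: Ku => // v hv; rewrite ripDr /qgform h.
  by exists (x + z); rewrite -xK addrAC subrr add0r.
- move=> S Ssa SS.
  have SK f : (S \; S)%relation (K f, f - K f) by rewrite SS; exists f.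
  have D2 f : S.`1 (K f) by have /(sqrt_relP Ssa) [] := SK f.
  have E2 f v : S.`1 v -> rip v f = gform S v (K f).
    move=> hv; have /(sqrt_relP Ssa) [_ /(_ v hv)] := SK f.
    by rewrite /gform => ->; rewrite ripBr addrC subrK.
  have h1 := cform_sub qgform_cform (gform_cform Ssa) Kb KD KE D2 E2.
  have h2 := cform_sub (gform_cform Ssa) qgform_cform Kb D2 E2 KD KE.
  have SD x : S.`1 x <-> qdom x by split=> [/h2[]|/h1[]].
  split => // x y hx hy.
  have hxD := qdomD hx hy; have hxB := qdomB hx hy.
  have : qgform x y = gform S x y.
    rewrite (sip_polar (cform_sip qgform_cform)) //.
    rewrite (sip_polar (cform_sip (gform_cform Ssa))); try exact/SD.
    by rewrite (h1 _ hxD).2 (h1 _ hxB).2.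
  by rewrite /qgform /gform => /addrI.
Qed.

End summable_form.

(** * Uniform boundedness and reachability *)

Section uniform_boundedness.
Context {R : realType} {U Z : hilbertType R}.

(** A Baire argument: halving the radii makes the centers Cauchy, and their limit lies in every
    closed ball. *)
Lemma nested_balls (P : nat -> U -> Prop) :
  (forall n x r, 0 < r -> exists x' r', [/\ 0 < r', nrm (x' - x) + r' <= r, 2 * r' <= r &
     forall z, nrm (z - x') <= r' -> P n z]) ->
  exists z, forall n, P n z.
Proof.
move=> step.
have step' (q : nat * (U * R)) : exists q' : U * R, 0 < q.2.2 ->
    [/\ 0 < q'.2, nrm (q'.1 - q.2.1) + q'.2 <= q.2.2, 2 * q'.2 <= q.2.2 &
     forall z, nrm (z - q'.1) <= q'.2 -> P q.1 z].
  case: q => n [x r] /=; have [r0|nr0] := pselect (0 < r); last by exists (x, r).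
  by have [x' [r' h]] := step n x r r0; exists (x', r').
have [G hG] := choice step'.
pose q := fix q n := if n is n'.+1 then G (n', q n') else (0, 1).
have q0 n : 0 < (q n).2.
  by elim: n => [|n ih] /=; [exact: ltr01|case: (hG (n, q n) ih)].
have q1 n : nrm ((q n.+1).1 - (q n).1) + (q n.+1).2 <= (q n).2 by case: (hG (n, q n) (q0 n)).
have q2 n : 2 * (q n.+1).2 <= (q n).2 by case: (hG (n, q n) (q0 n)).
have q3 n z : nrm (z - (q n.+1).1) <= (q n.+1).2 -> P n z.
  by case: (hG (n, q n) (q0 n)) => _ _ _; exact.
have nest n k : nrm ((q (k + n)%N).1 - (q n).1) + (q (k + n)%N).2 <= (q n).2.
  elim: k => [|k ih]; first by rewrite add0n subrr nrm0 add0r.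
  rewrite addSn; apply: le_trans ih; apply: le_trans (lerD (nrmB_tri (q (k + n)%N).1 _ _) (lexx _)) _.
  by have := q1 (k + n)%N; lra.
have q4 n : (q n).2 <= 2^-1 ^+ n.
  elim: n => [|n ih]; first by rewrite expr0.
  by rewrite exprS; have := q2 n; lra.
have close m n : (n <= m)%N -> nrm ((q m).1 - (q n).1) <= (q n).2.
  by move=> /subnK <-; have := nest n (m - n)%N; have := q0 (m - n + n)%N; lra.
have [z hz] : exists z, nrm ((q n).1 - z) @[n --> \oo] --> (0 : R).
  apply: hilbert_complete => e e0.
  have e2 : 0 < e / 2 by rewrite divr_gt0.
  have /cvgr0Pnorm_lt/(_ _ e2) [N _ hN] := @cvg_half_expr R; exists N => m n Nm Nn.
  have := le_lt_trans (ler_norm _) (hN N (leqnn N)) => h.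
  apply: le_lt_trans (nrmB_tri (q N).1 _ _) _; rewrite (nrmBC (q N).1).
  by have := close m N Nm; have := close n N Nn; have := q4 N; lra.
exists z => n; apply: q3.
have l : nrm ((q m).1 - (q n.+1).1) @[m --> \oo] --> nrm (z - (q n.+1).1).
  apply: nrm_cvg; under eq_cvg do rewrite opprB addrA subrK.
  exact: hz.
apply: cvgr_to_le l _.
by exists n.+1 => // m nm; exact: (close m n.+1 nm).
Qed.

(* Banach-Steinhaus for the functionals [u |-> rip (T u) y] *)
Lemma weakly_bounded (T : U -> Z) (E : set Z) :
  (forall a x y, T (a *: x + y) = a *: T x + T y) -> dense E ->
  (forall y, E y -> exists2 c, 0 <= c & forall u, `|rip (T u) y| <= c * nrm u) ->
  exists2 c, 0 <= c & forall u, nrm (T u) <= c * nrm u.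
Proof.
move=> Tl /denseP Ed Eb; apply: contrapT => nb.
have big (c : R) : 0 <= c -> exists u, c * nrm u < nrm (T u).
  move=> c0; apply: contrapT => h; apply: nb; exists c => // u.
  by rewrite leNgt; apply/negP => hu; apply: h; exists u.
have [|z hz] := @nested_balls (fun n z => n%:R <= nrm (T z)); last first.
  have := hz (Num.bound (nrm (T z))).
  by rewrite leNgt archi_boundP ?nrm_ge0.
move=> n x r r0.
have n0 : 0 <= n%:R :> R by [].
have [|u0 hu0] := big (n%:R / (r / 2)); first by rewrite divr_ge0 // divr_ge0 // ltW.
have u0n : 0 < nrm u0.
  rewrite lt_neqAle eq_sym nrm_ge0 andbT; apply: contraTneq hu0 => h.
  by rewrite (nrm0_eq0 h) (lin0 Tl) !nrm0 mulr0 ltxx.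
pose u := (r / 2 / nrm u0)%:C *: u0.
have un : nrm u = r / 2.
  by rewrite nrmZr ger0_norm ?divfK ?gt_eqF // divr_ge0 ?nrm_ge0 // divr_ge0 // ltW.
have Tu : n%:R < nrm (T u).
  rewrite (linZ Tl) nrmZr ger0_norm; last by rewrite divr_ge0 ?nrm_ge0 // divr_ge0 // ltW.
  rewrite -(ltr_pM2l (x := r / 2 / nrm u0)) in hu0; last by rewrite divr_gt0 // divr_gt0.
  apply: le_lt_trans hu0; apply: eqW.
  by field; rewrite !gt_eqF.
set t := nrm (T u) in Tu.
have t0 : 0 < t by exact: le_lt_trans Tu.
(* For this tolerance [n (t + e)] stays below [t ^+ 2 - t * e], with half of [t (t - n)] to spare;
   so some [y] in [E] can replace [T u] as the test vector. *)
have e0 : 0 < t * (t - n%:R) / (2 * (t + n%:R)).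
  by rewrite divr_gt0 ?mulr_gt0 ?subr_gt0 // ltr_wpDr.
have [y Ey hy] := Ed (T u) _ e0.
have tn : 0 < t + n%:R by rewrite ltr_wpDr.
have gap0 : n%:R * nrm y < rip (T u) y.
  set e := _ / _ in e0 hy.
  have he : e * (2 * (t + n%:R)) = t * (t - n%:R) by rewrite divfK // gt_eqF // mulr_gt0.
  have h1 : nrm y <= t + e.
    have := nrmB_ge y (T u); rewrite nrmBC -/t; lra.
  have h2 : t ^+ 2 - t * e <= rip (T u) y.
    have -> : y = T u - (T u - y) by rewrite opprB addrC subrK.
    rewrite ripBr -nrm_sq -/t lerD2l lerN2; apply: le_trans (ler_norm _) _.
    by apply: le_trans (rip_le _ _) _; rewrite -/t ler_pM2l // ltW.
  apply: lt_le_trans h2; apply: (@le_lt_trans _ _ (n%:R * (t + e))).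
    by rewrite ler_wpM2l.
  by nra.
(* [T u] is half the difference of [T (x + u)] and [T (x - u)], so one of these two pairs with [y]
   above the threshold. *)
have [x' xx' gap] : exists2 x', nrm (x' - x) = r / 2 & n%:R * nrm y < `|rip (T x') y|.
  have [h|h] := ltP (n%:R * nrm y) `|rip (T (x + u)) y|.
    by exists (x + u) => //; rewrite addrAC subrr add0r.
  exists (x - u); first by rewrite addrAC subrr add0r nrmN.
  have E2 : 2 * rip (T u) y = rip (T (x + u)) y - rip (T (x - u)) y.
    by rewrite (linD Tl) (linB Tl) ripDl ripBl; ring.
  move: h; rewrite ler_norml => /andP[h1 h2].
  rewrite ltr_normr; apply/orP; right; lra.
have [c c0 hc] := Eb y Ey.
pose g := `|rip (T x') y| - n%:R * nrm y.
have g0 : 0 < g by rewrite subr_gt0.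
have c1 : 0 < c + 1 by rewrite ltr_wpDl.
(* [T] is not known to be continuous, but [rip (T z) y] is, as [y] lies in [E]: on this ball it
   changes by at most the gap [g]. *)
exists x', (Order.min (r / 2) (g / (c + 1))); split.
- by rewrite lt_min !divr_gt0.
- by rewrite xx'; have : Order.min (r / 2) (g / (c + 1)) <= r / 2 by [rewrite ge_min lexx]; lra.
- by have : Order.min (r / 2) (g / (c + 1)) <= r / 2 by [rewrite ge_min lexx]; lra.
move=> z; rewrite le_min => /andP[_]; rewrite ler_pdivlMr // => hz.
have h1 : `|rip (T (z - x')) y| <= c * nrm (z - x') by exact: hc.
have h2 : n%:R * nrm y <= `|rip (T z) y|.
  have h3 : `|rip (T x') y| <= `|rip (T z) y| + `|rip (T (z - x')) y|.
    have -> : rip (T x') y = rip (T z) y - rip (T (z - x')) y.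
      by rewrite (linB Tl) ripBl; ring.
    by apply: le_trans (ler_normD _ _) _; rewrite normrN.
  have := nrm_ge0 (z - x'); rewrite /g in hz; nra.
have [y0|yn] := eqVneq (nrm y) 0.
  by move: gap; rewrite y0 mulr0 (nrm0_eq0 y0) rip0r normr0 ltxx.
have yp : 0 < nrm y by rewrite lt_neqAle eq_sym yn nrm_ge0.
by rewrite -(ler_pM2r yp); apply: le_trans h2 (rip_le _ _).
Qed.

End uniform_boundedness.

Section span.
Context {R : realType} {X : hilbertType R}.

Lemma lspan_subspace (E : set X) : subspace (lspan E).
Proof.
split.
- by exists 0%N, (fun=> 0), (fun=> 0); split; [case|rewrite big_ord0].
- move=> _ _ [n [a [v [Ev ->]]]] [m [b [w [Ew ->]]]].
  exists (n + m)%N, (fun i : 'I_(n + m) => match fintype.split i with inl j => a j | inr j => b j end).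
  exists (fun i : 'I_(n + m) => match fintype.split i with inl j => v j | inr j => w j end); split.
    by move=> i; case: (fintype.split i).
  rewrite big_split_ord /=; congr (_ + _); apply: eq_bigr => i _.
    by have -> : fintype.split (lshift m i) = inl i := unsplitK (inl i).
  by have -> : fintype.split (rshift n i) = inr i := unsplitK (inr i).
- move=> c _ [n [a [v [Ev ->]]]]; exists n, (fun i => c * a i), v; split => //.
  by rewrite scaler_sumr; apply: eq_bigr => i _; rewrite scalerA.
Qed.

Lemma lspan_min (E M : set X) : subspace M -> (forall x, E x -> M x) ->
  forall x, lspan E x -> M x.
Proof.
move=> [M0 MD MZ] EM _ [n [a [v [Ev ->]]]].
by apply: big_ind => // i _; apply: MZ; exact: EM.
Qed.

Lemma lspan_in (E : set X) x : E x -> lspan E x.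
Proof.
by move=> Ex; exists 1%N, (fun=> 1), (fun=> x); split => //; rewrite big_ord1 scale1r.
Qed.

End span.

(** * Reachable states and conservation of energy *)

Section reachability.
Context {R : realType} {X U Y : hilbertType R}.
Variable S : system X U Y.

Local Notation A := (sysA S).
Local Notation B := (sysB S).
Local Notation C := (sysC S).
Local Notation D := (sysD S).

Definition obs k (x : X) : Y := C (iter k A x).

Lemma obs_blin k : blin (obs k).
Proof. exact: (blin_comp (blin_iter k (bop_blin A)) (bop_blin C)). Qed.

Let Al := blin_lin (bop_blin A).
Let Bl := blin_lin (bop_blin B).
Let Cl := blin_lin (bop_blin C).
Let Dl := blin_lin (bop_blin D).

Lemma ImAB_subspace : subspace (ImAB S).
Proof. exact: lspan_subspace. Qed.

Lemma ImAB_A x : ImAB S x -> ImAB S (A x).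
Proof.
apply: (@lspan_min _ _ _ [set x | ImAB S (A x)]).
  have [L0 LD LZ] := ImAB_subspace; split=> /= [|v w hv hw|a v hv].
  - by rewrite (lin0 Al).
  - by rewrite (linD Al); exact: LD.
  - by rewrite (linZ Al); exact: LZ.
by move=> _ [n [u ->]] /=; apply: lspan_in; exists n.+1, u.
Qed.

Lemma ImAB_B u : ImAB S (B u).
Proof. by apply: lspan_in; exists 0%N, u. Qed.

Lemma traj_lin a u v n :
  traj S (fun k => a *: u k + v k) n = a *: traj S u n + traj S v n.
Proof.
elim: n => [|n ih] /=; first by rewrite scaler0 addr0.
by rewrite ih Al Bl scalerDr addrACA.
Qed.

Lemma traj_delay u n : traj S (fun k => if k is k'.+1 then u k' else 0) n.+1 = traj S u n.
Proof.
elim: n => [|n ih]; first by rewrite /= (lin0 Al) (lin0 Bl) addr0.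
by rewrite [LHS]/= -[X in A X + _]/(traj S _ n.+1) ih.
Qed.

Lemma ImAB_traj x : ImAB S x -> exists u N, x = traj S u N.
Proof.
(* Inputs of different lengths are added after delaying them by zeros to a common final time. *)
have delay u n m : exists v, traj S v (m + n) = traj S u n.
  elim: m => [|m [v hv]]; first by exists u.
  by exists (fun k => if k is k'.+1 then v k' else 0); rewrite addSn traj_delay.
apply: (@lspan_min _ _ _ [set x | exists u N, x = traj S u N]).
  split.
  - by exists (fun=> 0), 0%N.
  - move=> _ _ [u [n ->]] [v [m ->]].
    have [u' <-] := delay u n m; have [v' <-] := delay v m n.
    exists (fun k => 1 *: u' k + v' k), (m + n)%N.
    by rewrite traj_lin scale1r (addnC n).
  - move=> a _ [u [n ->]]; exists (fun k => a *: u k + 0), n.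
    rewrite (traj_lin a u (fun=> 0)); have -> : traj S (fun=> 0) n = 0.
      by elim: n => //= n ->; rewrite (lin0 Al) (lin0 Bl) addr0.
    by rewrite addr0.
move=> _ [n [u ->]]; exists (fun k => if k is 0%N then u else 0), n.+1.
elim: n => [|n ih]; first by rewrite /= (lin0 Al) add0r.
by rewrite iterS ih [RHS]/= (lin0 Bl) addr0.
Qed.

Variable theta : R[i] -> bop U Y.
Hypothesis real : is_realization S theta.
Hypothesis inn : inner theta.

Let q := qform obs.

(** Once the input is switched off at time [N], the outputs are [obs k x]; the energy identity
    splits at [N] into the past outputs and [q x x]. *)
Lemma traj_energy u N : qfin obs (traj S u N) /\
  q (traj S u N) (traj S u N) = \sum_(0 <= k < N) nrm (u k) ^+ 2
     - \sum_(0 <= k < N) nrm (outp S u k) ^+ 2.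
Proof.
pose v k := if (k < N)%N then u k else 0.
have v0 k : (N <= k)%N -> v k = 0 by move=> Nk; rewrite /v ltnNge Nk.
have tE k : (k <= N)%N -> traj S v k = traj S u k.
  by elim: k => [//|k ih] kN /=; rewrite ih 1?ltnW // /v kN.
have tE2 k : traj S v (k + N) = iter k A (traj S u N).
  elim: k => [|k ih]; first exact: tE.
  by rewrite addSn /= ih v0 ?leq_addl // (lin0 Bl) addr0.
set x := traj S u N.
have E := energy_identity real inn.1 v0 inn.2.
have yE m : \sum_(0 <= k < m + N) nrm (outp S v k) ^+ 2
    = \sum_(0 <= k < N) nrm (outp S u k) ^+ 2 + qsum obs m x x.
  rewrite (big_cat_nat _ (n := N)) ?leq_addl //=; congr (_ + _).
    by apply: eq_big_nat => k /andP[_ kN]; rewrite /outp tE 1?ltnW // /v kN.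
  rewrite -{1}[N]add0n big_addn addnK; apply: eq_bigr => k _.
  by rewrite /outp tE2 v0 ?leq_addl // (lin0 Dl) addr0 nrm_sq.
have uE : \sum_(0 <= k < N) nrm (v k) ^+ 2 = \sum_(0 <= k < N) nrm (u k) ^+ 2.
  by apply: eq_big_nat => k /andP[_ kN]; rewrite /v kN.
rewrite uE in E.
have E2 : \sum_(0 <= k < m + N) nrm (outp S v k) ^+ 2 @[m --> \oo]
    --> \sum_(0 <= k < N) nrm (u k) ^+ 2.
  by rewrite (cvg_shiftn N (fun m => \sum_(0 <= k < m) nrm (outp S v k) ^+ 2)).
have E3 : qsum obs m x x @[m --> \oo]
    --> \sum_(0 <= k < N) nrm (u k) ^+ 2 - \sum_(0 <= k < N) nrm (outp S u k) ^+ 2.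
  have -> : (fun m => qsum obs m x x) = fun m => \sum_(0 <= k < m + N) nrm (outp S v k) ^+ 2
      - \sum_(0 <= k < N) nrm (outp S u k) ^+ 2.
    by apply/funext => m; rewrite yE addrAC subrr add0r.
  by apply: cvgB => //; exact: cvg_cst.
split; last exact: qform_unique.
exists (\sum_(0 <= k < N) nrm (u k) ^+ 2 - \sum_(0 <= k < N) nrm (outp S u k) ^+ 2) => m.
exact: nondecreasing_cvgn_to_le (qsum_mono _ _) E3 m.
Qed.

Lemma ImAB_fin x : ImAB S x -> qfin obs x.
Proof. by move=> /ImAB_traj [u [N ->]]; have [] := traj_energy u N. Qed.

(** The input leading to [x] is prolonged by one step [u], and two instances of [traj_energy] are
    subtracted. *)
Lemma ImAB_energy x u : ImAB S x ->
  q (A x + B u) (A x + B u) + nrm (C x + D u) ^+ 2 = q x x + nrm u ^+ 2.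
Proof.
move=> /ImAB_traj [w [N ->]].
pose v k := if (k < N)%N then w k else u.
have tE k : (k <= N)%N -> traj S v k = traj S w k.
  by elim: k => [//|k ih] kN /=; rewrite ih 1?ltnW // /v kN.
have vN : v N = u by rewrite /v ltnn.
have -> : A (traj S w N) + B u = traj S v N.+1 by rewrite /= tE // vN.
have -> : C (traj S w N) + D u = outp S v N by rewrite /outp tE // vN.
have [_ ->] := traj_energy w N; have [_ ->] := traj_energy v N.+1.
rewrite !big_nat_recr //= vN.
have -> : \sum_(0 <= k < N) nrm (v k) ^+ 2 = \sum_(0 <= k < N) nrm (w k) ^+ 2.
  by apply: eq_big_nat => k /andP[_ kN]; rewrite /v kN.
have -> : \sum_(0 <= k < N) nrm (outp S v k) ^+ 2 = \sum_(0 <= k < N) nrm (outp S w k) ^+ 2.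
  by apply: eq_big_nat => k /andP[_ kN]; rewrite /outp tE 1?ltnW // /v kN.
by ring.
Qed.

Let T := sip_qform obs_blin.

(** Comparing the energy balances for [u] and [- u] isolates the mixed terms. *)
Lemma ImAB_cross x u : ImAB S x -> q (A x) (B u) + rip (C x) (D u) = 0.
Proof.
move=> hx; have fA := ImAB_fin (ImAB_A hx); have fB := ImAB_fin (ImAB_B u).
have h1 := ImAB_energy u hx; have h2 := ImAB_energy (- u) hx.
rewrite (linN Bl) (linN Dl) nrmN in h2.
rewrite /q (sipD T fA fB (sipMD T fA fB)) !(sipDr T fA fB) // in h1.
rewrite /q (sipB T fA fB (sipMB T fA fB)) !(sipBr T fA fB) // in h2.
rewrite nrm_sq ripDl !ripDr (ripC (D u)) (sipC T fB fA) in h1.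
rewrite nrm_sq ripBl !ripBr (ripC (D u)) (sipC T fB fA) in h2.
rewrite /q; lra.
Qed.

Lemma ImAB_input u v : q (B u) (B v) + rip (D u) (D v) = rip u v.
Proof.
have L0 : ImAB S 0 by case: ImAB_subspace.
have E w : q (B w) (B w) + nrm (D w) ^+ 2 = nrm w ^+ 2.
  have := ImAB_energy w L0; rewrite (lin0 Al) (lin0 Cl) !add0r => ->.
  have -> : q 0 0 = 0 by exact: (sip0 T (qfin0 obs_blin)).
  by rewrite add0r.
have fu := ImAB_fin (ImAB_B u); have fv := ImAB_fin (ImAB_B v).
have := E (u + v); rewrite (linD Bl) (linD Dl) !nrm_sq !ripDl !ripDr.
rewrite /q (sipD T fu fv (sipMD T fu fv)) !(sipDr T fu fv) // (sipC T fv fu).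
rewrite (ripC (D v)) (ripC v).
have := E u; have := E v; rewrite !nrm_sq /q; lra.
Qed.

Let qd := qdom obs (ImAB S).

Lemma qsum_A N x : qsum obs N (A x) (A x) = qsum obs N.+1 x x - rip (C x) (C x).
Proof.
rewrite {2}/qsum big_nat_recl //= addrAC subrr add0r /qsum.
by apply: eq_bigr => k _; rewrite /obs -iterSr.
Qed.

Lemma qfin_A x : qfin obs x -> qfin obs (A x).
Proof.
move=> [M hM]; exists M => N; rewrite qsum_A.
by have := hM N.+1; have := rip_ge0 (C x); lra.
Qed.

Lemma qform_A x : qfin obs x -> q (A x) (A x) = q x x - nrm (C x) ^+ 2.
Proof.
move=> hx; apply: qform_unique; under eq_cvg do rewrite qsum_A.
rewrite nrm_sq; apply: cvgB; last exact: cvg_cst.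
by rewrite (cvg_shiftS (fun N => qsum obs N x x)); exact: (qsum_cvg obs_blin).
Qed.

(** By [qsum_A] the form does not grow under [A], while the norm grows by at most [nA]; hence the
    factor [nA ^+ 2 + 1]. *)
Lemma qdom_A x : qd x -> qd (A x).
Proof.
move=> hx e e0; have [_ [nA nA0 hA]] := bop_blin A.
have c0 : 0 < nA ^+ 2 + 1 by rewrite ltr_wpDl ?sqr_ge0.
have [|v Lv xv] := hx (e / (nA ^+ 2 + 1)); first by rewrite divr_gt0.
exists (A v) => [|N]; first exact: ImAB_A.
rewrite -(linB Al) qsum_A.
have h1 := xv N.+1; rewrite ler_pdivlMr // in h1; apply: le_trans h1.
have h2 : nrm (A (x - v)) ^+ 2 <= nA ^+ 2 * nrm (x - v) ^+ 2.
  by rewrite -exprMn ler_pXn2r ?nnegrE ?mulr_ge0 ?nrm_ge0.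
have h3 := rip_ge0 (C (x - v)); have h4 := qsum_ge0 obs N.+1 (x - v).
have h5 := sqr_ge0 (nrm (x - v)); have h6 := sqr_ge0 nA.
have h7 := mulr_ge0 h6 h4.
by rewrite mulrDr mulr1 mulrDl; nra.
Qed.

Lemma qdom_cross x u : qd x -> q (A x) (B u) + rip (C x) (D u) = 0.
Proof.
move=> hx.
have F := qdom_fin obs_blin ImAB_fin.
have Q := qgform_sip obs_blin ImAB_subspace ImAB_fin.
have [v Lv vx] := qgform_core obs_blin ImAB_subspace ImAB_fin hx.
have fB := ImAB_fin (ImAB_B u).
apply/eqP; rewrite -sqrf_eq0 eq_le sqr_ge0 andbT.
(* The constant comes from (a + b)^2 <= 2 a^2 + 2 b^2 and Cauchy-Schwarz for each term:
   [q (A y) (A y) + |C y|^2] is [q y y], and [q (B u) (B u) + |D u|^2] is [|u|^2]. *)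
have l : 2 * nrm u ^+ 2 * qgform obs (v n - x) (v n - x) @[n --> \oo] --> (2 * nrm u ^+ 2 * 0 : R).
  by apply: cvgM => //; exact: cvg_cst.
rewrite mulr0 in l; apply: cvgr_to_ge l _; apply: nearW => n.
have hv := qdom_L obs_blin (Lv n).
have hB := qdomB obs_blin ImAB_subspace hv hx.
have fv := F _ hv; have fx := F _ hx; have fvx := F _ hB.
have -> : q (A x) (B u) + rip (C x) (D u)
   = - (q (A (v n - x)) (B u) + rip (C (v n - x)) (D u)).
  rewrite (linB Al) (linB Cl) ripBl /q (sipB T) //; [|exact: qfin_A..].
  by have := ImAB_cross u (Lv n); rewrite /q; lra.
rewrite sqrrN; move: (v n - x) fvx hB => y fy hy.
have h1 : q (A y) (B u) ^+ 2 <= q (A y) (A y) * q (B u) (B u).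
  by apply: (sip_CS T) => //; exact: qfin_A.
have h2 := rip_CS (C y) (D u).
have h3 := qform_A fy; have h4 := ImAB_input u u.
have h5 : 0 <= q (B u) (B u) by exact: (sip_ge0 T).
have h6 : 0 <= q (A y) (A y) by apply: (sip_ge0 T); exact: qfin_A.
have h7 := rip_ge0 (C y); have h8 := rip_ge0 (D u); have h9 := rip_ge0 y.
rewrite nrm_sq in h3; rewrite /qgform nrm_sq -/(q y y).
set a := q (A y) (B u) in h1 *; set b := rip (C y) (D u) in h2 *.
have h10 := sqr_ge0 (a - b).
have h11 := mulr_ge0 h6 h8; have h12 := mulr_ge0 h7 h5.
have h13 : 0 <= rip y y * rip u u by rewrite mulr_ge0 // rip_ge0.
by nra.
Qed.

End reachability.

(** * Existence and uniqueness *)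

Section square_roots.
Context {R : realType} {X : hilbertType R}.

Lemma psqrtP (T : pop X X) :
  (exists S, [/\ selfadjoint S, nonnegative S & (S \; S)%relation = T]) ->
  [/\ selfadjoint (psqrt T), nonnegative (psqrt T) & (psqrt T \; psqrt T)%relation = T].
Proof.
move=> [S hS]; exact: (@xgetI _ set0 [set S : pop X X |
  [/\ selfadjoint S, nonnegative S & (S \; S)%relation = T]] S hS).
Qed.

(** The default of the choice is the empty set, so a single point of [psqrt T] certifies that a root
    exists. For a member of [RI] the domain and range conditions supply such points. *)
Lemma psqrt_neq0 (T : pop X X) p : psqrt T p ->
  [/\ selfadjoint (psqrt T), nonnegative (psqrt T) & (psqrt T \; psqrt T)%relation = T].
Proof.
move=> Tp; apply: psqrtP; apply: contrapT => h; move: Tp; rewrite /psqrt xgetPN //.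
by move=> S hS; apply: h; exists S.
Qed.

Lemma dom_sqrt_bounded (S : pop X X) (f : X -> X) : selfadjoint S ->
  (S \; S)%relation = graph f ->
  (forall x, S.`1 x) /\ forall x y, rip (papp S x) (papp S y) = rip x (f y).
Proof.
move=> Ssa SS.
have h y : (S \; S)%relation (y, f y) by rewrite SS.
have D y : S.`1 y by have /(sqrt_relP Ssa) [] := h y.
by split=> // x y; have /(sqrt_relP Ssa) [_ ->] := h y.
Qed.

Lemma graph0_sqrt : exists S : pop X X,
  [/\ selfadjoint S, nonnegative S & (S \; S)%relation = graph (fun=> 0)].
Proof.
exists (graph (fun=> 0)).
have op : is_operator (graph (fun _ : X => 0 : X)).
  split => //.
  - by move=> a x y x' y'; rewrite /graph /= => -> ->; rewrite scaler0 addr0.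
  - by move=> x y y'; rewrite /graph /= => -> ->.
split.
- split => //.
  + by apply/denseP => x e e0; exists x; [exists 0|rewrite subrr nrm0].
  + apply/seteqP; split=> -[x y].
      move=> /(padjoint_rip _ _ (is_operatorZ op)) h; rewrite /graph /=.
      by apply: rip_eq0; have := h y 0 erefl; rewrite rip0l.
    rewrite /graph /= => ->; apply/(padjoint_rip _ _ (is_operatorZ op)) => v w.
    by rewrite /graph /= => ->; rewrite rip0l rip0r.
- by move=> x y; rewrite /graph /= => ->; rewrite linear0l.
- apply/seteqP; split=> -[x y]; first by case.
  by rewrite /graph /= => ->; exists 0.
Qed.

(** Serves inequality (4) once [delta] is 0: values of the pseudo-inverse lie in the closure of the
    range, here {0}. *)
Lemma mpinv_graph0 : papp (mpinv (psqrt (graph (fun=> 0 : X)))) 0 = 0.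
Proof.
have [Ssa _ SS] := psqrtP graph0_sqrt.
set S := psqrt _ in Ssa SS *.
have [SD SE] := dom_sqrt_bounded Ssa SS.
have S0 x y : S (x, y) -> y = 0.
  by move=> /(pappE Ssa) <-; apply: rip_eq0; rewrite SE rip0r.
rewrite /papp; case: xgetP => // y _ [y' [z [_ _ hc _]]].
apply: nrm0_eq0; apply/eqP; rewrite eq_le nrm_ge0 andbT; apply/ler_addgt0Pr => e e0.
have [|w [[x Sxw]]] := hc (ball y e%:C).
  by apply: nbhsx_ballx; rewrite ltcR.
rewrite (S0 _ _ Sxw) -ball_normE /= subr0 normE ltcR => /ltW.
by rewrite add0r.
Qed.

Lemma ltr_graph_norm (p : X * X) (e : R[i]) : 0 < e ->
  nrm p.1 ^+ 2 + nrm p.2 ^+ 2 < Re e ^+ 2 -> graph_norm p < e.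
Proof.
move=> e0 h; have er : e = (Re e)%:C by rewrite RRe_real // gtr0_real.
rewrite /graph_norm -(ltr_pXn2r (n := 2)) ?nnegrE ?sqrtC_ge0 ?(ltW e0) ?addr_ge0 ?exprn_ge0 //.
by rewrite sqrtCK !normE -!rmorphXn -rmorphD er -rmorphXn ltcR.
Qed.

Lemma graph_norm_lt (p : X * X) (e : R) : graph_norm p < e%:C ->
  nrm p.1 ^+ 2 + nrm p.2 ^+ 2 < e ^+ 2.
Proof.
move=> h; have g0 : 0 <= graph_norm p by rewrite sqrtC_ge0 addr_ge0 ?exprn_ge0.
have e0 : 0 < e%:C := le_lt_trans g0 h.
move: h; rewrite -(ltr_pXn2r (n := 2)) ?nnegrE ?(ltW e0) //.
by rewrite /graph_norm sqrtCK !normE -!rmorphXn -rmorphD ltcR.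
Qed.

End square_roots.

Section main.
Context {R : realType} {X U Y : hilbertType R}.
Variable S : system X U Y.

Local Notation A := (sysA S).
Local Notation B := (sysB S).
Local Notation C := (sysC S).
Local Notation D := (sysD S).

Let Al := blin_lin (bop_blin A).
Let Bl := blin_lin (bop_blin B).
Let Cl := blin_lin (bop_blin C).
Let Dl := blin_lin (bop_blin D).

Variable theta : R[i] -> bop U Y.
Hypothesis real : is_realization S theta.
Hypothesis inn : inner theta.
Hypothesis Smin : minimal S.

Local Notation c := (obs S).
Local Notation L := (ImAB S).
Local Notation q := (qform c).
Local Notation qd := (qdom c L).

Let cb := @obs_blin R X U Y S.
Let Ls := @ImAB_subspace R X U Y S.
Let Lf := @ImAB_fin R X U Y S theta real inn.
Let T := sip_qform cb.
Let F x (h : qd x) : qfin c x := qdom_fin cb Lf h.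

Lemma obs_inj x : (forall k, c k x = 0) -> x = 0.
Proof.
move=> h; have : KerCA S x by move=> k _; exact: h.
by rewrite Smin.2.
Qed.

(** * Existence: the operator of the closed form belongs to the class *)

Section existence.
Variable H : pop X X.
Hypothesis Hsa : selfadjoint H.
Hypothesis HS : exists S, [/\ selfadjoint S, nonnegative S & (S \; S)%relation = H].
Hypothesis HE : forall x z, H (x, z) <-> qd x /\ forall v, qd v -> q v x = rip v z.
Hypothesis HF : forall S, selfadjoint S -> (S \; S)%relation = H ->
   (forall x, S.`1 x <-> qd x) /\
   (forall x y, qd x -> qd y -> rip (papp S x) (papp S y) = q x y).

Local Notation s := (papp (psqrt H)).

Let Ssa : selfadjoint (psqrt H). Proof. by have [] := psqrtP HS. Qed.
Let SS : (psqrt H \; psqrt H)%relation = H. Proof. by have [] := psqrtP HS. Qed.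
Let SD x : (psqrt H).`1 x <-> qd x. Proof. exact: (HF Ssa SS).1. Qed.
Let SF x y : qd x -> qd y -> rip (s x) (s y) = q x y. Proof. exact: (HF Ssa SS).2. Qed.
Let dL x : L x -> qd x. Proof. exact: (qdom_L cb). Qed.
Let dB u : qd (B u). Proof. by apply: dL; exact: ImAB_B. Qed.

Lemma qdom_hB_blin : blin (hB S H).
Proof.
split.
  move=> a x y; rewrite /hB Bl pappP_lin //; exact/SD.
exists 1 => // u; rewrite mul1r -(ler_pXn2r (n := 2)) ?nnegrE ?nrm_ge0 // !nrm_sq.
rewrite SF // -(ImAB_input real inn u u); first by rewrite lerDl rip_ge0.
Qed.

Lemma qdom_delta u : delta S H u = 0.
Proof.
apply: rip_eqP => v; rewrite /delta !ripBr -(adjoint_rip _ _ (bop_blin D)).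
rewrite -(adjoint_rip _ _ qdom_hB_blin) /hB SF // -(ImAB_input real inn v u).
by ring.
Qed.

Lemma qdom_crossop x : qd x -> crossop S H x = 0.
Proof.
move=> hx; apply: rip_eqP => u; rewrite /crossop ripDr.
rewrite -(adjoint_rip _ _ (bop_blin D)) -(adjoint_rip _ _ qdom_hB_blin) /hB.
have hA : qd (A x) by exact: (qdom_A hx).
rewrite SF // (ripC (D u)) qformC addrC.
exact: (qdom_cross real inn).
Qed.

Lemma qdom_RI : RI S H.
Proof.
have dE : delta S H = fun=> 0 by apply/funext => u; exact: qdom_delta.
have sdE : sqrt_delta S H = psqrt (graph (fun=> 0)) by rewrite /sqrt_delta dE.
split.
- exact: Hsa.
- move=> x y Hxy x0; have [hx hy] := (HE x y).1 Hxy.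
  have ge : 0 < rip y x.
    rewrite ripC -hy // lt_neqAle (sip_ge0 T) ?andbT; last exact: F.
    by apply: contra_neqN x0 => /eqP/esym; apply: (qform_eq0 cb Lf obs_inj).
  (* Symmetry makes [ip y x] real, as the strict order of [R[i]] requires. *)
  have im : ip y x = ip x y.
    by have [_ _ adj] := Hsa; have : padjoint H (x, y) by [rewrite adj]; exact.
  rewrite ipE ltcE /= ge andbT oppr_eq0; apply/eqP.
  have : rip ('i *: y) x = - rip ('i *: y) x.
    by rewrite !rip_il {1}im ipC; case: (ip y x).
  by lra.
- by move=> x /SD hx; apply/SD; exact: (qdom_A hx).
- by move=> u; apply/SD.
- by rewrite dE; exact: cst_continuous.
- by move=> u; rewrite qdom_delta linear0l.
- move=> x /SD hx; rewrite sdE qdom_crossop //.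
  have [[[S0 _ _] _ _] _ _] := psqrtP (@graph0_sqrt _ U).
  by exists 0.
- move=> x /SD hx; have hA : qd (A x) := qdom_A hx.
  rewrite sdE qdom_crossop // mpinv_graph0 normr0 expr0n /=.
  rewrite !normE -!rmorphXn -!rmorphB ler0c !nrm_sq !SF //.
  by rewrite (qform_A (F hx)) nrm_sq opprB [_ + (_ - _)]addrC subrK subrr.
Qed.

(** On [qd] the graph norm of the root is the form norm, for which [L] is dense by construction. *)
Lemma qdom_sqrt_approx x : qd x -> exists2 v : nat -> X, (forall n, L (v n)) &
  nrm (v n - x) ^+ 2 + nrm (s (v n) - s x) ^+ 2 @[n --> \oo] --> (0 : R).
Proof.
move=> hx; have [v Lv vx] := qgform_core cb Ls Lf hx; exists v => //.
under eq_cvg => n.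
  have hv := dL (Lv n); have hB := qdomB cb Ls hv hx.
  rewrite -(pappB Ssa); [|exact/SD..].
  rewrite !nrm_sq SF // -/(qgform c _ _).
  over.
exact: vx.
Qed.

Lemma qdom_core : is_core L (psqrt H).
Proof.
split; first by move=> x /dL hx; apply/SD.
move=> [x y] Sxy e e0; have hx : qd x by apply/SD; exists y.
have [v Lv vx] := qdom_sqrt_approx hx.
have e1 : 0 < Re e by rewrite -ltcR RRe_real // gtr0_real.
have /cvgr0Pnorm_lt/(_ (Re e ^+ 2)) := vx; rewrite exprn_gt0 // => /(_ isT) [N _ hN].
exists (v N, s (v N)); split => //=.
  by apply: pappP; apply/SD; exact: dL.
apply: ltr_graph_norm => //=; rewrite -(pappE Ssa Sxy) nrmBC (nrmBC (s x)).
exact: le_lt_trans (ler_norm _) (hN N (leqnn N)).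
Qed.

(** A vector orthogonal to this image is, by graph norm approximation, orthogonal to the whole range
    of the root; hence it lies in the kernel, which is trivial by [obs_inj]. *)
Lemma qdom_dense_range : dense (pimage (psqrt H) L).
Proof.
apply: dense_subspace; first by have [/operator_linear op _ _] := Ssa; exact: pimage_subspace.
move=> v hv.
suff Sv : psqrt H (v, 0).
  have dv : qd v by apply/SD; exists 0.
  apply: (qform_eq0 cb Lf obs_inj dv).
  by rewrite -SF // (pappE Ssa Sv) rip0l.
apply/(selfadjointP Ssa) => x /SD hx; rewrite rip0r.
have [w Lw wx] := qdom_sqrt_approx hx.
have l : rip (s (w n)) v @[n --> \oo] --> rip (s x) v.
  apply: rip_cvgl; apply: (@sqr_cvgn0 _ _ _ 1 wx) => n.
  by rewrite mul1r lerDr sqr_ge0.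
apply: cvgn_cst_eq l _ => n; apply: hv; exists (w n) => //.
by apply: pappP; apply/SD; exact: dL.
Qed.

Lemma iter_adjoint_rip n x y : rip (c n x) y = rip x (iter n (adjoint A) (adjoint C y)).
Proof.
rewrite /obs (adjoint_rip _ _ (bop_blin C)); move: (adjoint C y) => z.
elim: n z => [|n ih] z //; rewrite iterS (adjoint_rip _ _ (bop_blin A)) ih.
by rewrite -iterSr.
Qed.

(* [A^*n C^* y] is in the range of [H^(1/2)], because [x |-> <C A^n x, y>] is bounded
   by [|H^(1/2) x| |y|]. *)
Lemma adjoint_in_range n y : exists w, psqrt H (w, iter n (adjoint A) (adjoint C y)).
Proof.
have bS : sip (psqrt H).`1 (fun v w => rip (s v) (s w)).
  have [D0 DD DZ] := selfadjoint_dom Ssa.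
  split => //.
  - by move=> r v; exact: DZ.
  - by move=> v w _ _; exact: ripC.
  - by move=> u v w hu hv _; rewrite (pappD Ssa) // ripDl.
  - by move=> r v w hv _; rewrite (pappZ Ssa) // ripZl.
  - by move=> v _; exact: rip_ge0.
have cl k := blin_lin (cb k).
have [||||u [Du uC hu]] := @riesz_sequence _ _ _ _ bS (fun v => rip (c n v) y) (rip y y).
- exact: rip_ge0.
- by move=> v w _ _; rewrite (linD (cl n)) ripDl.
- by move=> r v _; rewrite (linZ (cl n)) ripZl.
- move=> v /SD hv; apply: le_trans (rip_CS _ _) _; rewrite mulrC ler_wpM2l ?rip_ge0 //.
  rewrite SF //; apply: le_trans (qsum_le_qform n.+1 (F hv)).
  by rewrite /qsum big_nat_recr //= lerDr qsum_ge0.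
have [w sw] : exists w, nrm (s (u k) - w) @[k --> \oo] --> (0 : R).
  apply: (@sip_cauchy_rip _ _ (s \o u)) => e /uC [N hN]; exists N => i j Ni Nj /=.
  by rewrite -(pappB Ssa) //; exact: hN.
exists w; apply/(selfadjointP Ssa) => v Dv; rewrite -iter_adjoint_rip.
suff h2 : rip (s v) (s (u k)) @[k --> \oo] --> rip (s v) w.
  exact: cvgn_uniq h2 (hu v Dv).
by under eq_cvg do rewrite ripC; rewrite ripC; exact: rip_cvgl.
Qed.

(** Let [v] be orthogonal to all these preimages, and approximate it by [s (x n)] with [x n] in [L].
    The partial sums of [q y (x n)] pair [s y] with preimages, which do not see [v]. This yields |s
    (x n)| <= |s (x n) - v|, and [v = 0] in the limit. *)
Lemma qdom_dense_inverse : dense (pimage (psqrt H)^-1%relation (ImAC S)).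
Proof.
apply: dense_subspace.
  have [/operator_linear op _ _] := Ssa; apply: pimage_subspace; first exact: linear_relationV.
  exact: lspan_subspace.
move=> v hv.
have hv2 n y w : psqrt H (w, iter n (adjoint A) (adjoint C y)) -> rip w v = 0.
  move=> hw; apply: hv; exists (iter n (adjoint A) (adjoint C y)) => //.
  by apply: lspan_in; exists n, y.
have [z Lz zv] := dense_seq v qdom_dense_range.
have hx n : exists x, L x /\ psqrt H (x, z n) by have [x Lx Sx] := Lz n; exists x.
have [x hx'] := choice hx.
have Lx n : L (x n) by case: (hx' n).
have sx n : s (x n) = z n by apply: (pappE Ssa); case: (hx' n).
have key n : nrm (s (x n)) <= nrm (s (x n) - v).
  have dx := dL (Lx n).
  have main : q (x n) (x n) <= nrm (s (x n) - v) * nrm (s (x n)).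
    apply: (qform_le (F dx)) => N.
    have [W hW] := choice (fun k => adjoint_in_range k (c k (x n))).
    pose WN := \sum_(0 <= k < N) W k.
    have hWN y : L y -> rip (s y) WN = qsum c N y (x n).
      move=> Ly; rewrite ripC /rip linear_sumlz /= Re_sum; apply: eq_bigr => k _.
      rewrite -/(rip _ _) ripC iter_adjoint_rip.
      have [/(_ (hW k)) h _] := selfadjointP Ssa (W k) (iter k (adjoint A) (adjoint C (c k (x n)))).
      by apply: h; apply/SD; exact: dL.
    have vW : rip v WN = 0.
      rewrite ripC /rip linear_sumlz /= Re_sum big1 // => k _.
      exact: (hv2 _ _ _ (hW k)).
    (* The vectors [z m], which lie in the range of the root, stand in for [v]; as [v] is orthogonal
       to [WN], [rip (z m) WN] is [rip (z m - v) WN] and tends to 0. *)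
    have l : rip (z m - v) WN + nrm (s (x n) - z m) * nrm (s (x n)) @[m --> \oo]
        --> rip (v - v) WN + nrm (s (x n) - v) * nrm (s (x n)).
      apply: cvgD.
        apply: rip_cvgl; under eq_cvg do rewrite subrr subr0.
        exact: zv.
      apply: cvgM; last exact: cvg_cst.
      apply: nrm_cvg; under eq_cvg do rewrite opprB addrC addrA subrK nrmBC.
      exact: zv.
    rewrite subrr rip0l add0r in l; apply: cvgr_to_ge l _.
    apply: nearW => m.
    rewrite ripBl vW subr0 -sx hWN //.
    have dB' : qd (x n - x m) by apply: qdomB => //; exact: dL.
    have E : qsum c N (x n) (x n) = qsum c N (x m) (x n) + qsum c N (x n - x m) (x n).
      by rewrite (sipB (sip_qsum cb N)) // addrC subrK.
    rewrite E lerD2l; apply: le_trans (ler_norm _) _.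
    rewrite -(ler_pXn2r (n := 2)) ?nnegrE ?mulr_ge0 ?nrm_ge0 //.
    rewrite real_normK ?num_real // exprMn !nrm_sq.
    apply: le_trans (sip_CS (sip_qsum cb N) _ _) _ => //.
    rewrite -(pappB Ssa); [|by apply/SD; exact: dL..].
    rewrite !SF //; apply: ler_pM; rewrite ?qsum_ge0 //; apply: qsum_le_qform; exact: F.
  have [->|n0] := eqVneq (nrm (s (x n))) 0; first exact: nrm_ge0.
  have np : 0 < nrm (s (x n)) by rewrite lt_neqAle eq_sym n0 nrm_ge0.
  by rewrite -(ler_pM2r np) -expr2 nrm_sq SF.
apply: nrm0_eq0; apply/eqP; rewrite eq_le nrm_ge0 andbT.
have l1 : nrm (z n) @[n --> \oo] --> nrm v by exact: nrm_cvg.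
apply: ler_cvg_to l1 zv _.
by apply: nearW => n; rewrite -sx.
Qed.

Lemma qdom_RIcirc : RIcirc S H.
Proof.
split; [exact: qdom_RI|exact: qdom_dense_range|exact: qdom_dense_inverse|exact: qdom_core].
Qed.

End existence.

(** * Uniqueness: every member of the class has the same form *)

Section uniqueness.
Variable H : pop X X.
Hypothesis HRI : RI S H.
Hypothesis Hcore : is_core L (psqrt H).

Local Notation s := (papp (psqrt H)).

Let DB u : (psqrt H).`1 (B u). Proof. exact: RI_domB HRI u. Qed.
Let DA x : (psqrt H).`1 x -> (psqrt H).`1 (A x). Proof. exact: (RI_domA HRI). Qed.
Let Sspec : [/\ selfadjoint (psqrt H), nonnegative (psqrt H) & (psqrt H \; psqrt H)%relation = H].
Proof. by have [y hy] := DB 0; exact: psqrt_neq0 hy. Qed.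
Let Ssa : selfadjoint (psqrt H). Proof. by case: Sspec. Qed.

(** For [y] in the dense domain of the root, [rip (hB S H u) y] is [rip (B u) (s y)], bounded in
    [u]; uniform boundedness applies. This gives access to the adjoints inside [delta] and
    [crossop]. *)
Lemma RI_hB_blin : blin (hB S H).
Proof.
have hl a x y : hB S H (a *: x + y) = a *: hB S H x + hB S H y.
  by rewrite /hB Bl (pappP_lin Ssa).
split => //.
have [_ Dd _] := Ssa.
apply: (weakly_bounded hl Dd) => y Dy.
have [_ [b b0 hb]] := bop_blin B.
exists (b * nrm (s y)) => [|u]; first by rewrite mulr_ge0 ?nrm_ge0.
rewrite /hB (papp_sym Ssa) //; apply: le_trans (rip_le _ _) _.
by rewrite mulrAC ler_wpM2r ?nrm_ge0.
Qed.

Local Notation sd := (papp (sqrt_delta S H)).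

Let D0 : (psqrt H).`1 0.
Proof. by case: (selfadjoint_dom Ssa). Qed.

Let dspec : [/\ selfadjoint (sqrt_delta S H), nonnegative (sqrt_delta S H)
  & (sqrt_delta S H \; sqrt_delta S H)%relation = graph (delta S H)].
Proof. by have [w hw] := RI_range HRI D0; exact: psqrt_neq0 hw. Qed.
Let dsa : selfadjoint (sqrt_delta S H). Proof. by case: dspec. Qed.
Let dD u : (sqrt_delta S H).`1 u.
Proof. by have [_ _ h] := dspec; exact: (dom_sqrt_bounded dsa h).1. Qed.
Let dE u v : rip (sd u) (sd v) = rip u (delta S H v).
Proof. by have [_ _ h] := dspec; exact: (dom_sqrt_bounded dsa h).2. Qed.

(** Projecting a preimage of [crossop S H x] on the closure of the range changes it by a kernel
    vector, so the pseudo-inverse has a value there. For the chosen value, the remaining component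
    [z] is both in the range and in the kernel of a symmetric operator, hence 0. *)
Lemma mpinv_crossop x : (psqrt H).`1 x ->
  sd (papp (mpinv (sqrt_delta S H)) (crossop S H x)) = crossop S H x.
Proof.
move=> /(RI_range HRI) [w hw].
set M := (sqrt_delta S H).`2.
have Ms : subspace M by have [/operator_linear op _ _] := dsa; exact: range_subspace.
have [p hp [u Mu up]] := projection_sequence w Ms.
have hp2 : sqrt_delta S H (p, crossop S H x).
  have <- : sd p = crossop S H x; last exact: pappP.
  rewrite -(pappE dsa hw); apply/esym/subr0_eq; rewrite -(pappB dsa) //.
  apply: rip_inj => z; rewrite rip0r -(papp_sym dsa) //; apply: hp.
  by exists z; exact: pappP.
have mp : mpinv (sqrt_delta S H) (crossop S H x, p).
  exists (crossop S H x), 0; split => //=; first by rewrite addr0.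
    exact: closure_seq Mu up.
  by have [[]] := dsa.
have := @xgetI _ 0 [set y | mpinv (sqrt_delta S H) (crossop S H x, y)] p mp.
rewrite -/(papp _ _) /= => -[y [z [/= xyz Sy _ Sz]]].
move: Sy; set p' := papp _ _ => Sy; rewrite (pappE dsa Sy).
suff z0 : z = 0 by rewrite xyz z0 addr0.
have zE : z = sd (w - p').
  by rewrite (pappB dsa) // (pappE dsa hw) (pappE dsa Sy) xyz addrAC subrr add0r.
apply: rip_eq0; rewrite {1}zE (papp_sym dsa) // (pappE dsa Sz) rip0r.
by [].
Qed.

(** A Schur complement: with [p] the pseudo-inverse applied to [crossop S H x], the energy loss is
    at least [|p|^2 - 2 <sd u, p> + |sd u|^2], the square of the norm of [p - sd u]. *)
Lemma RI_passive x u : (psqrt H).`1 x ->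
  nrm (s (A x + B u)) ^+ 2 + nrm (C x + D u) ^+ 2 <= nrm (s x) ^+ 2 + nrm u ^+ 2.
Proof.
move=> Dx; have hb := RI_hB_blin.
have hE : delta S H u = u - adjoint D (D u) - adjoint (hB S H) (hB S H u) by [].
have h1 : rip u (delta S H u) = nrm u ^+ 2 - nrm (D u) ^+ 2 - nrm (s (B u)) ^+ 2.
  by rewrite hE !ripBr -(adjoint_rip _ _ (bop_blin D)) -(adjoint_rip _ _ hb) !nrm_sq.
set p := papp (mpinv (sqrt_delta S H)) (crossop S H x).
have h2 : nrm p ^+ 2 <= nrm (s x) ^+ 2 - nrm (s (A x)) ^+ 2 - nrm (C x) ^+ 2.
  by have := RI_ineq HRI Dx; rewrite !normE -!rmorphXn -!rmorphB lecR.
have h3 : rip u (crossop S H x) = rip (D u) (C x) + rip (s (B u)) (s (A x)).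
  by rewrite /crossop ripDr -(adjoint_rip _ _ (bop_blin D)) -(adjoint_rip _ _ hb).
have h4 : rip u (crossop S H x) = rip (sd u) p.
  by rewrite -(mpinv_crossop Dx) (papp_sym dsa).
have h5 := rip_ge0 (p - sd u).
rewrite ripBl !ripBr (ripC p) dE -!nrm_sq in h5.
rewrite (pappD Ssa) //; last exact: DA.
rewrite [nrm (s (A x) + _) ^+ 2]nrm_sq [nrm (C x + _) ^+ 2]nrm_sq !ripDl !ripDr -!nrm_sq.
rewrite (ripC (s (A x))) (ripC (C x)).
by lra.
Qed.

Lemma RI_ImAB_norm x : L x -> nrm (s x) ^+ 2 = q x x.
Proof.
move=> Lx; have Dx : (psqrt H).`1 x by exact: Hcore.1.
apply/eqP; rewrite eq_le; apply/andP; split.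
  have [u [N xE]] := ImAB_traj Lx; rewrite xE.
  have [_ ->] := traj_energy real inn u N.
  suff [_] : (psqrt H).`1 (traj S u N) /\ nrm (s (traj S u N)) ^+ 2 <=
    \sum_(0 <= k < N) nrm (u k) ^+ 2 - \sum_(0 <= k < N) nrm (outp S u k) ^+ 2 by [].
  elim: N {xE} => [|N [ih1 ih2]].
    by split; rewrite ?big_geq // (papp0 Ssa) nrm0 expr0n subrr.
  have [_ DD _] := selfadjoint_dom Ssa.
  split; first by apply: DD => //; exact: DA.
  have := RI_passive (u N) ih1; rewrite !big_nat_recr //= /outp.
  by move: ih2; lra.
apply: (qform_le (Lf Lx)) => N.
suff [_] : (psqrt H).`1 (iter N A x) /\
    qsum c N x x + nrm (s (iter N A x)) ^+ 2 <= nrm (s x) ^+ 2.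
  by apply: le_trans; rewrite lerDl sqr_ge0.
elim: N => [|N [ih1 ih2]]; first by rewrite /qsum big_geq // add0r.
split; first exact: DA.
have := RI_passive 0 ih1; rewrite (lin0 Bl) (lin0 Dl) !addr0 nrm0 expr0n addr0.
rewrite [qsum c N.+1 x x]/qsum big_nat_recr //= -/(qsum c N x x) -nrm_sq /obs.
by move: ih2; lra.
Qed.

Lemma RI_form : (forall x, (psqrt H).`1 x <-> qd x) /\
  (forall x y, qd x -> qd y -> rip (s x) (s y) = q x y).
Proof.
have F1 := gform_cform Ssa; have F2 := qgform_cform cb Ls Lf.
have LD1 v : L v -> (psqrt H).`1 v by exact: Hcore.1.
have LD2 v : L v -> qd v by exact: (qdom_L cb).
have LB v w : L v -> L w -> L (v - w) by exact: subspaceB.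
have E v : L v -> gform (psqrt H) v v = qgform c v v.
  by move=> Lv; rewrite /gform /qgform -RI_ImAB_norm // nrm_sq.
(* The core condition supplies approximants in [L] for the graph norm; for the converse inclusion,
   [L] is dense in [qd] by construction. *)
have h1 x : (psqrt H).`1 x -> qd x /\ gform (psqrt H) x x = qgform c x x.
  move=> Dx.
  have hv n : exists v, L v /\ gform (psqrt H) (v - x) (v - x) <= n.+1%:R^-1 ^+ 2.
    have [|[v w] [/= Svw Lv h]] := Hcore.2 (x, s x) (pappP Dx) (n.+1%:R^-1)%:C.
      by rewrite ltcR invr_gt0.
    exists v; split => //; have Dv := LD1 v Lv.
    rewrite /gform (pappB Ssa) // -!nrm_sq (pappE Ssa Svw) nrmBC (nrmBC w).
    exact/ltW/(graph_norm_lt h).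
  have [v hv'] := choice hv.
  have Lv n : L (v n) by case: (hv' n).
  apply: (cform_transfer F1 F2 LD1 LD2 LB E Lv Dx).
  have l : n.+1%:R^-1 * n.+1%:R^-1 @[n --> \oo] --> (0 * 0 : R).
    by apply: cvgM; exact: cvg_harmonic.
  rewrite mulr0 in l; apply: squeeze_cvgr (cvg_cst 0) l; apply: nearW => n.
  have [_] := hv' n; rewrite expr2 => ->; rewrite andbT.
  apply: (sip_ge0 (cform_sip F1)); apply: subspaceB => //; first exact: (selfadjoint_dom Ssa).
  exact: LD1.
have h2 x : qd x -> (psqrt H).`1 x.
  move=> hx; have [v Lv vx] := qgform_core cb Ls Lf hx.
  have E' w : L w -> qgform c w w = gform (psqrt H) w w by move=> /E ->.
  by have [] := cform_transfer F2 F1 LD2 LD1 LB E' Lv hx vx.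
split=> [x|x y hx hy]; first by split=> [/h1[]|/h2].
have hxD := qdomD cb Ls hx hy; have hxB := qdomB cb Ls hx hy.
have : gform (psqrt H) x y = qgform c x y.
  rewrite (sip_polar (cform_sip F2)) //.
  rewrite (sip_polar (cform_sip F1)); [|exact: h2..].
  by rewrite (h1 _ (h2 _ hxD)).2 (h1 _ (h2 _ hxB)).2.
by rewrite /qgform /gform => /addrI.
Qed.

(** The right side no longer mentions [H] and is the description in [qform_operator], so the graphs
    coincide. *)
Lemma RI_graph x z : H (x, z) <-> qd x /\ forall v, qd v -> q v x = rip v z.
Proof.
have [SD SF] := RI_form; have [_ _ <-] := Sspec.
rewrite (sqrt_relP Ssa); split=> -[hx h].
  have hx' : qd x by exact/SD.
  by split=> // v hv; rewrite -SF // h //; exact/SD.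
split; first exact/SD.
by move=> v /SD hv; rewrite SF // h.
Qed.

End uniqueness.

Lemma RIcirc_unique : exists H, RIcirc S = [set H] /\ forall u, delta S H u = 0.
Proof.
have Ld : dense L := Smin.1.
have [H [Hsa HS HE HF]] := qform_operator cb Ls Lf Ld.
exists H; split; last by move=> u; exact: (qdom_delta HS HF).
apply/seteqP; split=> [H' [HRI _ _ Hcore]|_ ->]; last exact: (qdom_RIcirc Hsa HS HE HF).
by apply/seteqP; split=> -[x z]; rewrite HE (RI_graph HRI Hcore).
Qed.

End main.

Theorem theorem5p4 (R : realType) (X U Y : hilbertType R)
    (sX : separable X) (sU : separable U) (sY : separable Y)
    (Sigma : system X U Y) (theta : R[i] -> bop U Y)
    (theta_inner : inner theta)
    (Sigma_minimal : minimal Sigma)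
    (Sigma_theta : is_realization Sigma theta) :
  exists H0 : pop X X,
    RIcirc Sigma = [set H0] /\ forall u : U, delta Sigma H0 u = 0.
Proof. exact: RIcirc_unique Sigma_theta theta_inner Sigma_minimal. Qed.
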